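(* Let $\epsilon_n\to0$ be a sequence of positive horizons and $\mathbf{b}^{\epsilon_n}(t)$ the associated body forces defined in the context. There is a positive constant $C$ independent of $\epsilon_n$ and $t\in[0,T]$ such that $$|\langle\mathbf{b}^{\epsilon_n}(t),\mathbf{w}\rangle|\le C\|\mathbf{w}\|_{H^1(D,\mathbb{R}^2)}\quad\text{for all }\epsilon_n>0\text{ and }\mathbf{w}\in\dot H^1(D,\mathbb{R}^2).$$ In addition there exists $\mathbf{b}^0(t)$ such that $\mathbf{b}^{\epsilon_n}\rightharpoonup\mathbf{b}^0$ in $L^2(0,T;\dot H^1(D;\mathbb{R}^2)')$ and $$\langle\mathbf{b}^0(t),\mathbf{w}\rangle=\langle\mathbf{g}(t),\mathbf{w}\rangle:=\int_{\partial D}\mathbf{g}(t)\cdot\mathbf{w}\,d\sigma$$ for all $\mathbf{w}\in\dot H^1(D,\mathbb{R}^2)$, and $\mathbf{g}(t)\in H^{-1/2}(\partial D)^2$.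
   Context: $a,b,T>0$ are constants. $D\subset\{0<x_1<a,\ -b/2<x_2<b/2\}$ is the open rectangle with rounded corners (radius of curvature $\theta$) from which a thin notch has been removed; the notch originates on the left side, is centered on the axis $x_2=0$, has thickness $2d$, total length $\ell(0)$, a circular tip at $(\ell(0),0)$ and rounded corners. $D$ has Lipschitz boundary and is symmetric about $x_2=0$; its flat top and bottom edges are $\{\theta\le x_1\le a-\theta,\ x_2=\pm b/2\}$. $\mathbf{e}^2$ is the unit vertical vector. Let $g(x_1,t)>0$ be smooth and bounded in $x_1$ and $t$. For $\epsilon>0$ the body force is $\mathbf{b}^\epsilon(\mathbf{x},t)=\mathbf{e}^2\epsilon^{-1}g(x_1,t)\chi^\epsilon_+(\mathbf{x})$ on the top layer, $\mathbf{b}^\epsilon(\mathbf{x},t)=-\mathbf{e}^2\epsilon^{-1}g(x_1,t)\chi^\epsilon_-(\mathbf{x})$ on the bottom layer, and zero elsewhere, where $\chi^\epsilon_+$ and $\chi^\epsilon_-$ are the indicator functions of $\{\theta<x_1<a-\theta,\ b/2-\epsilon<x_2<b/2\}$ and $\{\theta<x_1<a-\theta,\ -b/2<x_2<-b/2+\epsilon\}$. The boundary traction $\mathbf{g}$ is $\mathbf{g}=\pm\mathbf{e}^2g$ on $\{\theta\le x_1\le a-\theta,\ x_2=\pm b/2\}$ and $\mathbf{g}=0$ elsewhere on $\partial D$. $\dot H^1(D;\mathbb{R}^2)$ is the subspace of $H^1(D;\mathbb{R}^2)$ of fields $L^2$-orthogonal to in-plane rigid motions $\mathbf{\Omega}\times\mathbf{x}+\mathbf{c}$;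 $\dot H^1(D;\mathbb{R}^2)'$ is its dual, $\langle\cdot,\cdot\rangle$ the duality pairing, and $\langle\mathbf{b}^{\epsilon}(t),\mathbf{w}\rangle=\int_D\mathbf{b}^\epsilon(\mathbf{x},t)\cdot\mathbf{w}(\mathbf{x})\,d\mathbf{x}$. The convergence $\rightharpoonup$ is weak convergence. *)

(* Defs.v *)
From HB Require Import structures.
From mathcomp Require Import all_boot all_order all_algebra.
From mathcomp Require Import all_classical all_reals all_analysis.

Set Implicit Arguments.
Unset Strict Implicit.
Unset Printing Implicit Defensive.

Import Order.TTheory GRing.Theory Num.Theory numFieldNormedType.Exports.

Local Open Scope classical_set_scope.
Local Open Scope ring_scope.

(* The plane is R * R with its product topology and product sigma-algebra
   (that is, the Borel one). The library norm on R * R is the max norm, so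
   Euclidean distances are spelled out. *)

Section hausdorff.
Context {R : realType}.
Implicit Types (x y : R * R) (A B : set (R * R)).

Definition eucl_dist x y : R := Num.sqrt ((x.1 - y.1) ^+ 2 + (x.2 - y.2) ^+ 2).

Definition ediam A : \bar R :=
  Order.max 0%E (ereal_sup [set (eucl_dist p.1 p.2)%:E | p in A `*` A]).

Definition hausdorff1_delta (delta : R) A : \bar R :=
  ereal_inf [set (\sum_(k <oo) ediam (U k))%E | U in
    [set U : nat -> set (R * R) |
      A `<=` \bigcup_k U k /\ forall k, (ediam (U k) <= delta%:E)%E]].

Definition hausdorff1 A : \bar R :=
  ereal_sup [set hausdorff1_delta delta A | delta in [set delta : R | 0 < delta]].

Local Open Scope ereal_scope.

Lemma ediam_ge0 A : 0 <= ediam A.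
Proof. by rewrite /ediam le_max lexx. Qed.

Lemma ediam0 : ediam set0 = 0.
Proof.
by rewrite /ediam set0X image_set0 ereal_sup0; apply/max_idPl; exact: leNye.
Qed.

Lemma hausdorff1_delta_ge0 e A : 0 <= hausdorff1_delta e A.
Proof.
apply: le_ereal_inf_tmp => _ [U _ <-].
by apply: nneseries_ge0 => *; exact: ediam_ge0.
Qed.

Lemma hausdorff1_delta0 (e : R) : (0 < e)%R -> hausdorff1_delta e set0 = 0.
Proof.
move=> e0; apply/eqP; rewrite eq_le hausdorff1_delta_ge0 andbT.
apply: ereal_inf_lbound; exists (fun=> set0).
  by split => // k; rewrite ediam0 lee_fin ltW.
by rewrite eseries0// => *; rewrite ediam0.
Qed.

Lemma le_hausdorff1_delta e : {homo hausdorff1_delta e : A B / A `<=` B >-> A <= B}.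
Proof.
move=> A B AB; apply: ereal_inf_le_tmp => _ [U [BU eU] <-].
by exists U => //; split => //; exact: subset_trans BU.
Qed.

Lemma hausdorff1_delta_sigma_subadditive e :
  sigma_subadditive (hausdorff1_delta e).
Proof.
set h := hausdorff1_delta e.
have h0 := hausdorff1_delta_ge0 e.
move=> A; have [[i ioo]|] := pselect (exists i, h (A i) = +oo).
  by rewrite (eseries_pinfty _ _ ioo) ?leey// => n _; rewrite -ltNye (lt_le_trans _ (h0 _)).
rewrite -forallNE => Aoo.
suff add2e (r : {posnum R}) :
    h (\bigcup_n A n) <= \sum_(i <oo) h (A i) + r%:num%:E.
  by apply/lee_addgt0Pr => _/posnumP[].
rewrite (le_trans _ (epsilon_trick _ _ _))//.
pose P n (B : (set (R * R))^nat) :=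
  (A n `<=` \bigcup_k B k /\ forall k, ediam (B k) <= e%:E) /\
  \sum_(k <oo) ediam (B k) <= h (A n) + (r%:num / (2 ^ n.+1)%:R)%:E.
have [G PG] : {G : ((set (R * R))^nat)^nat & forall n, P n (G n)}.
  apply: (@choice _ _ P) => n; rewrite /P /h /hausdorff1_delta.
  set S := (X in ereal_inf X).
  have fS : ereal_inf S \is a fin_num.
    by rewrite ge0_fin_numE ?h0// ltey; apply/eqP; exact: Aoo.
  have en1 : (0 < r%:num / (2 ^ n.+1)%:R :> R)%R by [].
  have [x [B [AnB Be] muBx] xS] := lb_ereal_inf_adherent en1 fS.
  by exists B; split => //; rewrite muBx; exact/ltW.
have G0 p : 0 <= (ediam \o uncurry G) p by exact: ediam_ge0.
apply: (@le_trans _ _ (\esum_(i in setT) (ediam \o uncurry G) i)).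
  apply: ereal_inf_lbound => /=.
  have /card_esym/ppcard_eqP[f] := card_nat2.
  exists (uncurry G \o f).
    split => [|k]; last first.
      by rewrite /= /uncurry; case: (f k) => a b /=; exact: (PG a).1.2.
    apply: (@subset_trans _  (\bigcup_n \bigcup_k G n k)) => [t [i _]|].
      by move=> /((PG i).1.1) -[j _ ?]; exists i => //; exists j.
    move=> t [i _ [j _ Bijt]]; exists (f^-1%FUN (i, j)) => //=.
    by rewrite invK ?inE.
  rewrite -(esum_pred_image (ediam \o uncurry G) _ xpredT) ?[fun=> _]set_true//.
  by rewrite image_eq.
rewrite (_ : esum _ _ = \sum_(i <oo) \sum_(j <oo ) ediam (G i j)); last first.
  pose J : nat -> set (nat * nat) := fun i => [set (i, j) | j in setT].
  rewrite (_ : setT = \bigcup_k J k); last first.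
    by rewrite predeqE => -[a b]; split => // _; exists a => //; exists b.
  rewrite esum_bigcupT /=; last 2 first.
    - apply/trivIsetP => i j _ _ ij.
      rewrite predeqE => -[n m] /=; split => //= -[] [_] _ [<-{n} _].
      by move=> [m' _] [] /esym/eqP; rewrite (negbTE ij).
    - by move=> /= [n m]; exact: ediam_ge0.
  rewrite -(image_id [set: nat]) -fun_true esum_pred_image//; last first.
    by move=> n _; apply: esum_ge0 => -[a c] _; exact: ediam_ge0.
  apply: eq_eseriesr => /= j _.
  rewrite -(esum_pred_image (ediam \o uncurry G) (pair j) predT)//=; last first.
    by move=> ? ? _ _; exact: (@can_inj _ _ _ snd).
    by move=> n _; exact: ediam_ge0.
  by congr esum; rewrite predeqE => -[a b]; split; move=> [i _ <-]; exists i.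
apply: lee_nneseries => [i _ _|n _]; last exact: (PG n).2.
by apply: nneseries_ge0 => *; exact: ediam_ge0.
Qed.

Lemma le_hausdorff1_delta1 (e : R) A : (0 < e)%R ->
  hausdorff1_delta e A <= hausdorff1 A.
Proof. by move=> e0; apply: ereal_sup_ubound; exists e. Qed.

Lemma hausdorff1_ge0 A : 0 <= hausdorff1 A.
Proof.
exact: le_trans (hausdorff1_delta_ge0 1 A) (le_hausdorff1_delta1 _ ltr01).
Qed.

Lemma hausdorff1_set0 : hausdorff1 set0 = 0.
Proof.
apply/eqP; rewrite eq_le hausdorff1_ge0 andbT.
by apply: ge_ereal_sup => _ [e /= e0 <-]; rewrite hausdorff1_delta0.
Qed.

Lemma le_hausdorff1 : {homo hausdorff1 : A B / A `<=` B >-> A <= B}.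
Proof.
move=> A B AB; apply: ge_ereal_sup => _ [e /= e0 <-].
exact: le_trans (le_hausdorff1_delta e AB) (le_hausdorff1_delta1 _ e0).
Qed.

Lemma hausdorff1_sigma_subadditive : sigma_subadditive hausdorff1.
Proof.
move=> A; apply: ge_ereal_sup => _ [e /= e0 <-].
apply: le_trans (hausdorff1_delta_sigma_subadditive e A) _.
apply: lee_nneseries => [i _ _|i _]; first exact: hausdorff1_delta_ge0.
exact: le_hausdorff1_delta1.
Qed.

HB.instance Definition _ := isOuterMeasure.Build R (R * R)%type hausdorff1
  hausdorff1_set0 hausdorff1_ge0 le_hausdorff1 hausdorff1_sigma_subadditive.

Lemma hausdorff1_metric (eta : R) A B : (0 < eta)%R ->
  (forall x y, A x -> B y -> eta <= eucl_dist x y)%R ->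
  hausdorff1 A + hausdorff1 B <= hausdorff1 (A `|` B).
Proof.
move=> eta0 AB.
have sep (e : R) : (0 < e < eta)%R ->
    hausdorff1_delta e A + hausdorff1_delta e B <= hausdorff1 (A `|` B).
  move=> /andP[e0 eeta]; apply: le_trans (le_hausdorff1_delta1 _ e0).
  apply: le_ereal_inf_tmp => _ [U [ABU Ue] <-].
  pose V C k := if `[< U k `&` C !=set0 >] then U k else set0.
  have VC C : C `<=` A `|` B ->
      hausdorff1_delta e C <= \sum_(k <oo) ediam (V C k).
    move=> CAB; apply: ereal_inf_lbound; exists (V C) => //; split => [x Cx|k].
      have [k _ Ukx] := ABU _ (CAB _ Cx); exists k => //.
      by rewrite /V asboolT//; exists x.
    by rewrite /V; case: ifP => _//; rewrite ediam0 lee_fin ltW.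
  apply: le_trans (leeD (VC A _) (VC B _)) _; first exact: subsetUl.
    exact: subsetUr.
  rewrite -nneseriesD; try by move=> *; exact: ediam_ge0.
  apply: lee_nneseries => [i _ _|k _]; first by apply: adde_ge0; exact: ediam_ge0.
  rewrite /V; case: asboolP => [[x [Ux Ax]]|_]; last first.
    by rewrite ediam0 add0e; case: ifP => _//; rewrite ediam0 ediam_ge0.
  case: asboolP => [[y [Uy By]]|_]; last by rewrite ediam0 adde0.
  have := Ue k; rewrite leNgt => /negP[].
  rewrite /ediam lt_max; apply/orP; right.
  apply: (@lt_le_trans _ _ (eucl_dist x y)%:E).
    by rewrite lte_fin (lt_le_trans eeta)// AB.
  by apply: ereal_sup_ubound; exists (x, y).
have [e1 [e10 e1eta]] : exists e : R, (0 < e)%R /\ (e < eta)%R.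
  by exists (eta / 2)%R; split; [rewrite divr_gt0|rewrite gtr_pMr// invf_lt1// ltr1n].
have mono (e e' : R) C : (e <= e')%R -> hausdorff1_delta e' C <= hausdorff1_delta e C.
  move=> ee'; apply: ereal_inf_le_tmp => _ [U [CU Ue] <-]; exists U => //.
  by split=> // k; apply: le_trans (Ue k) _; rewrite lee_fin.
have supD C D : (forall e e' : R, (0 < e)%R -> (0 < e')%R ->
    hausdorff1_delta e C + hausdorff1_delta e' D <= hausdorff1 (A `|` B)) ->
    hausdorff1 C + hausdorff1 D <= hausdorff1 (A `|` B).
  have [->|fin CD] := eqVneq (hausdorff1 (A `|` B)) +oo; first by rewrite leey.
  have ffin : hausdorff1 (A `|` B) \is a fin_num.
    by rewrite ge0_fin_numE ?hausdorff1_ge0// ltey.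
  have fC e : (0 < e)%R -> hausdorff1_delta e C \is a fin_num.
    move=> e0; rewrite ge0_fin_numE ?hausdorff1_delta_ge0//.
    apply: le_lt_trans (leeDl _ (hausdorff1_delta_ge0 1 D)) _.
    by apply: le_lt_trans (CD _ _ e0 ltr01) _; rewrite ltey.
  have CD' (e : R) : (0 < e)%R ->
      hausdorff1 D <= hausdorff1 (A `|` B) - hausdorff1_delta e C.
    move=> e0; apply: ge_ereal_sup => _ [e' /= e'0 <-].
    by rewrite leeBrDl ?fC// CD.
  have fD : hausdorff1 D \is a fin_num.
    rewrite ge0_fin_numE ?hausdorff1_ge0//.
    apply: le_lt_trans (CD' _ ltr01) _.
    by rewrite ltey_eq fin_numB ffin fC.
  rewrite -leeBrDr//; apply: ge_ereal_sup => _ [e /= e0 <-].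
  by rewrite leeBrDr// addeC -leeBrDr ?fC// CD'.
apply: supD => e e' e0 e'0.
pose m := Num.min e1 (Num.min e e').
apply: le_trans (sep m _).
  by apply: leeD; apply: mono; rewrite /m !ge_min lexx !orbT.
by rewrite /m !lt_min e10 e0 e'0 /= gt_min e1eta.
Qed.

Lemma caratheodory_hausdorff1_gt (h : R * R -> R) (c : R) :
  (forall x y, `|h x - h y| <= eucl_dist x y)%R ->
  hausdorff1.-caratheodory [set x | (c < h x)%R].
Proof.
move=> hlip; apply: le_caratheodory_measurable => X.
change (hausdorff1 (X `&` [set x | (c < h x)%R]) +
  hausdorff1 (X `&` ~` [set x | (c < h x)%R]) <= hausdorff1 X).
have [->|Xoo] := eqVneq (hausdorff1 X) +oo; first by rewrite leey.
have fX : hausdorff1 X \is a fin_num.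
  by rewrite ge0_fin_numE ?hausdorff1_ge0// ltey.
set P := [set x | (c < h x)%R].
have sep (A B : set (R * R)) (u v : R) : (u < v)%R ->
    (forall x, A x -> h x <= u)%R -> (forall x, B x -> v <= h x)%R ->
    hausdorff1 A + hausdorff1 B <= hausdorff1 (A `|` B).
  move=> uv Au Bv; apply: (@hausdorff1_metric (v - u)%R).
    by rewrite subr_gt0.
  move=> x y Ax By; apply: le_trans (hlip x y).
  rewrite distrC ler_normr; apply/orP; left.
  by apply: lerB; [exact: Bv|exact: Au].
pose r n : R := (c + n.+1%:R^-1)%R.
have rS n : (r n.+1 < r n)%R.
  by rewrite /r ltrD2l ltf_pV2 ?posrE// ltr_nat.
have r_le m n : (m <= n)%N -> (r n <= r m)%R.
  by move=> mn; rewrite /r lerD2l lef_pV2 ?posrE// ler_nat.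
pose S k := [set x | X x /\ (r k.+1 <= h x < r k)%R].
pose A n := [set x | X x /\ (r n <= h x)%R].
have XPA n : hausdorff1 (X `&` ~` P) + hausdorff1 (A n) <= hausdorff1 X.
  apply: le_trans (sep _ _ c (r n) _ _ _) _.
  - by rewrite /r ltrDl invr_gt0.
  - by move=> x [_ /=] /negP; rewrite -leNgt.
  - by move=> x [].
  - by apply: le_outer_measure => x [|] [].
pose B b N := [set x | [/\ (0 < N)%N, X x & (r (N.*2 + b).-1 <= h x)%R]].
have half b N : \sum_(0 <= k < N) hausdorff1 (S (k.*2 + b)%N) <=
    hausdorff1 (B b N).
  elim: N => [|N IH]; first by rewrite big_geq// hausdorff1_ge0.
  rewrite big_nat_recr//=; apply: le_trans (leeD2r _ IH) _; rewrite addeC.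
  have SB : S (N.*2 + b)%N `|` B b N `<=` B b N.+1.
    move=> x [[Xx /andP[rx _]]|[N0 Xx rx]]; split => //; apply: le_trans rx.
    by apply: r_le; rewrite doubleS !addSn/= (leq_trans (leq_pred _)).
  apply: le_trans (le_hausdorff1 SB).
  case: N {IH SB} => [|N].
    rewrite (_ : B b 0%N = set0) ?hausdorff1_set0 ?adde0 ?setU0//.
    by apply/seteqP; split => // x [].
  apply: (sep _ _ (r (N.+1.*2 + b)%N) (r (N.+1.*2 + b).-1)).
  - by rewrite doubleS !addSn; exact: rS.
  - by move=> x [_ /andP[_ /ltW]].
  - by move=> x [].
have sumS b : \sum_(k <oo) hausdorff1 (S (k.*2 + b)%N) < +oo.
  apply: (@le_lt_trans _ _ (hausdorff1 X)); last by rewrite ltey.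
  apply: lime_le; first by apply: is_cvg_nneseries => *; exact: hausdorff1_ge0.
  apply: nearW => N; apply: le_trans (half b N) _.
  by apply: le_hausdorff1 => x [].
pose tl b n := \sum_(n <= k <oo) hausdorff1 (S (k.*2 + b)%N).
have tl0 b : tl b n @[n --> \oo] --> 0.
  by apply: nneseries_tail_cvg => // k _; exact: hausdorff1_ge0.
have XP n : hausdorff1 (X `&` P) <= hausdorff1 (A n.*2) + (tl 0%N n + tl 1%N n).
  pose U b := \bigcup_(k in ~` `I_n) S (k.*2 + b)%N.
  have XPU : X `&` P `<=` A n.*2 `|` (U 0%N `|` U 1%N).
    move=> x [Xx Px]; have [rx|rx] := leP (r n.*2) (h x); first by left.
    right.
    have exk : exists k, (r k <= h x)%R.
      by have [k /ltW rk] := ltr_add_invr Px; exists k.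
    case: (ex_minnP exk) => -[|k] rk kmin.
      by move: rx; rewrite ltNge (le_trans (r_le 0%N _ _) rk).
    have nk : (n.*2 <= k)%N.
      by rewrite leqNgt; apply/negP => /(r_le k.+1)/le_trans/(_ rk); rewrite leNgt rx.
    have Sk : S k x.
      by split=> //; rewrite rk ltNge; apply/negP => /kmin; rewrite ltnn.
    have := odd_double_half k; case: (odd k) => kE; [right|left].
      exists k./2; first by apply/negP; rewrite -leqNgt geq_half_double.
      by rewrite addnC kE.
    exists k./2; first by apply/negP; rewrite -leqNgt geq_half_double.
    by rewrite addnC kE.
  apply: le_trans (le_hausdorff1 XPU) _; apply: le_trans (outer_measureU2 _ _ _) _.
  apply: leeD2l; apply: le_trans (outer_measureU2 _ _ _) _.
  have tail b : hausdorff1 (U b) <= tl b n.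
    exact: (outer_measure_sigma_subadditive_tail hausdorff1 n
      (fun k => S (k.*2 + b)%N)).
  exact: leeD (tail 0%N) (tail 1%N).
have tlD : tl 0%N n + tl 1%N n @[n --> \oo] --> 0.
  by rewrite -[X in _ --> X]adde0; apply: cvgeD.
have lim_tl : hausdorff1 X + (tl 0%N n + tl 1%N n) @[n --> \oo] --> hausdorff1 X.
  rewrite -[X in _ --> X]adde0.
  by apply: (cvgeD _ (cvg_cst _) tlD); rewrite fin_num_adde_defr.
have := cvg_lim _ lim_tl; move=> /(_ (@ereal_hausdorff R)) <-.
apply: lime_ge; first by apply/cvg_ex; exists (hausdorff1 X).
apply: nearW => n; apply: le_trans (leeD2r _ (XP n)) _.
by rewrite addeAC leeD2r// addeC.
Qed.

Lemma caratheodory_hausdorff1 A : measurable A -> hausdorff1.-caratheodory A.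
Proof.
pose T := caratheodory_type (@hausdorff1 : set (R * R) -> \bar R).
have mh (h : R * R -> R) : (forall x y, `|h x - h y| <= eucl_dist x y)%R ->
    measurable_fun setT (h : T -> R).
  move=> hlip; apply: (measurability _ (measurable_realfun.RGenOInfty.measurableE R)).
  move=> _ [_ [c ->] <-]; rewrite setTI.
  rewrite (_ : _ @^-1` _ = [set x | (c < h x)%R]); last first.
    by apply/seteqP; split => x /=; rewrite in_itv/= andbT.
  exact: caratheodory_hausdorff1_gt.
have mid : measurable_fun setT (fun x : T => (x.1, x.2) : R * R).
  apply: measurable_fun_pair; apply: mh => x y; rewrite /eucl_dist -sqrtr_sqr.
    by rewrite ler_sqrt// ?lerDl ?sqr_ge0// addr_ge0 ?sqr_ge0.
  by rewrite ler_sqrt// ?lerDr ?sqr_ge0// addr_ge0 ?sqr_ge0.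
move=> mA; have := mid measurableT _ mA; rewrite setTI.
by rewrite (_ : _ @^-1` _ = A)//; apply/seteqP; split => -[].
Qed.

Lemma hausdorff1_semi_sigma_additive :
  semi_sigma_additive (hausdorff1 : set (R * R) -> \bar R).
Proof.
move=> F mF tF mUF.
exact: (@caratheodory_measure_sigma_additive R (R * R)%type hausdorff1 F
  (fun k => caratheodory_hausdorff1 (mF k)) tF (caratheodory_hausdorff1 mUF)).
Qed.

HB.instance Definition _ := isMeasure.Build _ (R * R)%type R hausdorff1
  hausdorff1_set0 hausdorff1_ge0 hausdorff1_semi_sigma_additive.


End hausdorff.

Section sobolev.
Context {R : realType}.
Implicit Types (D S : set (R * R)) (u h : R * R -> R) (w : R * R -> R * R).

Definition lebesgue2 := (@lebesgue_measure R \x @lebesgue_measure R)%E.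

Definition dot (x y : R * R) : R := x.1 * y.1 + x.2 * y.2.

Definition e1 : R * R := (1, 0).
Definition e2 : R * R := (0, 1).

Fixpoint Cn_on n (O : set (R * R)) (f : R * R -> R) : Prop :=
  (forall x, O x -> {for x, continuous f}) /\
  if n is m.+1 then
    [/\ forall x, O x -> derivable f x e1 /\ derivable f x e2,
        Cn_on m O ('D_e1 f) & Cn_on m O ('D_e2 f)]
  else True.

(* meant for open O *)
Definition smooth_on (O : set (R * R)) (f : R * R -> R) := forall n, Cn_on n O f.

Definition test_function D (phi : R * R -> R) :=
  smooth_on setT phi /\
  exists K, [/\ compact K, K `<=` D & forall x, ~ K x -> phi x = 0].

Definition L2 D u :=
  measurable_fun D u /\ (\int[lebesgue2]_(x in D) ((u x) ^+ 2)%:E < +oo)%E.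

Definition is_weak_deriv D (v : R * R) u h :=
  forall phi, test_function D phi ->
    \int[lebesgue2]_(x in D) (u x * 'D_v phi x) =
    - \int[lebesgue2]_(x in D) (h x * phi x).

Definition sobolev1 D u :=
  [/\ L2 D u, exists2 h, L2 D h & is_weak_deriv D e1 u h
    & exists2 h, L2 D h & is_weak_deriv D e2 u h].

(* well defined up to a null set *)
Definition weak_deriv D v u : R * R -> R :=
  xget (fun=> 0) [set h | L2 D h /\ is_weak_deriv D v u h].

Definition sobolev1_sqnorm D u : R :=
  \int[lebesgue2]_(x in D) (u x ^+ 2) +
  \int[lebesgue2]_(x in D) (weak_deriv D e1 u x ^+ 2) +
  \int[lebesgue2]_(x in D) (weak_deriv D e2 u x ^+ 2).

(* H^1(D; R^2); fields are functions on the whole plane, of which only the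
   values on D matter, and are not quotiented by almost everywhere equality *)
Definition H1field D : set (R * R -> R * R) :=
  [set w | sobolev1 D (fst \o w) /\ sobolev1 D (snd \o w)].

Definition H1norm D w : R :=
  Num.sqrt (sobolev1_sqnorm D (fst \o w) + sobolev1_sqnorm D (snd \o w)).

(* Omega e^3 x (x1, x2, 0) + c *)
Definition rigid_motion (Omega : R) (c x : R * R) : R * R :=
  (c.1 - Omega * x.2, c.2 + Omega * x.1).

Definition H1dot D : set (R * R -> R * R) :=
  [set w | H1field D w /\ forall Omega c,
    \int[lebesgue2]_(x in D) dot (w x) (rigid_motion Omega c x) = 0].

(* Trace of u on the boundary of D: for a Lipschitz domain D and u in H^1(D),
   this limit of averages exists at almost every boundary point and is the
   trace of u (Evans and Gariepy, Measure theory and fine properties of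
   functions, section 5.3). *)
Definition trace D u (x : R * R) : R :=
  lim ((\int[lebesgue2]_(y in D `&` [set y | eucl_dist x y < r]) u y) /
       fine (lebesgue2 (D `&` [set y | eucl_dist x y < r])) @[r --> 0^'+]).

Definition vtrace D w (x : R * R) : R * R :=
  (trace D (fst \o w) x, trace D (snd \o w) x).

Definition frontier D := closure D `\` interior D.

Definition Hhalf_sqnorm S w : \bar R :=
  (\int[hausdorff1]_(x in S) (eucl_dist (w x) 0 ^+ 2)%:E +
   \int[hausdorff1]_(x in S) \int[hausdorff1]_(y in S)
     (eucl_dist (w x) (w y) ^+ 2 / eucl_dist x y ^+ 2)%:E)%E.

(* Sobolev-Slobodeckij space H^{1/2}(S; R^2) on a curve S *)
Definition Hhalf S : set (R * R -> R * R) :=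
  [set w | [/\ measurable_fun S (fst \o w), measurable_fun S (snd \o w)
             & (Hhalf_sqnorm S w < +oo)%E]].

Definition Hhalf_norm S w : R := Num.sqrt (fine (Hhalf_sqnorm S w)).

End sobolev.

Section functionals.
Context {R : realType}.

(* V is a linear subspace of E and N a seminorm on it *)
Definition bounded_functional (E : lmodType R) (V : set E) (N : E -> R)
    (F : E -> R) :=
  (forall c u v, V u -> V v -> F (c *: u + v) = c * F u + F v) /\
  exists C, forall u, V u -> `|F u| <= C * N u.

Definition weakly_cvg (E : lmodType R) (V : set E) (N : E -> R)
    (u : nat -> E) (l : E) :=
  forall Phi, bounded_functional V N Phi -> Phi (u n) @[n --> \oo] --> Phi l.

(* f is in H^{-1/2}(S; R^2), acting through the L^2(S) pairing *)
Definition in_Hmhalf (S : set (R * R)) (f : R * R -> R * R) :=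
  (forall v, Hhalf S v ->
     hausdorff1.-integrable S (fun x => (dot (f x) (v x))%:E)) /\
  bounded_functional (Hhalf S) (Hhalf_norm S)
    (fun v => \int[hausdorff1]_(x in S) dot (f x) (v x)).

Variable D : set (R * R).

Definition H1dual : set ((R * R -> R * R) -> R) :=
  [set F | bounded_functional (H1dot D) (H1norm D) F].

Definition H1dual_norm (F : (R * R -> R * R) -> R) : \bar R :=
  ereal_sup [set `|F w|%:E | w in [set w | H1dot D w /\ H1norm D w <= 1]].

Definition simple_H1dual (s : R -> (R * R -> R * R) -> R) :=
  exists m (A : 'I_m -> set R) (F : 'I_m -> (R * R -> R * R) -> R),
    [/\ forall i, measurable (A i), forall i, H1dual (F i)
      & forall t w, s t w = \sum_(i < m) \1_(A i) t * F i w].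

Variable T : R.

Definition strongly_measurable (F : R -> (R * R -> R * R) -> R) :=
  exists s : nat -> R -> (R * R -> R * R) -> R,
    (forall n, simple_H1dual (s n)) /\
    {ae @lebesgue_measure R, forall t, 0 <= t <= T ->
      H1dual_norm (s n t - F t) @[n --> \oo] --> 0%E}.

Definition L2_H1dual_sqnorm (F : R -> (R * R -> R * R) -> R) : \bar R :=
  (\int[@lebesgue_measure R]_(t in [set` `[0, T]%R]) (H1dual_norm (F t) ^+ 2))%E.

(* Bochner space L^2(0, T; H1dual) *)
Definition L2_H1dual : set (R -> (R * R -> R * R) -> R) :=
  [set F | [/\ forall t, 0 <= t <= T -> H1dual (F t), strongly_measurable F
             & (L2_H1dual_sqnorm F < +oo)%E]].

Definition L2_H1dual_norm (F : R -> (R * R -> R * R) -> R) : R :=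
  Num.sqrt (fine (L2_H1dual_sqnorm F)).

End functionals.

Section specimen.
Context {R : realType}.
Variables a b theta : R.

Definition rounded_rectangle : set (R * R) :=
  [set x | exists c : R * R,
    [/\ theta <= c.1 <= a - theta, - (b / 2) + theta <= c.2 <= b / 2 - theta
      & eucl_dist x c < theta]].

(* Half-thickness d, tip at (l0, 0). The two corners of the mouth of the notch
   are rounded by arcs of radius rho centred at (rho, d + rho) and
   (rho, - (d + rho)). *)
Definition notch (l0 d rho : R) : set (R * R) :=
  [set x | x.1 <= l0 - d /\ `|x.2| <= d] `|`
  [set x | eucl_dist x (l0 - d, 0) <= d] `|`
  [set x | [/\ x.1 <= rho, `|x.2| <= d + rho
             & rho <= eucl_dist (x.1, `|x.2|) (rho, d + rho)]].

Definition specimen (l0 d rho : R) : set (R * R) :=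
  rounded_rectangle `\` notch l0 d rho.

Definition top_layer (eps : R) : set (R * R) :=
  [set x | theta < x.1 < a - theta /\ b / 2 - eps < x.2 < b / 2].

Definition bottom_layer (eps : R) : set (R * R) :=
  [set x | theta < x.1 < a - theta /\ - (b / 2) < x.2 < - (b / 2) + eps].

Definition top_edge : set (R * R) :=
  [set x | theta <= x.1 <= a - theta /\ x.2 = b / 2].

Definition bottom_edge : set (R * R) :=
  [set x | theta <= x.1 <= a - theta /\ x.2 = - (b / 2)].

(* The load g(x1, t) is given as a function of the pair (x1, t). *)
Variable g : R * R -> R.

Definition body_force (eps t : R) (x : R * R) : R * R :=
  (eps^-1 * g (x.1, t) *
    (\1_(top_layer eps) x - \1_(bottom_layer eps) x)) *: e2.

Definition traction (t : R) (x : R * R) : R * R :=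
  (g (x.1, t) * (\1_top_edge x - \1_bottom_edge x)) *: e2.

End specimen.

(* Main.v *)
(* On the rectangles next to the two loaded edges a Sobolev function u is, for
   almost every x1, absolutely continuous in x2 with derivative D_2 u, so that it has
   boundary values W(x1) with

     int_{layer of thickness delta} |u - W| <= delta int_{layer} |D_2 u|.

   By Lebesgue differentiation the averages defining the trace converge to W almost
   everywhere, and by Cauchy-Schwarz the layer force of thickness delta differs from
   the edge load by at most C sqrt(delta) |w|_{H^1}, uniformly in t. Together with the
   trivial bound C |w| / delta for thick layers this gives the uniform estimate. The
   L^2(0,T) norms of the differences are O(sqrt(eps_n)), so the convergence is even
   strong. Bochner measurability in t follows from continuity of t |-> g(., t) for the
   sup norm, which is uniform by compactness of the loaded edge. On horizontal lines
   the one-dimensional Hausdorff measure is Lebesgue measure, which identifies the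
   limit with the boundary integral of the traction. *)

Require Import Defs.
From HB Require Import structures.
From mathcomp Require Import all_boot all_order all_algebra.
From mathcomp Require Import all_classical all_reals all_analysis measurable_realfun.
From mathcomp Require Import lra.

Set Implicit Arguments.
Unset Strict Implicit.
Unset Printing Implicit Defensive.

Import Order.TTheory GRing.Theory Num.Theory numFieldNormedType.Exports.

Local Open Scope classical_set_scope.
Local Open Scope ring_scope.

(** * Smooth cut-off functions *)

(** Weak derivatives are tested only with products of one-variable cut-offs. Letting the horizontal
    factor tend to an indicator leaves, for each strip []p, q[], a one-variable weak equation for
    integrals over the strip. Evaluating it between two common Lebesgue points and letting [p], [q]
    run through the rationals gives the increment formula in x2 for almost every x1. The null set
    may depend on the two heights; Tonelli tolerates this, so no precise representative of u is
    built.

    Two encodings cost extra work. The trace is a pointwise [lim] with a default value, so its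
    measurability requires that of the set of convergence. [weak_deriv] is an arbitrary choice, so
    the zero field has norm 0 only by uniqueness of weak derivatives, and the dual norm is
    nonnegative only because that field lies in the unit ball.

    On the load side everything is stated for an arbitrary bounded measurable density c(x1). The
    difference of the loads at two times is then again a load, and continuity in t follows from the
    uniform bound. For H^{-1/2} it suffices that the H^{1/2} norm dominates the L^2 norm on the
    edges. *)

Section smooth_functions.
Context {R : realType}.
Implicit Types (f g : R -> R) (x : R) (n : nat).

(** The derivative is an existential witness rather than ['D_1 f], so that each smoothness proof can
    supply it in a convenient closed form. *)
Fixpoint Cn1 n f : Prop :=
  continuous f /\
  if n is m.+1 then exists2 f', forall x, is_derive x 1 f (f' x) & Cn1 m f'
  else True.

Definition smooth1 f := forall n, Cn1 n f.

Lemma Cn1S n f : Cn1 n.+1 f -> Cn1 n f.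
Proof.
elim: n f => [|n IH] f; first by move=> [cf _]; split.
move=> [cf [f' df cf']]; split => //; exists f' => //.
exact: IH.
Qed.

Lemma is_derive_Cn1S n f f' :
  (forall x, is_derive x 1 f (f' x)) -> Cn1 n f' -> Cn1 n.+1 f.
Proof.
move=> df cf'; split; last by exists f'.
move=> x; apply/differentiable_continuous/derivable1_diffP.
by have [] := df x.
Qed.

Lemma Cn1_cst n (c : R) : Cn1 n (cst c).
Proof.
elim: n c => [|n IH] c; first by split => // x; exact: cvg_cst.
by apply: (@is_derive_Cn1S _ _ (cst 0)) => // x; exact: is_derive_cst.
Qed.

Lemma Cn1_id n : Cn1 n (@id R).
Proof.
case: n => [|n]; first by split => // x.
by apply: (@is_derive_Cn1S _ _ (cst 1)) => //; exact: Cn1_cst.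
Qed.

Lemma Cn1D n f g : Cn1 n f -> Cn1 n g -> Cn1 n (f \+ g).
Proof.
elim: n f g => [|n IH] f g.
  by move=> [cf _] [cg _]; split => // x; apply: cvgD; [exact: cf|exact: cg].
move=> [_ [f' df cf']] [_ [g' dg cg']].
by apply: (@is_derive_Cn1S _ _ (f' \+ g')); exact: IH.
Qed.

Lemma Cn1M n f g : Cn1 n f -> Cn1 n g -> Cn1 n (f \* g).
Proof.
elim: n f g => [|n IH] f g.
  by move=> [cf _] [cg _]; split => // x; apply: cvgM; [exact: cf|exact: cg].
move=> Sf Sg; have [_ [f' df cf']] := Sf; have [_ [g' dg cg']] := Sg.
apply: (@is_derive_Cn1S _ _ ((f \* g') \+ (g \* f'))).
by apply: Cn1D; apply: IH => //; exact: Cn1S.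
Qed.

Lemma Cn1_comp n f g : Cn1 n f -> Cn1 n g -> Cn1 n (f \o g).
Proof.
elim: n f g => [|n IH] f g.
  by move=> [cf _] [cg _]; split => // x; apply: continuous_comp; [exact: cg|exact: cf].
move=> [_ [f' df cf']] Sg; have [_ [g' dg cg']] := Sg.
apply: (@is_derive_Cn1S _ _ ((f' \o g) \* g')).
by apply: Cn1M => //; apply: IH => //; exact: Cn1S.
Qed.

(** For [n = 0] this is the classical smooth function exp(-1/x) that is flat at 0. The powers of 1/x
    are included because the family is then stable under differentiation. *)
Definition flat n x : R := if 0 < x then x^-1 ^+ n * expR (- x^-1) else 0.

Lemma flat_ge0 n x : 0 <= flat n x.
Proof.
rewrite /flat; case: ifPn => // x0.
by rewrite mulr_ge0 ?expR_ge0// exprn_ge0// invr_ge0 ltW.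
Qed.

(** The exponential dominates its Taylor term of degree [n + 1] at 1/x. A linear bound for every [n]
    is all that differentiability at 0 asks for. *)
Lemma flat_le n x : 0 <= x -> flat n x <= (n.+1)`!%:R * x.
Proof.
move=> x0; rewrite /flat; case: ifPn => [xp|_]; last by rewrite mulr_ge0.
rewrite expRN ler_pdivrMr ?expR_gt0// -[X in _ <= _ * X * _]invrK mulrAC.
rewrite ler_pdivlMr ?invr_gt0//.
rewrite -exprSr mulrC -ler_pdivrMr ?ltr0n ?fact_gt0//.
by apply: le_trans (expR_ge1Dxn n _); rewrite ?lerDr// invr_ge0.
Qed.

Lemma is_derive_flat n x :
  is_derive x 1 (flat n) (flat n.+2 x - n%:R * flat n.+1 x).
Proof.
have [x0|x0|x0] := ltgtP x 0.
- rewrite /flat (lt_gtF x0) mulr0 subr0.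
  apply: (near_eq_is_derive _ (is_derive_cst (0 : R) _ _)).
  near=> y; rewrite ifN// -leNgt ltW//; near: y; exact: lt_nbhsl.
- have xN0 : x != 0 by rewrite gt_eqF.
  have nr : \near x, ((fun y : R => y^-1) ^+ n * (expR \o (fun y => - y^-1))) x = flat n x.
    near=> y; rewrite /flat ifT; last by near: y; exact: lt_nbhsr.
    by rewrite fctE exprfctE.
  apply: (near_eq_is_derive nr).
  have di : is_derive x 1 (fun y : R => y^-1) (- x ^- 2).
    have := @is_deriveV R id x 1 1 xN0 (is_derive_id _ _).
    by rewrite /GRing.scale/= mulr1.
  have dN : is_derive x 1 (fun y : R => - y^-1) (x ^- 2).
    by rewrite -[x ^- 2]opprK; exact: is_deriveN.
  have dX := @is_deriveX _ _ (fun y : R => y^-1) n _ _ _ di.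
  have dE := @is_derive1_comp _ expR (fun y : R => - y^-1) _ _ _ (is_derive_expR _) dN.
  have dM := is_deriveM dX dE; apply: (is_derive_eq dM).
  rewrite /flat x0 /GRing.scale/= exprfctE -?exprVn.
  move: (expR (- x^-1)) (x^-1) => E y.
  by clear; case: n => [|n]; rewrite /= !exprS; lra.
- subst x; rewrite /flat ltxx mulr0 subr0.
  suff cv : h^-1 *: ((flat n \o shift 0) (h *: 1) - flat n 0) @[h --> (0 : R)^'] --> (0 : R).
    by apply: DeriveDef; [apply/cvg_ex; exists 0|exact: cvg_lim cv].
  apply/cvgr0Pnorm_le => e e0; near=> h.
  have h0 : h != 0 by near: h; exact: nbhs_dnbhs_neq.
  rewrite /= addr0 /GRing.scale/= mulr1 {2}/flat ltxx subr0.
  have [hp|hn] := ltP 0 h; last by rewrite /flat ltNge hn/= mulr0 normr0 ltW.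
  (* The difference quotient at 0 is the next member of the family, hence O(h) by [flat_le]. *)
  have -> : h^-1 * flat n h = flat n.+1 h by rewrite /flat hp mulrA -exprS.
  rewrite ger0_norm ?flat_ge0//; apply: le_trans (flat_le _ (ltW hp)) _.
  rewrite mulrC -ler_pdivlMr ?ltr0n ?fact_gt0//.
  apply: le_trans (ler_norm _) _; near: h; apply: dnbhs0_le.
  by rewrite divr_gt0 ?ltr0n ?fact_gt0.
Unshelve. all: by end_near. Qed.

Lemma smooth1_flat n : smooth1 (flat n).
Proof.
move=> m; elim: m n => [|m IH] n.
  split => // x; apply/differentiable_continuous/derivable1_diffP.
  by have [] := is_derive_flat n x.
apply: is_derive_Cn1S (is_derive_flat n) _.
have -> : (fun x => flat n.+2 x - n%:R * flat n.+1 x) =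
    flat n.+2 \+ (cst (- n%:R) \* flat n.+1).
  by apply/funext => x /=; rewrite mulNr.
by apply: Cn1D => //; apply: Cn1M => //; exact: Cn1_cst.
Qed.

Lemma smooth1_cst (c : R) : smooth1 (cst c).
Proof. by move=> n; exact: Cn1_cst. Qed.

Lemma smooth1M f g : smooth1 f -> smooth1 g -> smooth1 (f \* g).
Proof. by move=> Sf Sg n; apply: Cn1M. Qed.

Lemma smooth1_comp f g : smooth1 f -> smooth1 g -> smooth1 (f \o g).
Proof. by move=> Sf Sg n; apply: Cn1_comp. Qed.

Lemma smooth1_affine (c e : R) : smooth1 (fun x => c * x + e).
Proof.
move=> n; apply: (@Cn1D n (cst c \* id) (cst e)); last exact: Cn1_cst.
by apply: Cn1M; [exact: Cn1_cst|exact: Cn1_id].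
Qed.

Lemma smooth1_continuous f : smooth1 f -> continuous f.
Proof. by move=> /(_ 0%N)[]. Qed.

Lemma smooth1_is_derive f : smooth1 f -> forall x, is_derive x 1 f ((derive1 f) x).
Proof.
move=> Sf x; have [_ [f' df _]] := Sf 1%N.
by rewrite derive1E; apply: DeriveDef => //; have [] := df x.
Qed.

Lemma smooth1_derive1 f : smooth1 f -> smooth1 (derive1 f).
Proof.
move=> Sf n; have [_ [f' df cf']] := Sf n.+1.
suff -> : (derive1 f) = f' by [].
by apply/funext => x; rewrite derive1E; have [] := df x.
Qed.

Lemma flat0 n x : x <= 0 -> flat n x = 0.
Proof. by rewrite /flat leNgt => /negbTE ->. Qed.

Lemma le_flat0 : {homo flat 0 : x y / x <= y}.
Proof.
move=> x y xy; have [x0|x0] := ltP 0 x; last by rewrite flat0// flat_ge0.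
have y0 := lt_le_trans x0 xy.
by rewrite /flat x0 y0 !expr0 !mul1r ler_expR lerN2 lef_pV2.
Qed.

(** The factor [expR 1] normalises [flat 0] to the value 1 at 1. The inner term is at least 1 for
    [x <= 0] and vanishes for [x >= 1], whence a smooth transition from 0 to 1. Nesting avoids the
    usual quotient, so that products and compositions suffice for smoothness. *)
Definition step x : R := expR 1 * flat 0 (1 - expR 1 * flat 0 (1 - x)).

Lemma smooth1_step : smooth1 step.
Proof.
apply: (@smooth1M (cst (expR 1)) _); first exact: smooth1_cst.
apply: (@smooth1_comp (flat 0) _); first exact: smooth1_flat.
have aff f : smooth1 f -> smooth1 (fun x => 1 - expR 1 * f x).
  move=> Sf; have := smooth1_comp (smooth1_affine (- expR 1) 1) Sf.
  by congr smooth1; apply/funext => x /=; rewrite mulNr addrC.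
apply: aff; apply: (@smooth1_comp (flat 0) (fun x => 1 - x)); first exact: smooth1_flat.
have := smooth1_affine (-1) 1.
by congr smooth1; apply/funext => x; rewrite mulN1r addrC.
Qed.

Lemma flat01 : expR 1 * flat 0 1 = 1.
Proof.
by rewrite /flat ltr01 expr0 invr1 mul1r -expRD subrr expR0.
Qed.

Lemma step_ge0 x : 0 <= step x.
Proof. by rewrite mulr_ge0 ?expR_ge0 ?flat_ge0. Qed.

Lemma step_le1 x : step x <= 1.
Proof.
rewrite -[leRHS]flat01 ler_pM2l ?expR_gt0// le_flat0// gerBl.
by rewrite mulr_ge0 ?expR_ge0 ?flat_ge0.
Qed.

Lemma step0 x : x <= 0 -> step x = 0.
Proof.
move=> x0; rewrite /step flat0 ?mulr0// subr_le0 -[leLHS]flat01 ler_pM2l ?expR_gt0//.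
by rewrite le_flat0// lerDl oppr_ge0.
Qed.

Lemma step1 x : 1 <= x -> step x = 1.
Proof. by move=> x1; rewrite /step [flat 0 (1 - x)]flat0 ?subr_le0// mulr0 subr0 flat01. Qed.

Lemma derive_step0 x : x < 0 -> (derive1 step) x = 0.
Proof.
move=> x0; rewrite derive1E.
have -> : 'D_1 step x = 'D_1 (cst (0 : R)) x; last exact: derive_cst.
apply: near_eq_derive; near=> y; rewrite step0//= ltW//; near: y; exact: lt_nbhsl.
Unshelve. all: by end_near. Qed.

Lemma derive_step1 x : 1 < x -> (derive1 step) x = 0.
Proof.
move=> x0; rewrite derive1E.
have -> : 'D_1 step x = 'D_1 (cst (1 : R)) x; last exact: derive_cst.
apply: near_eq_derive; near=> y; rewrite step1//= ltW//; near: y; exact: lt_nbhsr.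
Unshelve. all: by end_near. Qed.

(** The derivative is continuous on the compact interval [[0, 1]] and vanishes off it. *)
Lemma derive_step_bounded : exists2 M, 0 <= M & forall x, `|(derive1 step) x| <= M.
Proof.
have c : {within `[0, 1], continuous (derive1 step)}.
  apply: continuous_subspaceT; apply: smooth1_continuous.
  exact/smooth1_derive1/smooth1_step.
have [M [Mr MP]] := compact_bounded (continuous_compact c (@segment_compact R 0 1)).
exists `|M + 1| => // x.
have [x0|x0] := ltP x 0; first by rewrite derive_step0// normr0.
have [x1|x1] := ltP 1 x; first by rewrite derive_step1// normr0.
apply: le_trans (ler_norm _).
by apply: (MP (M + 1)); [rewrite ltrDl|exists x => //=; rewrite in_itv/= x0].
Qed.

(** Both ramps, of width [e], lie inside []s, t[], so the support never leaves [[s, t]] and the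
    limit as [e] tends to 0 is the indicator of the open interval. *)
Definition cutoff (s t e x : R) : R := step ((x - s) / e) * step ((t - x) / e).

Lemma smooth1_cutoff s t e : smooth1 (cutoff s t e).
Proof.
apply: smooth1M.
  apply: (@smooth1_comp step (fun x => (x - s) / e)); first exact: smooth1_step.
  have := smooth1_affine e^-1 (- s / e).
  by congr smooth1; apply/funext => x /=; rewrite mulrBl mulNr mulrC.
apply: (@smooth1_comp step (fun x => (t - x) / e)); first exact: smooth1_step.
have := smooth1_affine (- e^-1) (t / e).
by congr smooth1; apply/funext => x /=; rewrite mulrBl mulNr addrC [e^-1 * _]mulrC.
Qed.

Lemma cutoff_ge0 s t e x : 0 <= cutoff s t e x.
Proof. by rewrite mulr_ge0 ?step_ge0. Qed.

Lemma cutoff_le1 s t e x : cutoff s t e x <= 1.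
Proof. by rewrite mulr_ile1 ?step_ge0 ?step_le1. Qed.

Lemma cutoff_out s t e x : 0 < e -> ~~ (s < x < t) -> cutoff s t e x = 0.
Proof.
move=> e0; rewrite negb_and -!leNgt => /orP[xs|tx]; rewrite /cutoff.
  by rewrite step0 ?mul0r// pmulr_lle0 ?invr_gt0// subr_le0.
by rewrite [X in _ * X]step0 ?mulr0// pmulr_lle0 ?invr_gt0// subr_le0.
Qed.

Lemma cutoff_in s t e x : 0 < e -> s + e <= x <= t - e -> cutoff s t e x = 1.
Proof.
move=> e0 /andP[sx xt]; rewrite /cutoff !step1 ?mulr1//.
  by rewrite ler_pdivlMr// mul1r; lra.
by rewrite ler_pdivlMr// mul1r; lra.
Qed.

Lemma derive_cutoff s t e x : e != 0 ->
  derive1 (cutoff s t e) x = e^-1 * (derive1 step) ((x - s) / e) * step ((t - x) / e)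
    - e^-1 * step ((x - s) / e) * (derive1 step) ((t - x) / e).
Proof.
move=> e0; rewrite derive1E.
have ds := smooth1_is_derive smooth1_step.
have d1 : is_derive x 1 (fun x => (x - s) / e) e^-1.
  by apply: is_derive_eq; rewrite /GRing.scale/= !(mulr0, add0r, subr0, mulr1).
have d2 : is_derive x 1 (fun x => (t - x) / e) (- e^-1).
  by apply: is_derive_eq; rewrite /GRing.scale/= !(mulr0, add0r, subr0, mulrN1).
have := is_deriveM
  (@is_derive1_comp _ step (fun x => (x - s) / e) _ _ _ (ds _) d1)
  (@is_derive1_comp _ step (fun x => (t - x) / e) _ _ _ (ds _) d2).
move=> dM; have -> := @derive_val _ _ _ _ _ _ _ dM.
rewrite /GRing.scale/=; move: (derive1 step _) (derive1 step _) (step _) (step _) => A B C D.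
rewrite !mulrN addrC; congr (_ - _); last by rewrite mulrA mulrC mulrA.
by rewrite [LHS]mulrC [A / e]mulrC.
Qed.

Lemma cutoff_cvg s t (e : nat -> R) x : (forall n, 0 < e n) -> e n @[n --> \oo] --> 0 ->
  cutoff s t (e n) x @[n --> \oo] --> (\1_`]s, t[%classic x : R).
Proof.
move=> e0 ecvg; rewrite indicE mem_setE in_itv/=.
have [/andP[sx xt]|xst] := boolP (s < x < t); last first.
  by under eq_fun do rewrite cutoff_out//; exact: cvg_cst.
apply: cvg_near_cst; near=> n.
apply: cutoff_in => //=.
have : e n < Num.min (x - s) (t - x).
  near: n; apply: (cvgr_lt 0) => //.
  by rewrite lt_min !subr_gt0 sx.
by rewrite lt_min => /andP[? ?]; lra.
Unshelve. all: by end_near. Qed.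

Definition tensor f g (z : R * R) : R := f z.1 * g z.2.

Lemma continuous_fst : continuous (fun z : R * R => z.1).
Proof.
move=> z U zU; exists (U, setT) => /=; last by move=> x [].
by split => //; exact: filterT.
Qed.

Lemma continuous_snd : continuous (fun z : R * R => z.2).
Proof.
move=> z U zU; exists (setT, U) => /=; last by move=> x [].
by split => //; exact: filterT.
Qed.

Lemma continuous_tensor f g : continuous f -> continuous g ->
  continuous (tensor f g).
Proof.
move=> cf cg z.
have h1 : {for z, continuous (f \o fst)}.
  by apply: continuous_comp; [exact: continuous_fst|exact: cf].
have h2 : {for z, continuous (g \o snd)}.
  by apply: continuous_comp; [exact: continuous_snd|exact: cg].
exact: (cvgM h1 h2).
Qed.

Lemma is_derive_tensor_e1 f g z : smooth1 f ->
  is_derive z e1 (tensor f g) (tensor (derive1 f) g z).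
Proof.
move=> Sf; have [df vf] := smooth1_is_derive Sf z.1.
suff cv : h^-1 *: ((tensor f g \o shift z) (h *: e1) - tensor f g z) @[h --> 0^']
    --> (tensor (derive1 f) g z : R).
  by apply: DeriveDef; [apply/cvg_ex; eexists; exact: cv|exact: cvg_lim cv].
rewrite [X in _ --> X]/tensor -vf.
have -> : (fun h : R => h^-1 *: ((tensor f g \o shift z) (h *: e1) - tensor f g z)) =
    (fun h : R => h^-1 *: ((f \o shift z.1) (h *: 1) - f z.1)) \* cst (g z.2).
  by apply/funext => h; rewrite /tensor/= /GRing.scale/= mulr0 add0r -mulrBl mulrA.
by apply: cvgM; [exact: df|exact: cvg_cst].
Qed.

Lemma is_derive_tensor_e2 f g z : smooth1 g ->
  is_derive z e2 (tensor f g) (tensor f (derive1 g) z).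
Proof.
move=> Sg; have [dg vg] := smooth1_is_derive Sg z.2.
suff cv : h^-1 *: ((tensor f g \o shift z) (h *: e2) - tensor f g z) @[h --> 0^']
    --> (tensor f (derive1 g) z : R).
  by apply: DeriveDef; [apply/cvg_ex; eexists; exact: cv|exact: cvg_lim cv].
rewrite [X in _ --> X]/tensor -vg.
have -> : (fun h : R => h^-1 *: ((tensor f g \o shift z) (h *: e2) - tensor f g z)) =
    cst (f z.1) \* (fun h : R => h^-1 *: ((g \o shift z.2) (h *: 1) - g z.2)).
  apply/funext => h; rewrite /tensor/= /GRing.scale/= mulr0 add0r -mulrBr.
  by rewrite mulrCA.
by apply: cvgM; [exact: cvg_cst|exact: dg].
Qed.

Lemma derive_tensor_e2 f g : smooth1 g ->
  'D_e2 (tensor f g) = tensor f (derive1 g).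
Proof. by move=> Sg; apply/funext => z; have [] := is_derive_tensor_e2 f z Sg. Qed.

Lemma smooth_on_tensor f g : smooth1 f -> smooth1 g -> smooth_on setT (tensor f g).
Proof.
move=> Sf Sg n; elim: n f g Sf Sg => [|n IH] f g Sf Sg /=; split => //.
- by move=> z _; apply: continuous_tensor; exact: smooth1_continuous.
- by move=> z _; apply: continuous_tensor; exact: smooth1_continuous.
- split.
  + move=> z _; have [] := is_derive_tensor_e1 g z Sf.
    by have [] := is_derive_tensor_e2 f z Sg.
  + rewrite (_ : 'D_e1 _ = tensor (derive1 f) g).
      by apply: IH => //; exact: smooth1_derive1.
    by apply/funext => z; have [] := is_derive_tensor_e1 g z Sf.
  + by rewrite derive_tensor_e2//; apply: IH => //; exact: smooth1_derive1.
Qed.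

Lemma test_function_tensor (D : set (R * R)) f g (a b s t : R) :
  smooth1 f -> smooth1 g -> `[a, b] `*` `[s, t] `<=` D ->
  (forall x, ~~ (a < x < b) -> f x = 0) -> (forall x, ~~ (s < x < t) -> g x = 0) ->
  test_function D (tensor f g).
Proof.
move=> Sf Sg KD f0 g0; split; first exact: smooth_on_tensor.
exists (`[a, b] `*` `[s, t]); split => //.
  by apply: compact_setX; exact: segment_compact.
move=> z zK; rewrite /tensor; have [zab|zab] := boolP (a < z.1 < b); last first.
  by rewrite f0 ?mul0r.
rewrite g0 ?mulr0//; apply/negP => /andP[z1 z2]; apply: zK; split => /=.
  by case/andP: zab => ? ?; rewrite in_itv/= !ltW.
by rewrite in_itv/= !ltW.
Qed.

End smooth_functions.

(** * Weak derivatives and traces on a rectangle *)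

Section integral_facts.
Context d (T : measurableType d) (R : realType) (mu : {measure set T -> \bar R}).
Implicit Types (D : set T) (f g h : T -> R).

Lemma le_integrableR D f g : measurable D -> measurable_fun D f ->
  (forall x, D x -> `|f x| <= g x) -> mu.-integrable D (EFin \o g) ->
  mu.-integrable D (EFin \o f).
Proof.
move=> mD mf fg; apply: le_integrable => //; first exact/measurable_EFinP.
by move=> x Dx /=; rewrite lee_fin (le_trans (fg x Dx))// ler_norm.
Qed.

Lemma integrable_boundedM D f h c : measurable D -> measurable_fun D h ->
  (forall x, D x -> `|h x| <= c) -> mu.-integrable D (EFin \o f) ->
  mu.-integrable D (EFin \o (fun x => f x * h x)).
Proof.
move=> mD mh hc fi.
have mf : measurable_fun D f by exact/measurable_EFinP/(measurable_int mu).
apply: (@le_integrableR _ _ (fun x => c * `|f x|)) => //.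
- exact: measurable_funM.
- by move=> x Dx; rewrite normrM mulrC ler_wpM2r// hc.
- have := integrableZl mD c (integrable_abse fi).
  by apply: eq_integrable.
Qed.

Lemma integrableR_B D f g : measurable D ->
  mu.-integrable D (EFin \o f) -> mu.-integrable D (EFin \o g) ->
  mu.-integrable D (EFin \o (fun x => f x - g x)).
Proof. by move=> mD fi gi; apply: eq_integrable (integrableB mD fi gi). Qed.

Lemma integrableR_D D f g : measurable D ->
  mu.-integrable D (EFin \o f) -> mu.-integrable D (EFin \o g) ->
  mu.-integrable D (EFin \o (fun x => f x + g x)).
Proof. by move=> mD fi gi; apply: eq_integrable (integrableD mD fi gi). Qed.

Lemma integrableR_Z D c f : measurable D ->
  mu.-integrable D (EFin \o f) -> mu.-integrable D (EFin \o (fun x => c * f x)).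
Proof. by move=> mD fi; apply: eq_integrable (integrableZl mD c fi). Qed.

Lemma integrableR_norm D f : measurable D ->
  mu.-integrable D (EFin \o f) -> mu.-integrable D (EFin \o (fun x => `|f x|)).
Proof. by move=> mD fi; apply: eq_integrable (integrable_abse fi). Qed.

Lemma integrable_cst D (c : R) : measurable D -> (mu D < +oo)%E ->
  mu.-integrable D (EFin \o cst c).
Proof.
move=> mD Dfin; apply/integrableP; split.
  exact/measurable_EFinP/measurable_cst.
by rewrite [X in (X < _)%E](_ : _ = \int[mu]_(x in D) (cst `|c|%:E) x)%E// integral_cst// lte_mul_pinfty.
Qed.

Lemma Rintegral_dominated_cvg D (f_ : nat -> T -> R) f g : measurable D ->
  (forall n, measurable_fun D (f_ n)) ->
  (forall x, D x -> f_ n x @[n --> \oo] --> f x) ->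
  mu.-integrable D (EFin \o g) ->
  (forall n x, D x -> `|f_ n x| <= g x) ->
  \int[mu]_(x in D) f_ n x @[n --> \oo] --> \int[mu]_(x in D) f x.
Proof.
move=> mD mf ff ig fg.
have Eff x : D x -> (f_ n x)%:E @[n --> \oo] --> (f x)%:E.
  by move=> Dx; apply: cvg_EFin; [exact: nearW|exact: ff].
have mEf n : measurable_fun D (EFin \o f_ n) by exact/measurable_EFinP.
have mlim : measurable_fun D f.
  apply/measurable_EFinP; exact: (emeasurable_fun_cvg (fun n => EFin \o f_ n)).
have fgx x : D x -> `|f x| <= g x.
  move=> Dx; have /cvg_norm cf := ff x Dx.
  rewrite -(cvg_lim _ cf)//; apply: limr_le; first by apply/cvg_ex; exists `|f x|.
  by apply: nearW => n; exact: fg.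
have fi : mu.-integrable D (EFin \o f) by exact: (le_integrableR mD mlim fgx ig).
have h : (\int[mu]_(x in D) (f_ n x)%:E)%E @[n --> \oo] -->
   ((\int[mu]_(x in D) f x)%:E)%E.
  rewrite /Rintegral fineK; last exact: integrable_fin_num.
  by apply: (@dominated_cvg _ _ _ _ _ mD (fun n => EFin \o f_ n) _ (EFin \o g)).
exact: fine_cvg h.
Qed.

End integral_facts.

#[local] Instance ae_lebesgue_filter (R : realType) :
  Filter (nbhs (almost_everywhere (@lebesgue_measure R))).
Proof. exact: ae_filter_ringOfSetsType. Qed.

(** * Lebesgue points in one variable *)

Section one_dimensional.
Context {R : realType}.
Notation mu := (@lebesgue_measure R).
Implicit Types (f G m n : R -> R) (x : R).

Lemma lebesgue_pt_le f x (e : R) : lebesgue_pt f x -> 0 < e ->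
  \forall r \near 0^'+,
    (\int[mu]_(y in ball x r) `|(f y - f x)%:E| <= (e * r)%:E)%E.
Proof.
move=> fx e0.
(* The ball has length [2 r], so a mean deviation of at most [e / 2] integrates to at most
   [e * r]. *)
have e20 : 0 < e / 2 by rewrite divr_gt0.
have := fx; rewrite /lebesgue_pt => /fine_cvgP[fin cv].
move/cvgr0Pnorm_le : cv => /(_ _ e20) cv.
near=> r.
have r0 : 0 < r by near: r; exact: nbhs_right_gt.
have : davg f x r \is a fin_num by near: r; exact: fin.
have : `|fine (davg f x r)| <= e / 2 by near: r; exact: cv.
move=> h1 h2.
have : (davg f x r <= (e / 2)%:E)%E.
  by rewrite -(fineK h2) lee_fin (le_trans (ler_norm _)).
rewrite /davg /iavg.
have -> : ((mu (ball x r))^-1)%E = (r *+ 2)^-1%:E.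
  by rewrite lebesgue_measure_ball ?ltW// inver mulrn_eq0/= gt_eqF.
move=> h3.
rewrite -(@lee_pmul2l _ (r *+ 2)^-1%:E)//; last by rewrite lte_fin invr_gt0 pmulrn_lgt0.
apply: le_trans h3 _; rewrite -EFinM lee_fin [leRHS]mulrC ler_pdivlMr ?pmulrn_lgt0// -mulr_natr.
lra.
Unshelve. all: by end_near. Qed.

(** The bound holds for all subsets of one ball simultaneously, because it is applied to intervals
    that are not centred at [x] and may have [x] as an endpoint. *)
Lemma lebesgue_pt_Rintegral_le f x (e : R) : mu.-integrable setT (EFin \o f) ->
  lebesgue_pt f x -> 0 < e ->
  \forall r \near 0^'+, forall D, measurable D -> D `<=` ball x r ->
    \int[mu]_(y in D) `|f y - f x| <= e * r.
Proof.
move=> fi fx e0; near=> r => D mD Dr.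
have r0 : 0 < r by near: r; exact: nbhs_right_gt.
have mf : measurable_fun setT f by move: fi => /measurable_int/measurable_EFinP.
have mfx : measurable_fun setT (fun y => f y - f x) by exact: measurable_funB.
have : (\int[mu]_(y in ball x r) `|(f y - f x)%:E| <= (e * r)%:E)%E.
  by near: r; exact: lebesgue_pt_le.
move=> h2; have h1 : (\int[mu]_(y in D) `|(f y - f x)%:E| <= (e * r)%:E)%E.
  apply: le_trans h2; apply: ge0_subset_integral => //; first exact: measurable_ball.
  by apply/measurable_EFinP/measurableT_comp => //; exact: measurable_funTS.
rewrite -lee_fin /Rintegral fineK// ge0_fin_numE; first exact: le_lt_trans (ltry (e * r)).
by apply: integral_ge0.
Unshelve. all: by end_near. Qed.

(** Suppose [G x] is nonzero at a Lebesgue point. A rational interval around [x] inside the ball of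
    radius [r], of length more than [r], has zero integral, so the deviation from [G x] integrates
    to more than [|G x| * r], against the bound [|G x| / 2 * r]. Rational endpoints make the
    criterion usable when the hypothesis holds only off a null set for each interval. *)
Lemma ae_eq0_of_rat_itv (a b : R) G : mu.-integrable setT (EFin \o G) ->
  (forall p q : rat, a < ratr p -> ratr p < ratr q :> R -> ratr q < b ->
    \int[mu]_(x in `]ratr p, ratr q[) G x = 0) ->
  {ae mu, forall x, a < x < b -> G x = 0}.
Proof.
move=> Gi G0.
have Gl : locally_integrable setT G by apply: open_integrable_locally => //; exact: openT.
have := lebesgue_differentiation Gl; apply: filterS => x Gx /andP[ax xb].
apply/eqP; apply: contraT => Gx0.
have c0 : 0 < `|G x| / 2 by rewrite divr_gt0// normr_gt0.
have /(_ _ _ Gx c0) H := lebesgue_pt_Rintegral_le Gi.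
near (0 : R)^'+ => r.
have r0 : 0 < r by near: r; exact: nbhs_right_gt.
have rax : r < Num.min (x - a) (b - x).
  by near: r; apply: nbhs_right_lt; rewrite lt_min !subr_gt0 ax.
have : forall D, measurable D -> D `<=` ball x r ->
    \int[mu]_(y in D) `|G y - G x| <= `|G x| / 2 * r by near: r.
move=> Hr.
have [p] : exists q : rat, ratr q \in `](x - r), (x - r / 2)[ by apply: rat_in_itvoo; lra.
have [q] : exists q : rat, ratr q \in `](x + r / 2), (x + r)[ by apply: rat_in_itvoo; lra.
rewrite !in_itv/= => /andP[q1 q2] /andP[p1 p2].
move: rax; rewrite lt_min => /andP[rax rbx].
have pq : ratr p < ratr q :> R by lra.
have ap : a < ratr p by lra.
have qb : ratr q < b by lra.
have := G0 p q ap pq qb => G0pq.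
have mI : measurable (`](ratr p : R), (ratr q : R)[%classic) by exact: measurable_itv.
have muI : mu `](ratr p : R), (ratr q : R)[%classic = (ratr q - ratr p)%:E.
  by rewrite lebesgue_measure_itv/= lte_fin pq.
have GI : mu.-integrable `](ratr p : R), (ratr q : R)[%classic (EFin \o G).
  exact: integrableS Gi.
have cI : mu.-integrable `](ratr p : R), (ratr q : R)[%classic (EFin \o cst (G x)).
  by apply: integrable_cst => //; rewrite [ltLHS]muI ltry.
have Ib : `](ratr p : R), (ratr q : R)[%classic `<=` ball x r.
  move=> y; rewrite /= in_itv/= /ball/= => /andP[py yq]; rewrite ltr_distlC; lra.
have := Hr _ mI Ib.
have h1 : `|\int[mu]_(y in `]ratr p, ratr q[) (G y - G x)| <=
    \int[mu]_(y in `]ratr p, ratr q[) `|G y - G x|.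
  by apply: le_normr_Rintegral => //; exact: integrableR_B _ GI cI.
have h2 : \int[mu]_(y in `]ratr p, ratr q[) (G y - G x) = - (G x * (ratr q - ratr p)).
  rewrite (RintegralB _ GI cI)// G0pq sub0r Rintegral_cst//.
  by rewrite [X in fine X](_ : _ = (ratr q - ratr p)%:E).
have := le_trans h1 (Hr _ mI Ib).
have qp : 0 <= ratr q - ratr p :> R by rewrite subr_ge0 ltW.
rewrite h2 normrN normrM (ger0_norm qp).
have -> : `|G x| / 2 * r = `|G x| * (r / 2) by lra.
rewrite ler_pM2l ?normr_gt0// => ?; lra.
Unshelve. all: by end_near. Qed.

End one_dimensional.

(** * From a weak derivative to increments in one variable *)

Section weak_to_ac.
Context {R : realType}.
Notation mu := (@lebesgue_measure R).
Implicit Types (m n : R -> R) (s t e x : R).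

Lemma lebesgue_measure_bnd_lty (b1 b2 : bool) (p q : R) :
  (mu [set` Interval (BSide b1 p) (BSide b2 q)] < +oo)%E.
Proof. by rewrite lebesgue_measure_itv; case: ifP => // _; rewrite -EFinB ltry. Qed.

Lemma cvg_at_right0 (u : nat -> R) : (forall k, 0 < u k) ->
  u k @[k --> \oo] --> 0 -> u k @[k --> \oo] --> 0^'+.
Proof.
move=> u0 ucv U [r /= r0 HU].
have : \forall k \near \oo, `|u k| < r by apply: cvgr0_norm_lt.
apply: filterS => k uk; apply: HU => //=.
by rewrite sub0r normrN.
Qed.

Lemma derive_cutoff_out s t e x : 0 < e ->
  x < s \/ t < x \/ (s + e < x /\ x < t - e) -> derive1 (cutoff s t e) x = 0.
Proof.
move=> e0; rewrite derive_cutoff ?gt_eqF//.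
have lt1 y : 0 < e -> e < y -> 1 < y / e by move=> *; rewrite ltr_pdivlMr// mul1r.
have lt0 y : 0 < e -> y < 0 -> y / e < 0 by move=> *; rewrite pmulr_llt0 ?invr_gt0.
case=> [xs|[tx|[sx xt]]].
- rewrite [derive1 step ((x - _) / _)]derive_step0 ?[step ((x - _) / _)]step0.
  + by rewrite !(mulr0, mul0r, subr0).
  + by rewrite ltW// lt0// subr_lt0.
  + by rewrite lt0// subr_lt0.
- rewrite [derive1 step ((t - _) / _)]derive_step0 ?[step ((t - _) / _)]step0.
  + by rewrite !(mulr0, mul0r, subr0).
  + by rewrite ltW// lt0// subr_lt0.
  + by rewrite lt0// subr_lt0.
- rewrite !derive_step1 ?lt1//; [|lra|lra].
  by rewrite !(mulr0, mul0r, subr0).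
Qed.

Lemma derive_cutoff_bounded : exists2 M : R, 0 <= M &
  forall s t e x, 0 < e -> `|derive1 (cutoff s t e) x| <= M / e.
Proof.
have [M M0 HM] := @derive_step_bounded R; exists (M + M); first exact: addr_ge0.
move=> s t e x e0; rewrite derive_cutoff ?gt_eqF//; apply: le_trans (ler_normB _ _) _.
have st y : `|step y| <= 1 by rewrite ger0_norm ?step_ge0 ?step_le1.
have key (u v : R) : `|u| <= M -> `|v| <= 1 -> `|e^-1 * u * v| <= M / e.
  move=> uM v1; have ei0 : 0 <= e^-1 by rewrite invr_ge0 ltW.
  rewrite 2!normrM (ger0_norm ei0) -mulrA mulrC ler_wpM2r//.
  by rewrite -[M]mulr1 ler_pM.
rewrite [(M + M) / e]mulrDl; apply: lerD; first by apply: key.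
by rewrite mulrAC; exact: key.
Qed.

Lemma continuous_derive_cutoff s t e : continuous (derive1 (cutoff s t e)).
Proof. exact/smooth1_continuous/smooth1_derive1/smooth1_cutoff. Qed.

Lemma measurable_continuousR (f : R -> R) (D : set R) : continuous f -> measurable_fun D f.
Proof.
by move=> cf; apply: measurable_funS (continuous_measurable_fun cf).
Qed.

Lemma Rintegral_derive_cutoff s t e p q : 0 < e -> p < q ->
  \int[mu]_(x in `[p, q]) derive1 (cutoff s t e) x = cutoff s t e q - cutoff s t e p.
Proof.
move=> e0 pq; rewrite /Rintegral.
have cc := smooth1_continuous (smooth1_cutoff s t e).
rewrite (@continuous_FTC2 _ _ (cutoff s t e))//.
  by apply: continuous_subspaceT; exact: continuous_derive_cutoff.
split => [x _||].
- by have [] := smooth1_is_derive (smooth1_cutoff s t e) x.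
- by apply: cvg_at_right_filter; exact: cc.
- by apply: cvg_at_left_filter; exact: cc.
Qed.

(** On a window of width [e] the derivative of the cut-off is at most [M / e], while [m] deviates
    from [m x] by at most [eta * (2 * e)] in the mean. The widths cancel, and replacing [m] by its
    value costs an error independent of [e]. *)
Lemma Rintegral_derive_cutoff_near m s x e p (M eta : R) t :
  mu.-integrable setT (EFin \o m) -> 0 < e ->
  (forall x, `|derive1 (cutoff s t e) x| <= M / e) ->
  (forall D, measurable D -> D `<=` ball x (2 * e) ->
    \int[mu]_(y in D) `|m y - m x| <= eta * (2 * e)) ->
  p <= x <= p + e ->
  `|\int[mu]_(y in `[p, p + e]) (m y * derive1 (cutoff s t e) y)
    - m x * (cutoff s t e (p + e) - cutoff s t e p)| <= M * (2 * eta).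
Proof.
move=> mi e0 HM Heta /andP[px xp].
set D := `[p, p + e]%classic.
have mD : measurable D by exact: measurable_itv.
have mid : mu.-integrable D (EFin \o m) by exact: integrableS mi.
have Dfin : (mu D < +oo)%E by exact: lebesgue_measure_bnd_lty.
have cid : mu.-integrable D (EFin \o cst (m x)).
  by apply: integrable_cst => //; exact: Dfin.
have mc : measurable_fun D (derive1 (cutoff s t e)).
  by apply: measurable_continuousR; exact: continuous_derive_cutoff.
have HMD y : D y -> `|derive1 (cutoff s t e) y| <= M / e by [].
rewrite -Rintegral_derive_cutoff//; last by rewrite ltrDl.
rewrite -/D.
set c' := derive1 (cutoff s t e) in mc HMD *.
have i1 : mu.-integrable D (EFin \o (fun y => m y * c' y)).
  by apply: integrable_boundedM; [exact: mD|exact: mc|exact: HMD|exact: mid].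
have i2 : mu.-integrable D (EFin \o c').
  apply: le_integrableR; [exact: mD|exact: mc|exact: HMD|].
  by apply: integrable_cst => //; exact: Dfin.
have i3 := integrableR_Z (m x) _ i2; have {}i3 := i3 mD.
rewrite -(RintegralZl _ _ i2)// -RintegralB//.
have i4 : mu.-integrable D (EFin \o (fun y => `|m y - m x|)).
  by apply: integrableR_norm => //; exact: integrableR_B.
apply: (@le_trans _ _ (\int[mu]_(y in D) (M / e * `|m y - m x|))).
  apply: (le_trans (le_normr_Rintegral _ (integrableR_B _ i1 i3))) => //.
  apply: le_Rintegral => //.
  - by apply: integrableR_norm => //; exact: integrableR_B.
  - exact: integrableR_Z.
  - move=> y Dy; rewrite -mulrBl normrM mulrC ler_wpM2r//; exact: HM.
rewrite (RintegralZl _ _ i4)//.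
(* Radius [e] would not do: balls are open, and [x] may be an endpoint of the window. *)
have De : D `<=` ball x (2 * e).
  move=> y; rewrite /D/= in_itv/= /ball/= => /andP[py yp].
  rewrite ltr_distlC; apply/andP; split; lra.
have MeN : 0 <= M / e by apply: le_trans (HM x); exact: normr_ge0.
apply: le_trans (ler_wpM2l MeN (Heta _ mD De)) _.
rewrite !mulrA; have -> : M / e * eta * 2 * e = M * eta * 2 * (e / e) by clear; lra.
by rewrite divff ?gt_eqF// mulr1; clear; lra.
Qed.

(* As e tends to 0 the derivative of the cut-off concentrates at s and t, which are
   Lebesgue points of m. *)
Lemma ac_of_weak m n s t : mu.-integrable setT (EFin \o m) ->
  mu.-integrable setT (EFin \o n) -> s < t -> lebesgue_pt m s -> lebesgue_pt m t ->
  (forall e, 0 < e -> \int[mu]_y (m y * derive1 (cutoff s t e) y) =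
                    - \int[mu]_y (n y * cutoff s t e y)) ->
  m t - m s = \int[mu]_(y in `]s, t[) n y.
Proof.
move=> mi ni st ms mt weak.
have [M M0 HM] := derive_cutoff_bounded.
pose e_ j : R := j.+1%:R^-1.
have e_gt0 j : 0 < e_ j by rewrite invr_gt0.
have e_cvg : e_ j @[j --> \oo] --> 0 by exact: cvg_harmonic.
have mT : measurable [set: R] by [].
have ncvg : \int[mu]_y (n y * cutoff s t (e_ j) y) @[j --> \oo] -->
    \int[mu]_(y in `]s, t[) n y.
  rewrite Rintegral_mkcond.
  apply: (@Rintegral_dominated_cvg _ _ _ mu setT _ _ (fun y => `|n y|)) => //.
  - move=> j; apply: measurable_funM.
      by move: ni => /measurable_int/measurable_EFinP.
    by apply: measurable_continuousR; apply: smooth1_continuous; exact: smooth1_cutoff.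
  - move=> y _; rewrite patchE.
    have -> : (if y \in `]s, t[%classic then n y else point) = n y * \1_`]s, t[%classic y.
      by rewrite indicE; case: ifPn => _; rewrite ?mulr1 ?mulr0.
    by apply: cvgM; [exact: cvg_cst|exact: cutoff_cvg].
  - exact: integrableR_norm.
  - move=> j y _; rewrite normrM ler_piMr// ger0_norm ?cutoff_ge0 ?cutoff_le1//.
have mcvg : \int[mu]_y (m y * derive1 (cutoff s t (e_ j)) y) @[j --> \oo] -->
    m s - m t.
  apply/cvgrPdist_le => eta eta0.
  (* Each of the two endpoints costs [M * (2 * eta')]; [M + 1] keeps the denominator positive when
     [M] is 0. *)
  pose eta' := eta / (4 * (M + 1)).
  have eta'0 : 0 < eta' by rewrite divr_gt0// mulr_gt0// ltr_wpDl.
  have Hs := lebesgue_pt_Rintegral_le mi ms eta'0.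
  have Ht := lebesgue_pt_Rintegral_le mi mt eta'0.
  have e2cvg : 2 * e_ j @[j --> \oo] --> 0^'+.
    apply: cvg_at_right0 => [j|]; first by rewrite mulr_gt0.
    by rewrite -[X in _ --> X](mulr0 2); apply: cvgM => //; exact: cvg_cst.
  near=> j.
  have e0 := e_gt0 j.
  have Hsj : forall D, measurable D -> D `<=` ball s (2 * e_ j) ->
      \int[mu]_(y in D) `|m y - m s| <= eta' * (2 * e_ j).
    by near: j; exact: (e2cvg _ Hs).
  have Htj : forall D, measurable D -> D `<=` ball t (2 * e_ j) ->
      \int[mu]_(y in D) `|m y - m t| <= eta' * (2 * e_ j).
    by near: j; exact: (e2cvg _ Ht).
  (* This separates the two ramps, which carry the whole derivative of the cut-off. *)
  have ej : e_ j < (t - s) / 3.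
    by near: j; apply: (cvgr_lt 0) => //; rewrite divr_gt0// subr_gt0.
  have st' : s + e_ j < t - e_ j by lra.
  have := Rintegral_derive_cutoff_near mi e0 (fun x => HM s t _ x e0) Hsj.
  move=> /(_ s); rewrite lexx lerDl (ltW e0) => /(_ isT) h1.
  have := Rintegral_derive_cutoff_near mi e0 (fun x => HM s t _ x e0) Htj.
  move=> /(_ (t - e_ j)); rewrite subrK lexx gerBl (ltW e0) => /(_ isT) h2.
  move: h1 h2; rewrite [cutoff s t (e_ j) s]cutoff_out ?ltxx//.
  rewrite [cutoff s t (e_ j) t]cutoff_out ?ltxx ?andbF//.
  have Es : cutoff s t (e_ j) (s + e_ j) = 1.
    by apply: cutoff_in => //; rewrite lexx/= ltW.
  have Et : cutoff s t (e_ j) (t - e_ j) = 1.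
    by apply: cutoff_in => //; rewrite lexx/= andbT ltW.
  rewrite Es Et => h1 h2.
  have mcE : \int[mu]_y (m y * derive1 (cutoff s t (e_ j)) y) =
      \int[mu]_(y in `[s, s + e_ j]) (m y * derive1 (cutoff s t (e_ j)) y) +
      \int[mu]_(y in `[t - e_ j, t]) (m y * derive1 (cutoff s t (e_ j)) y).
    rewrite -Rintegral_setU//.
    - rewrite [RHS]Rintegral_mkcond; congr Rintegral; apply/funext => y.
      rewrite patchE; case: ifPn => //; rewrite in_setU negb_or => /andP[].
      rewrite !mem_setE !in_itv/= !negb_and -!ltNge => H1 H2.
      rewrite derive_cutoff_out ?mulr0//.
      by move: H1 H2 => /orP[|] ? /orP[|] ?; [left|left|right;right|right;left].
    - apply: (@integrableS _ _ _ _ setT) => //.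
        by apply: measurableU; exact: measurable_itv.
      apply: integrable_boundedM => //.
        by apply: measurable_continuousR; exact: continuous_derive_cutoff.
      by move=> y _; exact: (HM s t (e_ j) y e0).
    - apply/disj_setPS => y [] /=; rewrite !in_itv/= => /andP[_ y1] /andP[y2 _].
      by have := lt_le_trans st' (le_trans y2 y1); rewrite ltxx.
  rewrite mcE.
  set P := (\int[_]_(_ in _) _) in h1 *; set Q := (\int[_]_(_ in _) _) in h2 *.
  have -> : m s - m t - (P + Q) = - (P - m s * (1 - 0)) - (Q - m t * (0 - 1)) by clear; lra.
  apply: le_trans (ler_normB _ _) _; rewrite normrN; apply: le_trans (lerD h1 h2) _.
  have -> : M * (2 * eta') + M * (2 * eta') = (4 * eta') * M by clear; lra.
  have -> : eta = (4 * eta') * (M + 1).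
    rewrite /eta' mulrAC [RHS]mulrC divfK//.
    by rewrite gt_eqF// mulr_gt0// ltr_wpDl.
  by apply: ler_wpM2l; [rewrite mulr_ge0 ?ltW|rewrite lerDl].
have : (- \int[mu]_y (n y * cutoff s t (e_ j) y)) @[j --> \oo] --> m s - m t.
  by rewrite (_ : (fun j => _) = (fun j => \int[mu]_y (m y * derive1 (cutoff s t (e_ j)) y)))//;
    apply/funext => j; rewrite weak.
move=> /(cvg_unique (@norm_hausdorff R _) (cvgN ncvg)) h.
by rewrite -[RHS]opprK h opprB.
Unshelve. all: by end_near. Qed.

End weak_to_ac.

Lemma Rintegral_indicr d (T : measurableType d) (R : realType)
    (mu : {measure set T -> \bar R}) (A : set T) (g : T -> R) :
  \int[mu]_(x in A) g x = \int[mu]_x (g x * \1_A x).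
Proof.
rewrite Rintegral_mkcond; congr Rintegral; apply/funext => x.
by rewrite patchE indicE; case: ifPn => _; rewrite ?mulr1 ?mulr0.
Qed.

Lemma integrable_fine d (T : measurableType d) (R : realType)
    (mu : {measure set T -> \bar R}) (D : set T) (F : T -> \bar R) :
  measurable D -> mu.-integrable D F -> mu.-integrable D (EFin \o (fine \o F)).
Proof.
move=> mD Fi; have mF := measurable_int _ Fi.
apply: le_integrable Fi => //.
  by apply/measurable_EFinP; apply: (measurable_comp measurableT).
by move=> x _ /=; case: (F x) => [r| |] //=; rewrite normr0 ?leey.
Qed.

Lemma ae_eq_Rintegral d (T : measurableType d) (R : realType)
    (mu : {measure set T -> \bar R}) (D : set T) (f g : T -> R) :
  measurable D -> measurable_fun D f -> measurable_fun D g ->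
  {ae mu, forall x, D x -> f x = g x} ->
  \int[mu]_(x in D) f x = \int[mu]_(x in D) g x.
Proof.
move=> mD mf mg fg; congr fine; apply: ae_eq_integral => //.
- exact/measurable_EFinP.
- exact/measurable_EFinP.
- by apply: filterS fg => x fgx /= Dx; rewrite fgx.
Qed.

(** * Fubini for real-valued integrals *)

Section real_fubini.
Context d1 d2 (T1 : measurableType d1) (T2 : measurableType d2) (R : realType).
Variables (m1 : {sigma_finite_measure set T1 -> \bar R})
          (m2 : {sigma_finite_measure set T2 -> \bar R}).
Variable f : T1 * T2 -> R.
Hypothesis fi : (m1 \x m2)%E.-integrable setT (EFin \o f).

Lemma integrable_fubini_G : m2.-integrable setT (fubini_G m1 (EFin \o f)).
Proof.
have mf := measurable_int _ fi.
apply/integrableP; split; first exact: (measurable_fubini_G fi).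
apply: le_lt_trans ((integrable21ltyP m1 m2 mf).1 fi).
apply: ge0_le_integral => //.
- by apply: measurableT_comp => //; exact: (measurable_fubini_G fi).
- apply: (measurable_fun_fubini_tonelli_G (abse \o (EFin \o f))).
    exact: measurableT_comp.
  by move=> z; exact: abse_ge0.
- move=> y _; apply: le_abse_integral => //.
  exact: measurableT_comp.
Qed.

Lemma integrable_Rfubini1 :
  m1.-integrable setT (EFin \o (fun x => \int[m2]_y f (x, y))).
Proof. exact: integrable_fine (integrable_fubini_F fi). Qed.

Lemma integrable_Rfubini2 :
  m2.-integrable setT (EFin \o (fun y => \int[m1]_x f (x, y))).
Proof. exact: integrable_fine integrable_fubini_G. Qed.

Lemma Rfubini1 : \int[(m1 \x m2)%E]_z f z = \int[m1]_x \int[m2]_y f (x, y).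
Proof.
rewrite /Rintegral -integral12_prod_meas1//; congr fine.
have iF := integrable_fubini_F fi.
apply: ae_eq_integral => //; first exact: measurable_int iF.
  by have /measurable_int := integrable_Rfubini1.
have := integrable_ae measurableT iF.
by apply: filterS => x + _ /= => /(_ I) fin; rewrite fineK.
Qed.

Lemma Rfubini2 : \int[(m1 \x m2)%E]_z f z = \int[m2]_y \int[m1]_x f (x, y).
Proof.
rewrite /Rintegral -integral21_prod_meas1//; congr fine.
have iF := integrable_fubini_G.
apply: ae_eq_integral => //; first exact: measurable_int iF.
  by have /measurable_int := integrable_Rfubini2.
have := integrable_ae measurableT iF.
by apply: filterS => x + _ /= => /(_ I) fin; rewrite fineK.
Qed.

End real_fubini.

(** * Increments along almost every vertical line *)

Section weak_derivative_rectangle.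
Context {R : realType}.
Notation mu := (@lebesgue_measure R).
Notation mu2 := (@lebesgue2 R).
Notation T2 := (measurableTypeR R * measurableTypeR R)%type.
Implicit Types (f k : R * R -> R) (p q s t x y : R).

Lemma Rintegral_slice f (eta : R -> R) (M : R) : mu2.-integrable setT (EFin \o f) ->
  measurable_fun setT eta -> (forall y, `|eta y| <= M) ->
  \int[mu2]_z (f z * eta z.2) = \int[mu]_y ((\int[mu]_x f (x, y)) * eta y).
Proof.
move=> fi meta etaM.
have fei : mu2.-integrable setT (EFin \o (fun z => f z * eta z.2)).
  apply: integrable_boundedM => //.
  by apply: (measurableT_comp meta); exact: measurable_snd.
rewrite (Rfubini2 fei); apply: ae_eq_Rintegral => //.
- by have /measurable_int/measurable_EFinP := integrable_Rfubini2 fei.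
- apply: measurable_funM => //.
  by have /measurable_int/measurable_EFinP := integrable_Rfubini2 fi.
- have := ae_integrable2 fi; apply: filterS => y fyi _.
  exact: (@RintegralZr _ (measurableTypeR R) _ mu setT (fun x => f (x, y)) (eta y) measurableT fyi).
Qed.

(** Integrating a strip in x1 leaves a function of the height alone, to which the one-variable
    result applies. *)
Definition strip p q f (z : R * R) : R := f z * \1_(`]p, q[%classic) z.1.

Lemma integrable_strip p q f : mu2.-integrable setT (EFin \o f) ->
  mu2.-integrable setT (EFin \o strip p q f).
Proof.
move=> fi; apply: (@integrable_boundedM _ _ _ _ _ _ _ 1) => //.
- by apply: measurableT_comp; [exact: measurable_indic|exact: measurable_fst].
- by move=> z _; rewrite indicE; case: (_ \in _); rewrite ?normr1 ?normr0.
Qed.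

Variables (f k : R * R -> R) (a b c e : R).
Hypotheses (fi : mu2.-integrable setT (EFin \o f)) (ki : mu2.-integrable setT (EFin \o k)).
Hypothesis weak : forall (psi eta : R -> R) (p q s t : R),
  smooth1 psi -> smooth1 eta -> a < p -> q < b -> c < s -> t < e ->
  (forall x, ~~ (p < x < q) -> psi x = 0) -> (forall y, ~~ (s < y < t) -> eta y = 0) ->
  \int[mu2]_z (f z * tensor psi (derive1 eta) z) = - \int[mu2]_z (k z * tensor psi eta z).

(** Only the horizontal factor is sharpened to an indicator; the vertical factor stays smooth, since
    it still has to be differentiated. *)
Lemma cutoff_tensor_cvg (h : R * R -> R) (eta : R -> R) (M : R) p q :
  mu2.-integrable setT (EFin \o h) -> continuous eta -> (forall y, `|eta y| <= M) ->
  \int[mu2]_z (h z * tensor (cutoff p q j.+1%:R^-1) eta z) @[j --> \oo] -->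
  \int[mu2]_z (strip p q h z * eta z.2).
Proof.
move=> hi ceta etaM.
have mh : measurable_fun setT h by move: hi => /measurable_int/measurable_EFinP.
apply: (@Rintegral_dominated_cvg _ T2 _ mu2 setT _ _ (fun z => M * `|h z|)) => //.
- move=> j; apply: measurable_funM => //; apply: measurable_funM.
    apply: measurableT_comp; last exact: measurable_fst.
    by apply: measurable_continuousR; apply: smooth1_continuous; exact: smooth1_cutoff.
  by apply: measurableT_comp; [exact: measurable_continuousR|exact: measurable_snd].
- move=> z _; rewrite /strip /tensor -mulrA; apply: cvgM; first exact: cvg_cst.
  apply: cvgM; last exact: cvg_cst.
  by apply: cutoff_cvg => //; exact: cvg_harmonic.
- by apply: integrableR_Z => //; exact: integrableR_norm.
- move=> j z _; rewrite normrM mulrC ler_wpM2r// /tensor normrM -[M]mul1r ler_pM//.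
  by rewrite ger0_norm ?cutoff_ge0 ?cutoff_le1.
Qed.

(** The strip integrals of [k] are the weak derivative in the height of those of [f], tested with
    cut-offs, which is the form that [ac_of_weak] requires. *)
Lemma weak_strip p q s t d : a < p -> q < b -> c < s -> t < e -> 0 < d ->
  \int[mu]_y ((\int[mu]_x strip p q f (x, y)) * derive1 (cutoff s t d) y) =
  - \int[mu]_y ((\int[mu]_x strip p q k (x, y)) * cutoff s t d y).
Proof.
move=> ap qb cs te d0.
have [M M0 HM] := @derive_cutoff_bounded R.
have HM' y : `|derive1 (cutoff s t d) y| <= M / d by exact: HM.
have H1 y : `|cutoff s t d y| <= 1 by rewrite ger0_norm ?cutoff_ge0 ?cutoff_le1.
have cc : continuous (cutoff s t d) by apply: smooth1_continuous; exact: smooth1_cutoff.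
have cd := @continuous_derive_cutoff R s t d.
rewrite -(Rintegral_slice (integrable_strip p q fi) _ HM'); last exact: measurable_continuousR.
rewrite -(Rintegral_slice (integrable_strip p q ki) _ H1); last exact: measurable_continuousR.
have h1 := cutoff_tensor_cvg (p := p) (q := q) fi cd HM'.
have h2 := cutoff_tensor_cvg (p := p) (q := q) ki cc H1.
apply: (cvg_unique (@norm_hausdorff R _) h1).
rewrite (_ : (fun j : nat => _) =
  (fun j : nat => - \int[mu2]_z (k z * tensor (cutoff p q j.+1%:R^-1) (cutoff s t d) z))).
  exact: cvgN.
apply/funext => j; apply: (weak (p := p) (q := q) (s := s) (t := t)) => //.
- exact: smooth1_cutoff.
- exact: smooth1_cutoff.
- by move=> x; exact: cutoff_out.
- by move=> y; exact: cutoff_out.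
Qed.

(** A height is good when it is a Lebesgue point for all rational strips at once; countability keeps
    the exceptional heights negligible. *)
Definition good_height y := mu.-integrable setT (EFin \o (fun x => f (x, y))) /\
  forall p q : rat, lebesgue_pt (fun y => \int[mu]_x strip (ratr p) (ratr q) f (x, y)) y.

Lemma ae_good_height : {ae mu, forall y, good_height y}.
Proof.
rewrite /good_height; apply: filterI; first exact: ae_integrable2 fi.
pose P n y := if (unpickle n : option (rat * rat)) is Some pq then
  lebesgue_pt (fun y => \int[mu]_x strip (ratr pq.1) (ratr pq.2) f (x, y)) y else True.
have : {ae mu, forall y n, P n y}.
  apply: ae_foralln => n; rewrite /P; case: (unpickle n) => [[p q]|]; last exact: aeW.
  apply: lebesgue_differentiation; apply: open_integrable_locally; first exact: openT.
  exact: integrable_Rfubini2 (integrable_strip _ _ fi).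
apply: filterS => y Py p q; have := Py (pickle (p, q)).
by rewrite /P pickleK.
Qed.

(** Let [G] be the defect in the asserted identity. By [ac_of_weak] and Fubini its integral over
    every rational interval in []a, b[] vanishes, so [G] is zero almost everywhere by
    [ae_eq0_of_rat_itv]. The exceptional set of [x] depends on [s] and [t]. *)
Lemma good_height_ac s t : good_height s -> good_height t -> c < s -> s < t -> t < e ->
  {ae mu, forall x, a < x < b ->
     f (x, t) - f (x, s) = \int[mu]_(y in `]s, t[) k (x, y)}.
Proof.
move=> [fs ms] [ft mt] cs st te.
have mst : measurable_fun setT (\1_(`]s, t[%classic) : R -> R) by exact: measurable_indic.
have st1 y : `|\1_(`]s, t[%classic) y : R| <= 1.
  by rewrite indicE; case: (_ \in _); rewrite ?normr1 ?normr0.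
have kst : mu2.-integrable setT (EFin \o (fun z => k z * \1_(`]s, t[%classic) z.2)).
  apply: (@integrable_boundedM _ T2 _ _ _ _ _ 1) => //.
  by apply: measurableT_comp => //; exact: measurable_snd.
have Ki := integrable_Rfubini1 kst.
pose G x := f (x, t) - f (x, s) - \int[mu]_y (k (x, y) * \1_(`]s, t[%classic) y).
have Gi : mu.-integrable setT (EFin \o G).
  by apply: integrableR_B => //; exact: integrableR_B.
have : {ae mu, forall x, a < x < b -> G x = 0}.
  apply: ae_eq0_of_rat_itv => // p q ap pq qb.
  rewrite Rintegral_indicr.
  have mpq : measurable_fun setT (\1_(`](ratr p : R), ratr q[%classic) : R -> R).
    exact: measurable_indic.
  have pq1 x : `|\1_(`](ratr p : R), ratr q[%classic) x : R| <= 1.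
    by rewrite indicE; case: (_ \in _); rewrite ?normr1 ?normr0.
  have bM h : mu.-integrable setT (EFin \o h) ->
      mu.-integrable setT (EFin \o (fun x => h x * \1_(`](ratr p : R), ratr q[%classic) x)).
    by move=> hi; apply: (@integrable_boundedM _ (measurableTypeR R) _ _ _ _ _ 1).
  rewrite (_ : (fun x => _) = (fun x =>
    strip (ratr p) (ratr q) f (x, t) - strip (ratr p) (ratr q) f (x, s) -
    (\int[mu]_y (k (x, y) * \1_(`]s, t[%classic) y)) * \1_(`]ratr p, ratr q[%classic) x)); last first.
    by apply/funext => x; rewrite /G /strip !mulrBl.
  rewrite (@RintegralB _ (measurableTypeR R) _ mu)//; last 2 first.
  - by apply: integrableR_B => //; exact: bM.
  - exact: bM.
  rewrite (@RintegralB _ (measurableTypeR R) _ mu)//; [|exact: bM|exact: bM].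
  have := ac_of_weak (integrable_Rfubini2 (integrable_strip (ratr p) (ratr q) fi))
    (integrable_Rfubini2 (integrable_strip (ratr p) (ratr q) ki)) st (ms p q) (mt p q).
  move=> -> => [|d d0]; last exact: weak_strip.
  apply/eqP; rewrite subr_eq0; apply/eqP.
  rewrite Rintegral_indicr.
  rewrite -(Rintegral_slice (integrable_strip (ratr p) (ratr q) ki) mst st1).
  have kk : mu2.-integrable setT (EFin \o
      (fun z => strip (ratr p) (ratr q) k z * \1_(`]s, t[%classic) z.2)).
    apply: (@integrable_boundedM _ T2 _ _ _ _ _ 1) => //; last exact: integrable_strip.
    by apply: measurableT_comp => //; exact: measurable_snd.
  rewrite (Rfubini1 kk).
  have ki1 := ae_integrable1 kst.
  apply: (@ae_eq_Rintegral _ (measurableTypeR R)) => //.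
  - by have /measurable_int/measurable_EFinP := integrable_Rfubini1 kk.
  - by have /measurable_int/measurable_EFinP := bM _ Ki.
  - move: ki1; apply: filterS => x kx _.
    rewrite -(@RintegralZr _ (measurableTypeR R) _ mu setT _ _ measurableT kx).
    by apply: eq_Rintegral => y _; rewrite /strip /= mulrAC.
apply: filterS => x + abx => /(_ abx)/eqP; rewrite /G subr_eq0 => /eqP ->.
by rewrite [RHS]Rintegral_indicr.
Qed.

End weak_derivative_rectangle.

(** * Tonelli on a product of measurable sets *)

Section rectangle_tonelli.
Context d1 d2 (T1 : measurableType d1) (T2 : measurableType d2) (R : realType).
Variables (m1 : {sigma_finite_measure set T1 -> \bar R})
          (m2 : {sigma_finite_measure set T2 -> \bar R}).
Local Open Scope ereal_scope.
Variables (g : T1 * T2 -> \bar R) (A : set T1) (B : set T2).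
Hypotheses (mg : measurable_fun (A `*` B) g) (g0 : forall z, 0 <= g z).
Hypotheses (mA : measurable A) (mB : measurable B).

Let h := g \_ (A `*` B).

Let mh : measurable_fun setT h.
Proof. by apply/(measurable_restrictT _ _).1 => //; exact: measurableX. Qed.

Let h0 z : 0 <= h z.
Proof. by rewrite /h patchE; case: ifP. Qed.

Lemma ge0_integral_rect1 :
  \int[m1 \x m2]_(z in A `*` B) g z = \int[m1]_(x in A) \int[m2]_(y in B) g (x, y).
Proof.
rewrite integral_mkcond (fubini_tonelli1 _ mh h0) [RHS]integral_mkcond.
apply: eq_integral => x _; rewrite /fubini_F patchE; case: ifPn => xA.
  rewrite [RHS]integral_mkcond; apply: eq_integral => y _.
  by rewrite /h !patchE in_setX xA.
by rewrite integral0_eq// => y _; rewrite /h patchE in_setX (negbTE xA).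
Qed.

Lemma ge0_integral_rect2 :
  \int[m1 \x m2]_(z in A `*` B) g z = \int[m2]_(y in B) \int[m1]_(x in A) g (x, y).
Proof.
rewrite integral_mkcond (fubini_tonelli2 _ mh h0) [RHS]integral_mkcond.
apply: eq_integral => y _; rewrite /fubini_G patchE; case: ifPn => yB.
  rewrite [RHS]integral_mkcond; apply: eq_integral => x _.
  by rewrite /h !patchE in_setX yB andbT.
by rewrite integral0_eq// => x _; rewrite /h patchE in_setX (negbTE yB) andbF.
Qed.

Lemma measurable_integral_rect1 : measurable_fun A (fun x => \int[m2]_(y in B) g (x, y)).
Proof.
apply: (eq_measurable_fun (fubini_F m2 h)).
  move=> x xA; rewrite /fubini_F [RHS]integral_mkcond; apply: eq_integral => y _.
  by rewrite /h !patchE in_setX xA.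
exact/measurable_funTS/measurable_fun_fubini_tonelli_F.
Qed.

Lemma measurable_integral_rect2 : measurable_fun B (fun y => \int[m1]_(x in A) g (x, y)).
Proof.
apply: (eq_measurable_fun (fubini_G m1 h)).
  move=> y yB; rewrite /fubini_G [RHS]integral_mkcond; apply: eq_integral => x _.
  by rewrite /h !patchE in_setX yB andbT.
exact/measurable_funTS/measurable_fun_fubini_tonelli_G.
Qed.

End rectangle_tonelli.

(** * Boundary values on a rectangle *)

Section rectangle_trace.
Context {R : realType}.
Notation mu := (@lebesgue_measure R).
Notation mu2 := (@lebesgue2 R).
Notation T1 := (measurableTypeR R).
Notation T2 := (T1 * T1)%type.
Variables (f k : R * R -> R) (a b c e : R).
Hypotheses (fi : mu2.-integrable setT (EFin \o f)) (ki : mu2.-integrable setT (EFin \o k)).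
Hypothesis ce : c < e.
Hypothesis weak : forall (psi eta : R -> R) (p q s t : R),
  smooth1 psi -> smooth1 eta -> a < p -> q < b -> c < s -> t < e ->
  (forall x, ~~ (p < x < q) -> psi x = 0) -> (forall y, ~~ (s < y < t) -> eta y = 0) ->
  \int[mu2]_z (f z * tensor psi (derive1 eta) z) = - \int[mu2]_z (k z * tensor psi eta z).

Let K x y := \int[mu]_(s in `]c, y[) k (x, s).

Let ae_ki : {ae mu, forall x, mu.-integrable setT (EFin \o (fun y => k (x, y)))}.
Proof. exact: ae_integrable1 ki. Qed.

Let KB x s t : mu.-integrable setT (EFin \o (fun y => k (x, y))) -> c < s -> s <= t ->
  K x t = K x s + \int[mu]_(y in `]s, t[) k (x, y).
Proof.
move=> kx cs st; rewrite /K.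
have kD (D : set T1) : measurable D -> mu.-integrable D (EFin \o (fun y => k (x, y))).
  by move=> mD; exact: integrableS kx.
rewrite (@Rintegral_itv_obnd_cbnd _ s); last exact: kD.
rewrite (_ : `]c, t[%classic = `]c, s[%classic `|` `[s, t[%classic); last first.
  by rewrite -itv_bndbnd_setU// ?bnd_simp//.
rewrite (@Rintegral_setU _ T1) //.
  by apply: kD; apply: measurableU; exact: measurable_itv.
apply/disj_setPS => y [] /=; rewrite !in_itv/= => /andP[_ ys] /andP[sy _].
by have := lt_le_trans ys sy; rewrite ltxx.
Qed.

Let KI y : mu.-integrable setT (EFin \o (K^~ y)).
Proof.
have kst : mu2.-integrable setT (EFin \o (fun z => k z * \1_(`]c, y[%classic) z.2)).
  apply: (@integrable_boundedM _ T2 _ _ _ _ _ 1) => //.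
    by apply: measurableT_comp; [exact: measurable_indic|exact: measurable_snd].
  by move=> z _; rewrite indicE; case: (_ \in _); rewrite ?normr1 ?normr0.
have := integrable_Rfubini1 kst; congr (_.-integrable _ _).
by apply/funext => x /=; rewrite /K Rintegral_indicr.
Qed.


(** One good height [y0] is fixed as a reference; it exists because good heights have full measure
    and []c, e[] has positive measure. [V] is the value at [y0] transported down to the side at
    height [c], so it is the lower boundary value, and [V x + K x e] the upper one. *)
Lemma rectangle_ac : exists2 V : R -> R, mu.-integrable setT (EFin \o V) &
  {ae mu, forall y, c < y < e -> {ae mu, forall x, a < x < b -> f (x, y) = V x + K x y}}.
Proof.
have gh := ae_good_height fi.
have [y0 [gy0 /andP[cy0 y0e]]] : exists y0, good_height f y0 /\ c < y0 < e.
  apply/not_existsP => H.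
  have : mu.-negligible `]c, e[%classic.
    apply: negligibleS gh => y /=; rewrite in_itv/= => cye gy; exact: (H y).
  move=> N; have : mu `]c, e[%classic = 0%E by exact: (negligibleP mu (measurable_itv _)).1 N.
  rewrite lebesgue_measure_itv/= lte_fin ce => /eqP.
  by rewrite -EFinB eqe subr_eq0 gt_eqF.
exists (fun x => f (x, y0) - K x y0); first by apply: integrableR_B => //; case: gy0.
apply: filterS gh => y gy /andP[cy ye].
have [yy0|yy0|->] := ltgtP y y0; last by apply: aeW => x _; rewrite subrK.
- have := good_height_ac fi ki weak gy gy0 cy yy0 y0e.
  apply: filterS2 ae_ki => x kx + axb => /(_ axb) h.
  by rewrite (KB kx cy (ltW yy0)) -h; lra.
- have := good_height_ac fi ki weak gy0 gy cy0 yy0 ye.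
  apply: filterS2 ae_ki => x kx + axb => /(_ axb) h.
  by rewrite (KB kx cy0 (ltW yy0)) -h; lra.
Qed.

(** The pointwise bound does not depend on the height, so integrating it over [J] contributes the
    factor [mu J]. A general base [A] is kept because the estimate is later localised to short
    intervals around a Lebesgue point. *)
Lemma rectangle_trace_estimate (W : R -> R) (A J : set R) :
  mu.-integrable setT (EFin \o W) -> measurable A -> measurable J ->
  A `<=` `]a, b[ -> J `<=` `]c, e[ ->
  {ae mu, forall y, J y -> {ae mu, forall x, A x ->
     (`|(f (x, y) - W x)%:E| <= \int[mu]_(s in J) `|(k (x, s))%:E|)%E}} ->
  (\int[mu2]_(z in A `*` J) `|(f z - W z.1)%:E| <=
   mu J * \int[mu2]_(z in A `*` J) `|(k z)%:E|)%E.
Proof.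
move=> Wi mA mJ Aab Jce H.
have mf : measurable_fun setT f by move: fi => /measurable_int/measurable_EFinP.
have mk : measurable_fun setT k by move: ki => /measurable_int/measurable_EFinP.
have mW : measurable_fun setT W by move: Wi => /measurable_int/measurable_EFinP.
have mfW : measurable_fun setT (fun z : T2 => `|(f z - W z.1)%:E|%E).
  apply: measurableT_comp => //; apply/measurable_EFinP; apply: measurable_funB => //.
  by apply: measurableT_comp => //; exact: measurable_fst.
have mabsk : measurable_fun setT (fun z : T2 => `|(k z)%:E|%E).
  by apply: measurableT_comp => //; apply/measurable_EFinP.
rewrite ge0_integral_rect2//; last exact: measurable_funTS.
set I := (\int[mu2]_(z in A `*` J) `|(k z)%:E|)%E.
have I0 : (0 <= I)%E by apply: integral_ge0.
rewrite muleC -(@integral_cst _ T1)//.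
apply: (@ae_ge0_le_integral _ T1) => //.
- by move=> y _; exact: integral_ge0.
- apply: (@measurable_integral_rect2 _ _ T1 T1 _ _ (fun z => `|(f z - W z.1)%:E|%E)) => //.
  exact: measurable_funTS.
- apply: filterS H => y Hy Jy.
  apply: (@le_trans _ _ (\int[mu]_(x in A) \int[mu]_(s in J) `|(k (x, s))%:E|)%E); last first.
    by rewrite /I ge0_integral_rect1//; exact: measurable_funTS.
  apply: (@ae_ge0_le_integral _ T1) => //.
  + apply/measurable_funTS/measurableT_comp => //.
    apply/measurable_EFinP; apply: measurable_funB => //.
    by apply: measurableT_comp => //; exact: pair2_measurable.
  + by move=> x _; exact: integral_ge0.
  + apply: (@measurable_integral_rect1 _ _ T1 T1 _ _ (fun z => `|(k z)%:E|%E)) => //.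
    exact: measurable_funTS.
  + exact: Hy.
Qed.

Let normr_Rintegral_le (h : R -> R) (D J : set R) :
  mu.-integrable setT (EFin \o h) -> measurable D -> measurable J -> D `<=` J ->
  (`|(\int[mu]_(s in D) h s)%:E| <= \int[mu]_(s in J) `|(h s)%:E|)%E.
Proof.
move=> hi mD mJ DJ.
have mh := measurable_int _ hi.
rewrite abse_EFin (@EFin_normr_Rintegral _ T1)//; last exact: integrableS hi.
apply: (@le_trans _ _ (\int[mu]_(s in D) `|(h s)%:E|)%E).
  by apply: le_abse_integral => //; exact: measurable_funTS.
apply: (@ge0_subset_integral _ T1) => //.
by apply/measurable_funTS/measurableT_comp.
Qed.

Lemma rectangle_trace_top : exists2 W : R -> R, mu.-integrable setT (EFin \o W) &
  forall (A : set R) (d : R), measurable A -> A `<=` `]a, b[ -> 0 < d <= e - c ->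
  (\int[mu2]_(z in A `*` `](e - d)%R, e[) `|(f z - W z.1)%:E| <=
   d%:E * \int[mu2]_(z in A `*` `](e - d)%R, e[) `|(k z)%:E|)%E.
Proof.
have [V Vi HV] := rectangle_ac.
exists (fun x => V x + K x e); first exact: integrableR_D.
move=> A d mA Aab /andP[d0 de].
have muJ : mu `]e - d, e[ = d%:E.
  by rewrite lebesgue_measure_itv/= lte_fin ltrBlDr ltrDl d0 -EFinB subKr.
have Jce : `]e - d, e[ `<=` `]c, e[.
  by move=> y; rewrite /= !in_itv/= => /andP[y1 y2]; apply/andP; split => //; lra.
rewrite -muJ; apply: (@rectangle_trace_estimate (fun x => V x + K x e)) => //; first exact: integrableR_D.
apply: filterS HV => y Hy Jy; have cye := Jce _ Jy.
move: cye Jy; rewrite /= !in_itv/= => cye /andP[y1 y2].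
have /andP[cy ye] := cye.
have := Hy cye; apply: filterS2 ae_ki => x kx + Ax.
have := Aab _ Ax; rewrite /= in_itv/= => axb /(_ axb) ->.
have -> : V x + K x y - (V x + K x e) = - \int[mu]_(s in `]y, e[) k (x, s).
  by rewrite (KB kx cy (ltW ye)); lra.
rewrite normrN.
apply: normr_Rintegral_le => //.
by move=> s; rewrite /= !in_itv/= => /andP[s1 s2]; apply/andP; split => //; lra.
Qed.

Lemma rectangle_trace_bottom : exists2 W : R -> R, mu.-integrable setT (EFin \o W) &
  forall (A : set R) (d : R), measurable A -> A `<=` `]a, b[ -> 0 < d <= e - c ->
  (\int[mu2]_(z in A `*` `]c, (c + d)%R[) `|(f z - W z.1)%:E| <=
   d%:E * \int[mu2]_(z in A `*` `]c, (c + d)%R[) `|(k z)%:E|)%E.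
Proof.
have [V Vi HV] := rectangle_ac; exists V => //.
move=> A d mA Aab /andP[d0 de].
have muJ : mu `]c, c + d[ = d%:E.
  by rewrite lebesgue_measure_itv/= lte_fin ltrDl d0 -EFinB addrAC subrr add0r.
have Jce : `]c, c + d[ `<=` `]c, e[.
  by move=> y; rewrite /= !in_itv/= => /andP[y1 y2]; apply/andP; split => //; lra.
rewrite -muJ; apply: (@rectangle_trace_estimate V) => //.
apply: filterS HV => y Hy Jy; have cye := Jce _ Jy.
move: cye Jy; rewrite /= !in_itv/= => cye /andP[y1 y2].
have := Hy cye; apply: filterS2 ae_ki => x kx + Ax.
have := Aab _ Ax; rewrite /= in_itv/= => axb /(_ axb) ->.
rewrite addrAC subrr add0r; apply: normr_Rintegral_le => //.
by move=> s; rewrite /= !in_itv/= => /andP[s1 s2]; apply/andP; split => //; lra.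
Qed.

End rectangle_trace.

(** * Cauchy-Schwarz against a constant *)

Section cauchy_schwarz.
Context d (T : measurableType d) (R : realType) (mu : {measure set T -> \bar R}).
Variables (A : set T) (g : T -> R).
Hypotheses (mA : measurable A) (Afin : (mu A < +oo)%E) (mg : measurable_fun A g).
Hypothesis g2 : (\int[mu]_(x in A) ((g x) ^+ 2)%:E < +oo)%E.

Lemma integrable_sqr : mu.-integrable A (EFin \o (fun x => g x ^+ 2)).
Proof.
apply/integrableP; split.
  by apply/measurable_EFinP; exact: measurable_funX.
by under eq_integral => x _ do rewrite /= ger0_norm ?sqr_ge0//.
Qed.

Lemma integrable_of_sqr : mu.-integrable A (EFin \o g).
Proof.
apply: (@le_integrableR _ _ _ _ _ _ (fun x => 1 + g x ^+ 2)) => // [x Ax|].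
  have [gx1|/ltW gx1] := leP `|g x| 1.
    by apply: le_trans gx1 _; rewrite lerDl sqr_ge0.
  rewrite -[leLHS]add0r lerD// -real_normK ?num_real// expr2.
  by rewrite -[leLHS]mul1r ler_wpM2r.
by apply: integrableR_D => //; [exact: integrable_cst|exact: integrable_sqr].
Qed.

(** The integral of [(|g| - t)^2] is a nonnegative quadratic in [t]; its minimiser [t = I / m] gives
    the inequality. *)
Lemma Rintegral_norm_le_sqrt : \int[mu]_(x in A) `|g x| <=
  Num.sqrt (fine (mu A)) * Num.sqrt (\int[mu]_(x in A) g x ^+ 2).
Proof.
set I := \int[mu]_(x in A) _; set S := \int[mu]_(x in A) _; set m := fine (mu A).
have I0 : 0 <= I by exact: Rintegral_ge0.
have S0 : 0 <= S by apply: Rintegral_ge0 => x _; exact: sqr_ge0.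
have m0 : 0 <= m by exact: fine_ge0.
have gi := integrableR_norm mA integrable_of_sqr.
have quad t : 0 <= S - 2 * t * I + t ^+ 2 * m.
  have -> : S - 2 * t * I + t ^+ 2 * m =
      \int[mu]_(x in A) (g x ^+ 2 - 2 * t * `|g x| + t ^+ 2).
    rewrite RintegralD//; last 2 first.
    - by apply: integrableR_B => //; [exact: integrable_sqr|exact: integrableR_Z].
    - exact: integrable_cst.
    rewrite RintegralB//; [|exact: integrable_sqr|exact: integrableR_Z].
    by rewrite RintegralZl// Rintegral_cst.
  apply: Rintegral_ge0 => x _.
  rewrite -(real_normK (num_real (g x))).
  have -> : `|g x| ^+ 2 - 2 * t * `|g x| + t ^+ 2 = (`|g x| - t) ^+ 2 by lra.
  exact: sqr_ge0.
rewrite -sqrtrM// -[leLHS]ger0_norm// -sqrtr_sqr ler_wsqrtr//.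
have [m00|mN0] := eqVneq m 0.
  have [->|IN0] := eqVneq I 0; first by rewrite expr0n/= mulr_ge0.
  (* When [m] is 0 the quadratic is affine in [t], and this value of [t] makes it -1, which is
     absurd. *)
  have := quad ((S + 1) / (2 * I)).
  have -> : 2 * ((S + 1) / (2 * I)) * I = S + 1.
    rewrite mulrAC mulrCA divff ?mulr1// mulf_neq0//.
  by rewrite m00; lra.
have := quad (I / m).
have -> : 2 * (I / m) * I = 2 * (I ^+ 2 / m) by lra.
have -> : (I / m) ^+ 2 * m = I ^+ 2 / m by rewrite expr2 -mulrA divfK// mulrAC.
move=> h; have : I ^+ 2 / m <= S by lra.
by rewrite ler_pdivrMr ?lt_def ?mN0// mulrC.
Qed.

End cauchy_schwarz.

(** * Sobolev functions near a side of a rectangle contained in the domain *)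

Section sobolev_rectangle.
Context {R : realType}.
Notation mu := (@lebesgue_measure R).
Notation mu2 := (@lebesgue2 R).
Notation T1 := (measurableTypeR R).
Notation T2 := (T1 * T1)%type.
Implicit Types (D : set (R * R)) (u : R * R -> R).

Lemma weak_derivP D u v : (exists2 h, L2 D h & is_weak_deriv D v u h) ->
  L2 D (weak_deriv D v u) /\ is_weak_deriv D v u (weak_deriv D v u).
Proof.
by case=> h Lh wh; apply: (@xgetPex _ (fun=> 0)
  [set h | L2 D h /\ is_weak_deriv D v u h]); exists h.
Qed.

Lemma L2_subset D E u : measurable D -> measurable E -> E `<=` D -> L2 D u -> L2 E u.
Proof.
move=> mD mE ED [mu_ fu]; split; first exact: measurable_funS mu_.
apply: le_lt_trans fu; apply: (@ge0_subset_integral _ T2) => //.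
- by apply/measurable_EFinP; exact: measurable_funX.
- by move=> x _; rewrite lee_fin sqr_ge0.
Qed.

Lemma lebesgue2_rect (A B : set R) : measurable A -> measurable B ->
  mu2 (A `*` B) = (mu A * mu B)%E.
Proof. by move=> mA mB; exact: product_measure1E. Qed.

Lemma measurable_rect (A B : set R) : measurable A -> measurable B ->
  measurable (A `*` B : set (R * R)).
Proof. by move=> mA mB; exact: measurableX. Qed.

Variables (D : set (R * R)) (a b c e : R).
Hypotheses (mD : measurable D) (QD : `]a, b[ `*` `]c, e[ `<=` D) (ce : c < e).
Let Q := `]a, b[%classic `*` `]c, e[%classic.

Let mQ : measurable (Q : set (R * R)).
Proof. by apply: measurable_rect; exact: measurable_itv. Qed.

Let Qfin : (mu2 Q < +oo)%E.
Proof.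
by rewrite lebesgue2_rect// lte_mul_pinfty// ?ge0_fin_numE//;
  exact: lebesgue_measure_bnd_lty.
Qed.

Let L2_restrict_integrable u : L2 D u -> mu2.-integrable setT (EFin \o (u \_ Q)).
Proof.
move=> /(L2_subset mD mQ QD)[mu_ fu].
have := @integrable_of_sqr _ T2 _ mu2 _ _ mQ Qfin mu_ fu.
by move=> /(@integrable_mkcond _ T2 _ mu2 _ _ mQ); rewrite restrict_EFin.
Qed.

(** A tensor supported in the rectangle is a test function for the whole domain, and extending [u]
    and [h] by zero off the rectangle alters neither integral. *)
Let weak_rect u h : is_weak_deriv D e2 u h ->
  forall (psi eta : R -> R) (p q s t : R),
  smooth1 psi -> smooth1 eta -> a < p -> q < b -> c < s -> t < e ->
  (forall x, ~~ (p < x < q) -> psi x = 0) -> (forall y, ~~ (s < y < t) -> eta y = 0) ->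
  \int[mu2]_z ((u \_ Q) z * tensor psi (derive1 eta) z) =
  - \int[mu2]_z ((h \_ Q) z * tensor psi eta z).
Proof.
move=> uh psi eta p q s t Spsi Seta ap qb cs te psi0 eta0.
have tf : test_function D (tensor psi eta).
  apply: (test_function_tensor Spsi Seta _ psi0 eta0) => z [/=].
  rewrite !in_itv/= => /andP[p1 q1] /andP[s1 t1]; apply: QD; split => /=.
    by rewrite in_itv/= (lt_le_trans ap p1) (le_lt_trans q1 qb).
  by rewrite in_itv/= (lt_le_trans cs s1) (le_lt_trans t1 te).
(* Because of the strict margins [c < s] and [t < e], [eta] vanishes in a whole neighbourhood of
   such a point. *)
have deta0 y : ~~ (c < y < e) -> derive1 eta y = 0.
  move=> ycd; rewrite derive1E.
  have -> : 'D_1 eta y = 'D_1 (cst (0 : R)) y; last exact: derive_cst.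
  apply: near_eq_derive.
  move: ycd; rewrite negb_and -!leNgt => /orP[yc|ey].
    near=> z; rewrite eta0// negb_and -!leNgt; apply/orP; left.
    by apply/ltW; near: z; apply: lt_nbhsl; exact: le_lt_trans cs.
  near=> z; rewrite eta0// negb_and -!leNgt; apply/orP; right.
  by apply/ltW; near: z; apply: lt_nbhsr; exact: lt_le_trans ey.
have eta0' y : ~~ (c < y < e) -> eta y = 0.
  move=> ycd; apply: eta0; apply: contra ycd => /andP[sy yt].
  by rewrite (lt_trans cs sy) (lt_trans yt te).
have psi0' x : ~~ (a < x < b) -> psi x = 0.
  move=> xab; apply: psi0; apply: contra xab => /andP[px xq].
  by rewrite (lt_trans ap px) (lt_trans xq qb).
have {uh} := uh _ tf.
have -> : (fun x => u x * 'D_e2 (tensor psi eta) x) = (fun x => u x * tensor psi (derive1 eta) x).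
  by apply/funext => z; rewrite -(derive_tensor_e2 _ Seta).
have aux (w : R * R -> R) (f g : R -> R) :
    (forall x, ~~ (a < x < b) -> f x = 0) -> (forall y, ~~ (c < y < e) -> g y = 0) ->
    \int[mu2]_(z in D) (w z * tensor f g z) = \int[mu2]_z ((w \_ Q) z * tensor f g z).
  move=> f0 g0; rewrite Rintegral_mkcond; congr Rintegral; apply/funext => z.
  rewrite !patchE /tensor.
  have [zQ|zQ] := boolP (z \in Q).
    by rewrite mem_set//; apply: QD; exact/set_mem.
  have -> : f z.1 * g z.2 = 0.
    have [z1|z1] := boolP (a < z.1 < b); last by rewrite f0 ?mul0r.
    have [z2|z2] := boolP (c < z.2 < e); last by rewrite g0 ?mulr0.
    by move/negP : zQ; case; rewrite inE; split; rewrite /= in_itv.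
  by rewrite !mulr0; case: ifP.
by rewrite !aux.
Unshelve. all: by end_near. Qed.

Let rect_integral_restrict u (w : R * R -> R) (A J : set R) :
  measurable A -> measurable J -> A `<=` `]a, b[ -> J `<=` `]c, e[ ->
  (\int[mu2]_(z in A `*` J) `|(((u \_ Q) z - w z)%:E)| =
   \int[mu2]_(z in A `*` J) `|((u z - w z)%:E)|)%E.
Proof.
move=> mA mJ Aab Jce; apply: eq_integral => z; rewrite inE => -[Az Jz].
by rewrite patchE mem_set//; split; [exact: Aab|exact: Jce].
Qed.

Lemma sobolev_trace_top u : sobolev1 D u ->
  exists2 W : R -> R, mu.-integrable setT (EFin \o W) &
  forall (A : set R) (d : R), measurable A -> A `<=` `]a, b[ -> 0 < d <= e - c ->
  (\int[mu2]_(z in A `*` `](e - d)%R, e[) `|(u z - W z.1)%:E| <=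
   d%:E * \int[mu2]_(z in A `*` `](e - d)%R, e[) `|(weak_deriv D e2 u z)%:E|)%E.
Proof.
move=> [Lu _ /weak_derivP[Lh wh]].
have [W Wi HW] := rectangle_trace_top (L2_restrict_integrable Lu)
  (L2_restrict_integrable Lh) ce (weak_rect wh).
exists W => // A d mA Aab de; have := HW A d mA Aab de.
have Jce : `]e - d, e[ `<=` `]c, e[.
  move: de => /andP[d0 de].
  by move=> y; rewrite /= !in_itv/= => /andP[y1 y2]; apply/andP; split => //; lra.
rewrite rect_integral_restrict//.
have := @rect_integral_restrict (weak_deriv D e2 u) (cst 0) _ _ mA (measurable_itv _) Aab Jce.
by under eq_integral do rewrite subr0; under [in RHS]eq_integral do rewrite subr0; move=> ->.
Qed.

Lemma sobolev_trace_bottom u : sobolev1 D u ->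
  exists2 W : R -> R, mu.-integrable setT (EFin \o W) &
  forall (A : set R) (d : R), measurable A -> A `<=` `]a, b[ -> 0 < d <= e - c ->
  (\int[mu2]_(z in A `*` `]c, (c + d)%R[) `|(u z - W z.1)%:E| <=
   d%:E * \int[mu2]_(z in A `*` `]c, (c + d)%R[) `|(weak_deriv D e2 u z)%:E|)%E.
Proof.
move=> [Lu _ /weak_derivP[Lh wh]].
have [W Wi HW] := rectangle_trace_bottom (L2_restrict_integrable Lu)
  (L2_restrict_integrable Lh) ce (weak_rect wh).
exists W => // A d mA Aab de; have := HW A d mA Aab de.
have Jce : `]c, c + d[ `<=` `]c, e[.
  move: de => /andP[d0 de].
  by move=> y; rewrite /= !in_itv/= => /andP[y1 y2]; apply/andP; split => //; lra.
rewrite rect_integral_restrict//.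
have := @rect_integral_restrict (weak_deriv D e2 u) (cst 0) _ _ mA (measurable_itv _) Aab Jce.
by under eq_integral do rewrite subr0; under [in RHS]eq_integral do rewrite subr0; move=> ->.
Qed.

End sobolev_rectangle.

(** * Hausdorff measure on a horizontal line *)

Section hausdorff_line.
Context {R : realType}.
Notation mu := (@lebesgue_measure R).
Notation T1 := (measurableTypeR R).
Variable h : R.
Notation iota := (fun x : R => (x, h)).

Lemma eucl_dist_line (x y : R) : eucl_dist (x, h) (y, h) = `|x - y|.
Proof. by rewrite /eucl_dist/= subrr expr0n/= addr0 sqrtr_sqr. Qed.

Lemma eucl_dist_le_ediam (U : set (R * R)) x y : U x -> U y ->
  ((eucl_dist x y)%:E <= ediam U)%E.
Proof.
move=> Ux Uy; rewrite /ediam le_max; apply/orP; right.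
by apply: ereal_sup_ubound; exists (x, y).
Qed.

Lemma ediam_le (U : set (R * R)) (l : R) : 0 <= l ->
  (forall x y, U x -> U y -> eucl_dist x y <= l) -> (ediam U <= l%:E)%E.
Proof.
move=> l0 Ul; rewrite /ediam ge_max lee_fin l0/=.
by apply: ge_ereal_sup => _ [[x y] [Ux Uy] <-]; rewrite lee_fin; exact: Ul.
Qed.

(** The interval is cut into [n] equal half-open pieces, with [n] so large that their length is at
    most [delta]; their diameters add up to no more than [q - p]. *)
Lemma hausdorff1_delta_line_le (p q delta : R) : p < q -> 0 < delta ->
  (hausdorff1_delta delta (iota @` `]p, q]) <= (q - p)%:E)%E.
Proof.
move=> pq d0.
pose n := (Num.truncn ((q - p) / delta)).+1.
pose l := (q - p) / n%:R.
have n0 : (0 : R) < n%:R by rewrite ltr0n.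
have qp0 : 0 < q - p by rewrite subr_gt0.
have l0 : 0 < l by rewrite divr_gt0.
have ld : l <= delta.
  rewrite ler_pdivrMr// mulrC -ler_pdivrMr// ltW//.
  by rewrite truncnS_gt.
have nl : n%:R * l = q - p by rewrite mulrC divfK// gt_eqF.
pose U k := if (k < n)%N then iota @` `](p + k%:R * l), (p + k.+1%:R * l)] else set0.
have dU k : (ediam (U k) <= (if (k < n)%N then l else 0)%:E)%E.
  rewrite /U; case: ifP => _; last by rewrite ediam0.
  apply: ediam_le; first exact: ltW.
  move=> _ _ [x /=] + <- [y /=] + <-; rewrite !in_itv/= eucl_dist_line -natr1 mulrDl mul1r.
  by move=> /andP[x1 x2] /andP[y1 y2]; rewrite ler_norml; apply/andP; split; lra.
apply: (@le_trans _ _ (\sum_(k <oo) ediam (U k))%E).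
  apply: ereal_inf_lbound; exists U => //; split; last first.
    move=> k; apply: le_trans (dU k) _; rewrite lee_fin.
    by case: ifP => // _; exact: ltW.
  move=> _ [x /=] + <-; rewrite in_itv/= => /andP[px xq].
  have exk : exists k, x <= p + k.+1%:R * l.
    by exists n.-1; rewrite /n/= -/n nl addrC subrK.
  case: (ex_minnP exk) => k xk kmin.
  have kn : (k < n)%N.
    by rewrite /n ltnS; apply: kmin; rewrite -/n nl addrC subrK.
  exists k => //; rewrite /U kn; exists x => //=; rewrite in_itv/= xk andbT.
  case: k {kn xk} kmin => [|k] kmin; first by rewrite mul0r addr0.
  by rewrite ltNge; apply/negP => /kmin; rewrite ltnn.
apply: lime_le; first by apply: is_cvg_nneseries => k _ _; exact: ediam_ge0.
apply: nearW => N.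
apply: (@le_trans _ _ ((minn N n)%:R * l)%:E); last first.
  by rewrite lee_fin -nl ler_pM2r// ler_nat geq_minr.
elim: N => [|N IH]; first by rewrite big_geq// min0n mul0r.
rewrite big_nat_recr//=; apply: le_trans (leeD IH (dU N)) _.
rewrite -EFinD lee_fin; case: ifP => Nn.
  by rewrite (minn_idPl (ltnW Nn)) (minn_idPl Nn) -natr1 mulrDl mul1r.
by rewrite addr0 ler_pM2r// ler_nat leq_min geq_minr andbT (leq_trans (geq_minl _ _)).
Qed.

(** The intersection of a covering set with the line need not be measurable. It is enlarged to the
    closed interval between its infimum and supremum, whose length is still at most the diameter,
    and countable subadditivity of Lebesgue measure concludes. *)
Lemma hausdorff1_delta_line_ge (p q delta : R) : p < q -> 0 < delta ->
  ((q - p)%:E <= hausdorff1_delta delta (iota @` `]p, q]))%E.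
Proof.
move=> pq d0; apply: le_ereal_inf_tmp => _ [U [cU dU] <-].
pose P k := iota @^-1` U k.
pose J k : set R := if `[< P k !=set0 >] then `[inf (P k), sup (P k)]%classic else set0.
have mJ k : measurable (J k) by rewrite /J; case: ifP => // _; exact: measurable_itv.
have Pd k x y : P k x -> P k y -> (`|x - y|%:E <= ediam (U k))%E.
  by move=> Px Py; rewrite -eucl_dist_line; exact: eucl_dist_le_ediam.
have Pd' k x y : P k x -> P k y -> x <= y + delta.
  move=> Px Py; have := le_trans (Pd k x y Px Py) (dU k).
  by rewrite lee_fin; move/(le_trans (ler_norm _)); rewrite lerBlDl.
have ub k x : P k x -> has_ubound (P k).
  by move=> Px; exists (x + delta) => y Py; exact: (Pd' k).
have lb k x : P k x -> has_lbound (P k).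
  by move=> Px; exists (x - delta) => y Py; rewrite lerBlDr; exact: (Pd' k).
have PJ k : P k `<=` J k.
  move=> x Px; rewrite /J asboolT; last by exists x.
  rewrite /= in_itv/=; apply/andP; split.
    by apply: ge_inf => //; exact: lb Px.
  by apply: ub_le_sup => //; exact: ub Px.
have muJ k : (mu (J k) <= ediam (U k))%E.
  rewrite /J; case: asboolP => [[x Px]|_]; last by rewrite measure0 ediam_ge0.
  rewrite lebesgue_measure_itv/= lte_fin; case: ifP => _; last exact: ediam_ge0.
  have Ufin : ediam (U k) \is a fin_num.
    by rewrite ge0_fin_numE ?ediam_ge0//; apply: le_lt_trans (dU k) (ltry _).
  rewrite -(fineK Ufin) -EFinB lee_fin lerBlDr.
  have Pne : P k !=set0 by exists x.
  apply: ge_sup => // y Py; rewrite -lerBlDl; apply: lb_le_inf => // z Pz.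
  rewrite lerBlDr -lerBlDl; apply: le_trans (ler_norm _) _.
  by rewrite -lee_fin fineK//; exact: Pd.
have -> : (q - p)%:E = mu `]p, q].
  by rewrite lebesgue_measure_itv/= lte_fin pq -EFinB.
apply: (@le_trans _ _ (\sum_(k <oo) mu (J k))%E); last first.
  by apply: lee_nneseries => // k _.
apply: measure_sigma_subadditive => //.
move=> x xpq; have [|k _ Ux] := cU (x, h); first by exists x.
by exists k => //; exact: PJ.
Qed.

Lemma measurable_hline : measurable [set z : R * R | z.2 = h].
Proof.
have -> : [set z : R * R | z.2 = h] = setT `&` snd @^-1` [set h].
  by rewrite setTI.
by apply: measurable_snd => //; exact: measurable_set1.
Qed.

Lemma measurable_iota : measurable_fun setT (iota : R -> R * R).
Proof. by apply: measurable_fun_pair => //; exact: measurable_cst. Qed.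

(** Restrict the Hausdorff measure to the line and push it forward by [fst]: the result has the
    right value on every []p, q]], so it is Lebesgue measure by uniqueness. *)
Lemma hausdorff1_line (A : set (R * R)) : measurable A ->
  A `<=` [set z | z.2 = h] -> hausdorff1 A = mu (iota @^-1` A).
Proof.
move=> mA AL.
pose nu0 := mrestr (@hausdorff1 R) measurable_hline.
pose nu : {measure set T1 -> \bar R} :=
  measure_function_pushforward__canonical__measure_function_Measure
    nu0 (measurable_fst : measurable_fun setT (fst : R * R -> T1)).
have nuE X : measurable X -> mu X = nu X.
  apply: lebesgue_measure_unique => _ [[p q] _ <-] /=.
  rewrite lebesgue_measure_itv/= lte_fin /nu /nu0 /= /pushforward /mrestr.
  have -> : fst @^-1` `]p, q] `&` [set z : R * R | z.2 = h] = iota @` `]p, q].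
    apply/seteqP; split => [[x y] [/= xpq ->]|_ [x xpq <-]]; first by exists x.
    by split.
  case: ifPn => [pq|].
    apply/eqP; rewrite eq_le; apply/andP; split.
      apply: (le_trans (hausdorff1_delta_line_ge pq ltr01)).
      by apply: ereal_sup_ubound; exists 1 => //=.
    by apply: ge_ereal_sup => _ [e /= e0 <-]; exact: hausdorff1_delta_line_le.
  rewrite -leNgt => qp; rewrite set_itv_ge ?image_set0 ?hausdorff1_set0//.
  by rewrite bnd_simp -leNgt.
rewrite nuE; last by rewrite -[X in measurable X]setTI; exact: measurable_iota.
rewrite /nu /nu0/= /pushforward /mrestr; congr hausdorff1.
apply/seteqP; split => [[x y] Axy|[x y] /= [Axh ->]//].
by have /= yh := AL _ Axy; split => //=; rewrite /preimage/= -yh.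
Qed.

Lemma measurable_line (I : set R) : measurable I -> measurable (iota @` I).
Proof.
move=> mI; have -> : iota @` I = (fst @^-1` I) `&` [set z | z.2 = h].
  by apply/seteqP; split => [_ [x Ix <-]//|[x y] /= [Ix ->]]; exists x.
apply: measurableI; last exact: measurable_hline.
by rewrite -[X in measurable X]setTI; exact: measurable_fst.
Qed.

(** On subsets of the segment the Hausdorff measure is the image of Lebesgue measure, so this is the
    change of variables for a pushforward. *)
Lemma ge0_integral_line (I : set R) (f : R * R -> \bar R) : measurable I ->
  measurable_fun (iota @` I) f -> (forall z, 0 <= f z)%E ->
  (\int[hausdorff1]_(z in iota @` I) f z = \int[mu]_(x in I) f (x, h))%E.
Proof.
move=> mI mf f0.
have mE := measurable_line mI.
have preE : iota @^-1` (iota @` I) = I.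
  by apply/seteqP; split => [x [y Iy [<-]]//|x Ix]; exists x.
have m12 (A : set (R * R)) : measurable A -> A `<=` iota @` I ->
    hausdorff1 A = pushforward mu (iota : T1 -> R * R) A.
  by move=> mA AE; rewrite hausdorff1_line// => z /AE [x _ <-].
rewrite (eq_measure_integral _ m12).
apply: etrans (@ge0_integral_pushforward _ _ T1 (R * R)%type R _ measurable_iota mu
  (iota @` I) f mE mf (fun y _ => f0 y)) _.
by rewrite preE.
Qed.

End hausdorff_line.

(** * Boundary averages and the trace *)

Section limit_measurability.
Context d (T : measurableType d) (R : realType).
Variable A : T -> R -> R.
Hypothesis mA : forall r, 0 < r -> measurable_fun setT (A^~ r).
Hypothesis lcA : forall x r, 0 < r -> A x s @[s --> r^'-] --> A x r.

Let osc k m x := forall p q : rat, 0 < (ratr p : R) < m.+1%:R^-1 ->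
  0 < (ratr q : R) < m.+1%:R^-1 -> `|A x (ratr p) - A x (ratr q)| <= k.+1%:R^-1.

Let C := [set x | forall k, exists m, osc k m x].

Let measurable_osc k m : measurable (osc k m).
Proof.
pose P n : set T := if (unpickle n : option (rat * rat)) is Some pq then
  (if (0 < (ratr pq.1 : R) < m.+1%:R^-1) && (0 < (ratr pq.2 : R) < m.+1%:R^-1)
   then [set x | `|A x (ratr pq.1) - A x (ratr pq.2)| <= k.+1%:R^-1] else setT) else setT.
have -> : osc k m = \bigcap_n P n.
  apply/seteqP; split => [x ox n _|x Px p q pm qm].
    rewrite /P; case: (unpickle n) => [[p q]|]//=.
    by case: ifP => // /andP[pm qm]; exact: ox.
  by have := Px (pickle (p, q)) I; rewrite /P pickleK /= pm qm.
apply: bigcapT_measurable => n; rewrite /P.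
case: (unpickle n) => [[p q]|]//=; case: ifP => // /andP[/andP[p0 _] /andP[q0 _]].
have mf : measurable_fun setT (fun x => `|A x (ratr p) - A x (ratr q)|).
  by apply: measurableT_comp => //; apply: measurable_funB; exact: mA.
have := mf measurableT _ (measurable_itv `]-oo, (k.+1%:R^-1 : R)]).
by rewrite setTI; congr measurable; apply/seteqP; split => x; rewrite /= in_itv.
Qed.

Let measurable_C : measurable C.
Proof.
have -> : C = \bigcap_k \bigcup_m osc k m.
  apply/seteqP; split => [x Cx k _|x Cx k].
    by have [m ?] := Cx k; exists m.
  by have [m _ ?] := Cx k I; exists m.
by apply: bigcapT_measurable => k; apply: bigcupT_measurable => m.
Qed.

Let osc_real k m x (r s : R) : osc k m x -> 0 < r < m.+1%:R^-1 ->
  0 < s < m.+1%:R^-1 -> `|A x r - A x s| <= k.+1%:R^-1.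
Proof.
move=> ox.
have approx (t : R) (P : R -> Prop) : 0 < t < m.+1%:R^-1 ->
    (\forall u \near t^'-, P u) -> exists2 p : rat, 0 < (ratr p : R) < m.+1%:R^-1 & P (ratr p).
  move=> /andP[t0 tm] [e /= e0 He].
  have [p] : exists p : rat, ratr p \in `](Num.max 0 (t - e)), t[.
    by apply: rat_in_itvoo; rewrite gt_max t0/= ltrBlDr ltrDl.
  rewrite in_itv/= gt_max => /andP[/andP[p0 pe] pt].
  exists p; first by rewrite p0 (lt_trans pt tm).
  by apply: He => //=; rewrite ger0_norm ?subr_ge0 ?(ltW pt)// ltrBlDr -ltrBlDl.
move=> rm sm; apply/ler_addgt0Pr => e e0.
have r0 : 0 < r by case/andP: rm.
have s0 : 0 < s by case/andP: sm.
have e20 : 0 < e / 2 by rewrite divr_gt0.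
have /cvgrPdist_le/(_ _ e20) nr := @lcA x _ r0.
have /cvgrPdist_le/(_ _ e20) ns := @lcA x _ s0.
have [p pm rp] := approx r _ rm nr.
have [q qm sq] := approx s _ sm ns.
have -> : A x r - A x s = (A x r - A x (ratr p)) +
  (A x (ratr p) - A x (ratr q)) - (A x s - A x (ratr q)) by lra.
apply: le_trans (ler_normB _ _) _.
apply: (@le_trans _ _ (`|A x r - A x (ratr p)| + `|A x (ratr p) - A x (ratr q)| +
   `|A x s - A x (ratr q)|)); first by rewrite lerD2r ler_normD.
have -> : k.+1%:R^-1 + e = e / 2 + k.+1%:R^-1 + e / 2 by rewrite {1}[e]splitr addrCA addrA.
by apply: lerD; [apply: lerD => //; exact: ox|].
Qed.

Let near_small m : \forall r \near (0 : R)^'+, 0 < r < m.+1%:R^-1.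
Proof.
near=> r; apply/andP; split; near: r; first exact: nbhs_right_gt.
by apply: nbhs_right_lt; rewrite invr_gt0.
Unshelve. all: by end_near. Qed.

(* By left continuity the Cauchy criterion only needs rational radii, so that the set of
   convergence is measurable. *)
Let C_cvg x : C x <-> cvg (A x r @[r --> 0^'+]).
Proof.
split => [Cx|cx k].
  apply/cauchy_cvgP/cauchy_ballP => e e0.
  have [k ke] : exists k, k.+1%:R^-1 < e.
    have [k] := ltr_add_invr e0; rewrite add0r => ke; by exists k.
  have [m om] := Cx k.
  exists ((A x) @` [set r | 0 < r < m.+1%:R^-1], (A x) @` [set r | 0 < r < m.+1%:R^-1]).
    by split; apply: filterS (near_small m) => r rm; exists r.
  move=> [_ _] [/= [r rm <-] [s sm <-]]; rewrite /ball/=.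
  exact: le_lt_trans (osc_real om rm sm) ke.
have k0 : 0 < k.+1%:R^-1 / 2 :> R by rewrite divr_gt0.
move/cvg_ex : cx => [l /cvgrPdist_le/(_ _ k0)] [e /= e0 He].
have [m me] : exists m, m.+1%:R^-1 < e.
  have [m] := ltr_add_invr e0; rewrite add0r => me; by exists m.
exists m => p q /andP[p0 pm] /andP[q0 qm].
have H (t : R) : 0 < t -> t < m.+1%:R^-1 -> `|l - A x t| <= k.+1%:R^-1 / 2.
  move=> t0 tm; apply: He => //=.
  by rewrite sub0r normrN gtr0_norm// (lt_trans tm).
have -> : A x (ratr p) - A x (ratr q) = (l - A x (ratr q)) - (l - A x (ratr p)) by lra.
apply: le_trans (ler_normB _ _) _; by have := lerD (H _ q0 qm) (H _ p0 pm); rewrite -splitr.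
Qed.

Lemma measurable_lim_right0 : measurable_fun setT (fun x => lim (A x r @[r --> 0^'+])).
Proof.
(* Off [C] the limit does not exist and [lim] returns its default value 0, which the indicator
   reproduces. *)
pose u n x := A x n.+1%:R^-1 * \1_C x.
have mu_ n : measurable_fun setT (u n).
  by apply: measurable_funM; [exact: mA|exact: measurable_indic].
have ulim x : u n x @[n --> \oo] --> lim (A x r @[r --> 0^'+]).
  rewrite /u indicE; have [xC|xC] := boolP (x \in C).
    under eq_fun do rewrite mulr1.
    have /cvg_at_rightP := (C_cvg x).1 (set_mem xC).
    by apply; split => //; exact: cvg_harmonic.
  under eq_fun do rewrite mulr0.
  rewrite dvgP; first exact: cvg_cst.
  by move=> /C_cvg/mem_set; rewrite (negbTE xC).
apply/measurable_EFinP.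
apply: (emeasurable_fun_cvg (fun n => EFin \o u n)).
  by move=> n; exact/measurable_EFinP.
by move=> x _; apply: cvg_EFin; [exact: nearW|exact: ulim].
Qed.

End limit_measurability.

Lemma measurable_invr (R : realType) : measurable_fun setT (fun x : R => x^-1).
Proof.
have -> : [set: R] = [set 0] `|` [set~ 0] by rewrite setUv.
apply/measurable_funU => //; first exact: measurableC.
split.
  apply: (eq_measurable_fun (cst (0 : R) : R -> R)); last exact: measurable_cst.
  by move=> x /set_mem /= ->; rewrite invr0.
apply: open_continuous_measurable_fun.
  by apply: closed_openC; exact: closed_eq.
by move=> x /set_mem /= /eqP x0; exact: inv_continuous.
Qed.

(** * Measurability of the trace along a horizontal line *)

Section trace_measurability.
Context {R : realType}.
Notation mu := (@lebesgue_measure R).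
Notation mu2 := (@lebesgue2 R).
Notation T1 := (measurableTypeR R).
Notation T2 := (T1 * T1)%type.
Implicit Types (u : R * R -> R) (x h r : R).

Let B h x r : set (R * R) := [set y | eucl_dist (x, h) y < r].

Lemma measurable_eucl_dist_line h :
  measurable_fun setT (fun z : R * (R * R) => eucl_dist (z.1, h) z.2).
Proof.
have m1 : measurable_fun setT (fun z : R * (R * R) => z.2.1).
  by apply: measurableT_comp; [exact: measurable_fst|exact: measurable_snd].
have m2 : measurable_fun setT (fun z : R * (R * R) => z.2.2).
  by apply: measurableT_comp; [exact: measurable_snd|exact: measurable_snd].
apply: measurableT_comp; first exact: (continuous_measurable_fun (@sqrt_continuous R)).
apply: measurable_funD; apply: measurable_funX; apply: measurable_funB => //.
exact: measurable_fst.
Qed.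

Lemma measurable_ball_line h x r : measurable (B h x r).
Proof.
have m : measurable_fun setT (fun y : R * R => eucl_dist (x, h) y).
  have := measurableT_comp (measurable_eucl_dist_line h) (@pair1_measurable _ _ R (R * R)%type x).
  by [].
have := m measurableT _ (measurable_itv `]-oo, r[).
by rewrite setTI; congr measurable; apply/seteqP; split => y; rewrite /= in_itv.
Qed.

Variable D : set (R * R).
Hypotheses (mD : measurable D) (Dfin : (mu2 D < +oo)%E).

Let N u h x r := \int[mu2]_(y in D `&` B h x r) u y.

Let NE u h x r : N u h x r = \int[mu2]_y ((u \_ D) y * \1_(B h x r) y).
Proof.
rewrite /N Rintegral_mkcondr Rintegral_mkcond; congr Rintegral; apply/funext => y.
by rewrite !patchE indicE; case: (y \in D); case: (y \in B _ _ _); rewrite ?mulr1 ?mulr0 ?mul0r.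
Qed.

Let measurable_N u h r : measurable_fun D u -> measurable_fun setT (fun x => N u h x r).
Proof.
move=> mu_.
pose F (z : R * (R * R)) := ((u \_ D) z.2 * \1_(B h z.1 r) z.2)%:E.
have mF : measurable_fun setT F.
  apply/measurable_EFinP; apply: measurable_funM.
    apply: measurableT_comp; last exact: measurable_snd.
    exact: ((measurable_restrictT u mD).1 mu_).
  have mE : measurable [set z : R * (R * R) | eucl_dist (z.1, h) z.2 < r].
    have := measurable_eucl_dist_line h measurableT (measurable_itv `]-oo, r[).
    by rewrite setTI; congr measurable; apply/seteqP; split => y; rewrite /= in_itv.
  exact: measurable_indic mE.
have -> : (fun x => N u h x r) = (fine \o fun x =>
    (\int[mu2]_y F^\+ (x, y) - \int[mu2]_y F^\- (x, y))%E).
  apply/funext => x; rewrite NE /Rintegral /= integralE; congr (fine (_ - _)%E).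
    by apply: eq_integral => y _; rewrite !funeposE.
  by apply: eq_integral => y _; rewrite !funenegE.
apply: (measurable_comp measurableT) => //.
have mG (G : R * (R * R) -> \bar R) : measurable_fun setT G -> (forall z, 0 <= G z)%E ->
    measurable_fun setT (fun x : R => \int[mu2]_y G (x, y))%E.
  move=> mG G0.
  (* Regrouping the three variables as ((x, y1), y2) turns the planar integral into two successive
     one-dimensional Tonelli steps. *)
  have mH : measurable_fun setT (fun w : (T1 * T1) * T1 => G (w.1.1, (w.1.2, w.2))).
    apply: (measurableT_comp mG); apply: measurable_fun_pair.
      by apply: measurableT_comp; [exact: measurable_fst|exact: measurable_fst].
    apply: measurable_fun_pair; last exact: measurable_snd.
    by apply: measurableT_comp; [exact: measurable_snd|exact: measurable_fst].
  have mH1 := @measurable_fun_fubini_tonelli_F _ _ (T1 * T1)%type T1 R mu _ mH (fun w => G0 _).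
  have g0 w : (0 <= fubini_F mu (fun w : (T1 * T1) * T1 => G (w.1.1, (w.1.2, w.2))) w)%E.
    by apply: integral_ge0 => *; exact: G0.
  have mH2 := @measurable_fun_fubini_tonelli_F _ _ T1 T1 R mu _ mH1 g0.
  rewrite [X in measurable_fun _ X](_ : _ = (fun x : R => \int[mu]_y1 \int[mu]_y2 G (x, (y1, y2)))%E) //.
  apply/funext => x.
  apply: (@fubini_tonelli1 _ _ T1 T1 R mu mu (fun y => G (x, y))) => // .
  by apply: measurableT_comp.
apply: emeasurable_funB.
  by apply: mG; [exact: measurable_funepos|exact: funepos_ge0].
by apply: mG; [exact: measurable_funeneg|exact: funeneg_ge0].
Qed.

(** The balls are open, so those of radius [s < r] exhaust the ball of radius [r] as [s] tends to
    [r]; dominated convergence applies. Continuity from the right would see the bounding circle. *)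
Let left_continuous_N u h x r : mu2.-integrable D (EFin \o u) ->
  N u h x s @[s --> r^'-] --> N u h x r.
Proof.
move=> ui; apply/cvg_at_leftP => v [vr vcv].
have uDi : mu2.-integrable setT (EFin \o (u \_ D)).
  by move: ui => /(@integrable_mkcond _ T2 _ mu2 _ _ mD); rewrite restrict_EFin.
rewrite (_ : (fun n => _) = (fun n => \int[mu2]_y ((u \_ D) y * \1_(B h x (v n)) y))); last first.
  by apply/funext => n; rewrite NE.
rewrite NE; apply: (@Rintegral_dominated_cvg _ T2 _ mu2 setT _ _ (fun y => `|(u \_ D) y|)) => //.
- move=> n; apply: measurable_funM.
    by move: uDi => /measurable_int/measurable_EFinP.
  by apply: measurable_indic; exact: measurable_ball_line.
- move=> y _; apply: cvgM; first exact: cvg_cst.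
  rewrite indicE; have [yr|ry] := ltP (eucl_dist (x, h) y) r.
    rewrite mem_set//; apply: cvg_near_cst; near=> n.
    rewrite indicE mem_set// /B /=; near: n; exact: (cvgr_gt r).
  rewrite memNset; last by rewrite /B /= ltNge ry.
  apply: cvg_near_cst; apply: nearW => n.
  by rewrite indicE memNset// /B /=; apply/negP; rewrite -leNgt (le_trans _ ry)// ltW.
- exact: integrableR_norm.
- move=> n y _; rewrite normrM ler_piMr// indicE; case: (_ \in _); rewrite ?normr1 ?normr0//.
Unshelve. all: by end_near. Qed.

Let massE h x r : fine (mu2 (D `&` B h x r)) = N (cst 1) h x r.
Proof.
rewrite /N Rintegral_cst ?mul1r//.
by apply: measurableI => //; exact: measurable_ball_line.
Qed.

Lemma measurable_trace_line u h : measurable_fun D u -> mu2.-integrable D (EFin \o u) ->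
  measurable_fun setT (fun x : R => trace D u (x, h)).
Proof.
move=> mu_ ui.
have i1 : mu2.-integrable D (EFin \o (cst 1 : R * R -> R)) by exact: integrable_cst.
have -> : (fun x : R => trace D u (x, h)) =
    (fun x => lim (N u h x r / N (cst 1) h x r @[r --> 0^'+])).
  apply/funext => x; rewrite /trace.
  rewrite [X in lim (X @ _)](_ : _ = (fun r => N u h x r / N (cst 1) h x r))//.
  by apply/funext => r; exact: (f_equal (fun t => N u h x r / t) (massE h x r)).
apply: measurable_lim_right0 => [r _|x r r0].
  apply: measurable_funM; first exact: measurable_N.
  by apply: measurableT_comp; [exact: measurable_invr|exact: measurable_N].
(* If the ball of radius [r] carries no mass of [D], neither do smaller ones, and the quotient is
   constantly 0 because the inverse of 0 is 0. *)
have [M0|M0] := eqVneq (N (cst 1) h x r) 0.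
  rewrite M0 invr0 mulr0; apply: cvg_near_cst; near=> s.
  suff -> : N (cst 1) h x s = 0 by rewrite invr0 mulr0.
  apply/eqP; rewrite eq_le -[X in _ <= X]M0 -!massE fine_ge0// andbT fine_le//.
  - by rewrite ge0_fin_numE//; apply: le_lt_trans Dfin; apply: le_measure; rewrite ?inE//;
      apply: measurableI => //; exact: measurable_ball_line.
  - by rewrite ge0_fin_numE//; apply: le_lt_trans Dfin; apply: le_measure; rewrite ?inE//;
      apply: measurableI => //; exact: measurable_ball_line.
  - apply: le_measure; rewrite ?inE; [apply: measurableI => //; exact: measurable_ball_line..|].
    apply: setIS => y; rewrite /B/= => ys; apply: lt_le_trans ys _.
    by near: s; apply: nbhs_left_le.
by apply: cvgM; [exact: left_continuous_N|apply: cvgV => //; exact: left_continuous_N].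
Unshelve. all: by end_near. Qed.

End trace_measurability.

Section layers.
Context {R : realType}.
Notation mu := (@lebesgue_measure R).

(** The boolean selects the side of the height [h], so that the trace argument is written once for
    both loaded edges. The layer is open: it misses [h] and shrinks to the empty set with [d]. *)
Definition layer (s : bool) (h d : R) : set R :=
  if s then `]h - d, h[%classic else `]h, h + d[%classic.

Lemma measurable_layer s h d : measurable (layer s h d).
Proof. by rewrite /layer; case: s; exact: measurable_itv. Qed.

Lemma lebesgue_measure_layer s h d : 0 < d -> mu (layer s h d) = d%:E.
Proof.
move=> d0; rewrite /layer; case: s; rewrite lebesgue_measure_itv/= lte_fin.
  by rewrite ltrBlDr ltrDl d0 -EFinB subKr.
by rewrite ltrDl d0 -EFinB addrAC subrr add0r.
Qed.

Lemma le_layer s h d d' : d <= d' -> layer s h d `<=` layer s h d'.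
Proof.
move=> dd' y; rewrite /layer; case: s; rewrite /= !in_itv/= => /andP[? ?];
  apply/andP; split => //; lra.
Qed.

Lemma indic_layer_cvg0 s h (v : nat -> R) y : v n @[n --> \oo] --> 0 ->
  (\1_(layer s h (v n)) y : R) @[n --> \oo] --> (0 : R).
Proof.
move=> v0; apply: cvg_near_cst.
have [yh|yh] := eqVneq y h.
  apply: nearW => n; rewrite indicE memNset// yh /layer.
  by case: s; rewrite /= in_itv/= ltxx ?andbF.
have yh0 : 0 < `|y - h| by rewrite normr_gt0 subr_eq0.
have : \forall n \near \oo, v n < `|y - h| by apply: (cvgr_lt 0).
apply: filterS => n vn; rewrite indicE memNset// /layer => H.
move: H vn; case: s; rewrite /= in_itv/= => /andP[h1 h2].
  by rewrite ltr0_norm ?subr_lt0//; lra.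
by rewrite gtr0_norm ?subr_gt0//; lra.
Qed.

End layers.

Section euclidean_distance.
Context {R : realType}.
Implicit Types x y : R * R.

Lemma eucl_dist_ge1 x y : `|x.1 - y.1| <= eucl_dist x y.
Proof. by rewrite /eucl_dist -sqrtr_sqr ler_wsqrtr// lerDl sqr_ge0. Qed.

Lemma eucl_dist_ge2 x y : `|x.2 - y.2| <= eucl_dist x y.
Proof. by rewrite /eucl_dist -sqrtr_sqr ler_wsqrtr// lerDr sqr_ge0. Qed.

Lemma eucl_dist_le x y : eucl_dist x y <= `|x.1 - y.1| + `|x.2 - y.2|.
Proof.
rewrite /eucl_dist -[leRHS]ger0_norm ?addr_ge0// -sqrtr_sqr ler_wsqrtr//.
rewrite [leRHS]sqrrD !real_normK ?num_real// -addrA lerD2l lerDr.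
by rewrite mulrn_wge0// mulr_ge0.
Qed.

End euclidean_distance.

(** * Identification of the trace at Lebesgue points of the boundary values *)

Section trace_at_lebesgue_points.
Context {R : realType}.
Notation mu := (@lebesgue_measure R).
Notation mu2 := (@lebesgue2 R).
Notation T1 := (measurableTypeR R).
Notation T2 := (T1 * T1)%type.
Variables (D : set (R * R)) (s : bool) (a b h d0 : R) (u k : R * R -> R) (W : R -> R).
Hypotheses (mD : measurable D) (Dfin : (mu2 D < +oo)%E) (d0_gt0 : 0 < d0).
Hypothesis D_layer : `]a, b[ `*` layer s h d0 `<=` D.
Hypotheses (Lu : L2 D u) (Lk : L2 D k) (Wi : mu.-integrable setT (EFin \o W)).
Hypothesis uW : forall (A : set R) (d : R),
  measurable A -> A `<=` `]a, b[ -> 0 < d <= d0 ->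
  (\int[mu2]_(z in A `*` layer s h d) `|(u z - W z.1)%:E| <=
   d%:E * \int[mu2]_(z in A `*` layer s h d) `|(k z)%:E|)%E.

Let rect_sub (A : set R) d : A `<=` `]a, b[ -> d <= d0 -> A `*` layer s h d `<=` D.
Proof.
move=> Aab dd0 z [Az dz]; apply: D_layer; split; first exact: Aab.
exact: le_layer dz.
Qed.

Let mrect (A : set R) d : measurable A -> measurable (A `*` layer s h d : set (R * R)).
Proof. by move=> mA; apply: measurable_rect => //; exact: measurable_layer. Qed.

Let rect_fin (A : set R) d : measurable A -> A `<=` `]a, b[ -> d <= d0 ->
  (mu2 (A `*` layer s h d) < +oo)%E.
Proof.
move=> mA Aab dd0; apply: le_lt_trans Dfin; apply: le_measure; rewrite ?inE//.
  exact: mrect.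
exact: rect_sub.
Qed.

(** Absolute continuity of the integral: the squares over ever thinner layers tend to 0, by
    dominated convergence. The threshold serves all bases [A], since each is contained in the full
    layer. *)
Lemma sqr_layer_cvg0 (e : R) : 0 < e -> \forall d \near 0^'+,
  forall A, measurable A -> A `<=` `]a, b[ ->
  \int[mu2]_(z in A `*` layer s h d) k z ^+ 2 <= e.
Proof.
move=> e0.
have Lk2 : mu2.-integrable D (EFin \o (fun z => k z ^+ 2)).
  by apply: (@integrable_sqr _ T2) => //; case: Lk.
pose F n z := k z ^+ 2 * \1_(layer s h n.+1%:R^-1) z.2.
have Fcv : \int[mu2]_(z in D) F n z @[n --> \oo] --> \int[mu2]_(z in D) (0 : R).
  apply: (@Rintegral_dominated_cvg _ T2 _ mu2 D _ _ (fun z => k z ^+ 2)) => //.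
  - move=> n; apply: measurable_funM.
      by move: Lk2 => /measurable_int/measurable_EFinP.
    apply/measurable_funTS/measurableT_comp; last exact: measurable_snd.
    by apply: measurable_indic; exact: measurable_layer.
  - move=> z _; rewrite -[X in _ --> X](mulr0 (k z ^+ 2)).
    apply: cvgM; first exact: cvg_cst.
    by apply: indic_layer_cvg0; exact: cvg_harmonic.
  - move=> n z _; rewrite normrM ger0_norm ?sqr_ge0// ler_piMr ?sqr_ge0//.
    by rewrite indicE; case: (_ \in _); rewrite ?normr1 ?normr0.
rewrite Rintegral_cst// mul0r in Fcv.
have [n Hn] : exists n, \int[mu2]_(z in D) F n z < e.
  have [n _ Hn] := cvgr_lt _ Fcv _ e0.
  by exists n; exact: (Hn n (leqnn n)).
near=> d => A mA Aab.
have dd0 : d <= d0 by near: d; exact: nbhs_right_le.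
have dn : d <= n.+1%:R^-1 by near: d; apply: nbhs_right_le; rewrite invr_gt0.
apply: le_trans (ltW Hn).
rewrite [leLHS]Rintegral_mkcond [leRHS]Rintegral_mkcond.
have Fi : mu2.-integrable D (EFin \o F n).
  apply: (@integrable_boundedM _ T2 _ _ _ _ _ 1) => //.
    apply/measurable_funTS/measurableT_comp; last exact: measurable_snd.
    by apply: measurable_indic; exact: measurable_layer.
  by move=> z _; rewrite indicE; case: (_ \in _); rewrite ?normr1 ?normr0.
have mAd := mrect d mA.
have sub := rect_sub Aab dd0.
apply: (@le_Rintegral _ T2) => //.
- have : mu2.-integrable (A `*` layer s h d) (EFin \o (fun z => k z ^+ 2)).
    exact: integrableS Lk2.
  by move=> /(@integrable_mkcond _ T2 _ mu2 _ _ mAd); rewrite restrict_EFin.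
- by move: Fi => /(@integrable_mkcond _ T2 _ mu2 _ _ mD); rewrite restrict_EFin.
- move=> z _; rewrite !patchE; case: ifPn => [/set_mem zA|_].
    rewrite mem_set; last exact: sub.
    by rewrite /F indicE mem_set ?mulr1//; case: zA => _; exact: le_layer.
  by case: ifP => // _; rewrite /F mulr_ge0 ?sqr_ge0// indicE; case: (_ \in _).
Unshelve. all: by end_near. Qed.

Lemma abs_layer_le (A : set R) d : measurable A -> A `<=` `]a, b[ -> 0 < d <= d0 ->
  \int[mu2]_(z in A `*` layer s h d) `|k z| <=
  Num.sqrt (fine (mu A) * d) * Num.sqrt (\int[mu2]_(z in A `*` layer s h d) k z ^+ 2).
Proof.
move=> mA Aab /andP[dp dd0].
have mAd := mrect d mA.
have [mk fk] := L2_subset mD mAd (rect_sub Aab dd0) Lk.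
have Afin : mu A \is a fin_num.
  rewrite ge0_fin_numE//; apply: (@le_lt_trans _ _ (mu `]a, b[%classic)).
    by apply: le_measure; rewrite ?inE.
  exact: lebesgue_measure_bnd_lty.
have E : fine (mu2 (A `*` layer s h d)) = fine (mu A) * d.
  by rewrite (lebesgue2_rect mA (measurable_layer _ _ _)) (lebesgue_measure_layer _ _ dp) fineM.
rewrite -E.
exact: (@Rintegral_norm_le_sqrt _ T2 _ mu2 _ k mAd (rect_fin mA Aab dd0) mk fk).
Qed.

(** Insert [W z.1]. The deviation of [u] from it is controlled by [uW]; the remaining term depends
    on x1 only and is multiplied by the thickness [d] of the layer. *)
Lemma abs_trace_layer_le x1 (A : set R) d (K L : R) :
  measurable A -> A `<=` `]a, b[ -> 0 < d <= d0 ->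
  \int[mu2]_(z in A `*` layer s h d) `|k z| <= K ->
  \int[mu]_(x in A) `|W x - W x1| <= L ->
  (\int[mu2]_(z in A `*` layer s h d) `|(u z - W x1)%:E| <= (d * (K + L))%:E)%E.
Proof.
move=> mA Aab dd0 kK WL.
have /andP[dp dd] := dd0.
have mAd := mrect d mA.
have sub := rect_sub Aab dd.
have [mk fk] := L2_subset mD mAd sub Lk.
have [muu _] := L2_subset mD mAd sub Lu.
have mW : measurable_fun setT W by move: Wi => /measurable_int/measurable_EFinP.
have m1 : measurable_fun (A `*` layer s h d) (fun z => `|(u z - W z.1)%:E|%E).
  apply: measurableT_comp => //; apply/measurable_EFinP; apply: measurable_funB => //.
  by apply/measurable_funTS/measurableT_comp => //; exact: measurable_fst.
have m2 : measurable_fun (A `*` layer s h d) (fun z : R * R => `|(W z.1 - W x1)%:E|%E).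
  apply: measurableT_comp => //; apply/measurable_EFinP; apply: measurable_funB => //.
  by apply/measurable_funTS/measurableT_comp => //; exact: measurable_fst.
apply: (@le_trans _ _ (\int[mu2]_(z in A `*` layer s h d)
    (`|(u z - W z.1)%:E| + `|(W z.1 - W x1)%:E|))%E).
  apply: (@ge0_le_integral _ T2) => //.
  - apply/measurable_EFinP; apply: measurableT_comp => //.
    by apply: measurable_funB => //; exact: measurable_cst.
  - by apply: emeasurable_funD.
  - by move=> z _; rewrite -EFinD lee_fin; exact: ler_distD.
rewrite (@ge0_integralD _ T2)//.
rewrite mulrDr EFinD; apply: leeD.
  apply: le_trans (uW mA Aab dd0) _; rewrite EFinM lee_wpmul2l ?lee_fin ?(ltW dp)//.
  have ki := @integrable_of_sqr _ T2 _ mu2 _ k mAd (rect_fin mA Aab dd) mk fk.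
  move: kK; rewrite -lee_fin /Rintegral fineK => [h1|]; first exact: h1.
  exact: (@integrable_fin_num _ T2 _ mu2 _ mAd _ (@integrableR_norm _ T2 _ mu2 _ _ mAd ki)).
have -> : (\int[mu2]_(z in A `*` layer s h d) `|(W z.1 - W x1)%:E| =
  mu (layer s h d) * \int[mu]_(x in A) `|(W x - W x1)%:E|)%E.
  rewrite ge0_integral_rect2//; last exact: measurable_layer.
  by rewrite muleC -(@integral_cst _ T1)//; exact: measurable_layer.
rewrite (lebesgue_measure_layer _ _ dp) EFinM lee_wpmul2l ?lee_fin ?(ltW dp)//.
have Afin : (mu A < +oo)%E.
  apply: (@le_lt_trans _ _ (mu `]a, b[%classic)); last exact: lebesgue_measure_bnd_lty.
  by apply: le_measure; rewrite ?inE.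
have WA : mu.-integrable A (EFin \o W) by exact: integrableS Wi.
have cA : mu.-integrable A (EFin \o cst (W x1)) by exact: integrable_cst.
move: WL; rewrite -lee_fin /Rintegral fineK => [h1|]; first exact: h1.
exact: (@integrable_fin_num _ T1 _ mu _ mA _ (@integrableR_norm _ T1 _ mu _ _ mA (@integrableR_B _ T1 _ mu _ _ _ mA WA cA))).
Qed.

(** [D] within radius [r] lies in a box of width [2 r] and height [r], since [D] is on one side of
    the edge, and contains a box of width [r] and height [r / 2]. The integrated deviation over the
    outer box is o(r^2), while the inner box bounds the mass below by a multiple of r^2. *)
Lemma trace_cvg_lebesgue_pt x1 : a < x1 < b -> lebesgue_pt W x1 ->
  (forall z, D z -> if s then z.2 < h else h < z.2) ->
  (\int[mu2]_(y in D `&` [set y | eucl_dist (x1, h) y < r]) u y) /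
  fine (mu2 (D `&` [set y | eucl_dist (x1, h) y < r])) @[r --> 0^'+] --> W x1.
Proof.
move=> /andP[ax1 x1b] Wx1 side; apply/cvgrPdist_le => e e0.
have e40 : 0 < e / 4 by rewrite divr_gt0.
have e80 : 0 < (e / 8) ^+ 2 by rewrite exprn_gt0// divr_gt0.
near=> r.
have r0 : 0 < r by near: r; exact: nbhs_right_gt.
have rd0 : r <= d0 by near: r; exact: nbhs_right_le.
have rab : r < Num.min (x1 - a) (b - x1).
  by near: r; apply: nbhs_right_lt; rewrite lt_min !subr_gt0 ax1.
move: rab; rewrite lt_min => /andP[ra rb].
pose A := `]x1 - r, x1 + r[%classic.
have mA : measurable A by exact: measurable_itv.
have Aab : A `<=` `]a, b[.
  by move=> y; rewrite /A/= !in_itv/= => /andP[y1 y2]; apply/andP; split; lra.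
have rr : 0 < r <= d0 by rewrite r0.
set B := [set y | eucl_dist (x1, h) y < r].
have mB : measurable B by exact: measurable_ball_line.
have mDB : measurable (D `&` B) by exact: measurableI.
have DBA : D `&` B `<=` A `*` layer s h r.
  move=> z [Dz Bz]; have := side _ Dz.
  have := le_lt_trans (eucl_dist_ge1 _ _) Bz; have := le_lt_trans (eucl_dist_ge2 _ _) Bz.
  rewrite /= !ltr_norml => /andP[z2l z2r] /andP[z1l z1r] sz.
  split; first by rewrite /A/= in_itv/=; apply/andP; split; lra.
  by move: sz; rewrite /layer; case: (s) => sz; rewrite /= in_itv/=; apply/andP; split; lra.
pose A' := `]x1 - r / 2, x1 + r / 2[%classic.
have mA' : measurable A' by exact: measurable_itv.
have r20 : 0 < r / 2 by rewrite divr_gt0.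
have ADB : A' `*` layer s h (r / 2) `<=` D `&` B.
  move=> z [z1 z2]; split.
    apply: D_layer; split; last by apply: le_layer z2; lra.
    by move: z1; rewrite /A'/= !in_itv/= => /andP[? ?]; apply/andP; split; lra.
  apply: le_lt_trans (eucl_dist_le _ _) _; rewrite [ltRHS]splitr /=; apply: ltrD.
    by move: z1; rewrite /A'/= in_itv/= => /andP[? ?]; rewrite ltr_norml; apply/andP; split; lra.
  move: z2; rewrite /layer; case: (s); rewrite /= in_itv/= => /andP[? ?];
    by rewrite ltr_norml; apply/andP; split; lra.
have DBfin : (mu2 (D `&` B) < +oo)%E.
  by apply: le_lt_trans Dfin; apply: le_measure; rewrite ?inE//; exact: subIsetl.
have mass : r ^+ 2 / 2 <= fine (mu2 (D `&` B)).
  have E : mu2 (A' `*` layer s h (r / 2)) = (r ^+ 2 / 2)%:E.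
    rewrite (lebesgue2_rect mA' (measurable_layer _ _ _)) (lebesgue_measure_layer _ _ r20).
    rewrite lebesgue_measure_itv/= lte_fin ifT; last by lra.
    by rewrite -EFinB -EFinM; congr EFin; lra.
  rewrite -lee_fin fineK; last by rewrite ge0_fin_numE.
  by rewrite -E; apply: le_measure; rewrite ?inE//; exact: mrect.
(* Cauchy-Schwarz on an area [2 * r * r] gives a factor at most [2 * r], and the layer integral of
   [k ^+ 2] has been made at most [(e / 8) ^+ 2]. *)
have K : \int[mu2]_(z in A `*` layer s h r) `|k z| <= r * (e / 4).
  apply: le_trans (abs_layer_le mA Aab rr) _.
  have -> : fine (mu A) = 2 * r.
    rewrite lebesgue_measure_itv/= lte_fin ifT; last by lra.
    by rewrite -EFinB/=; lra.
  have -> : r * (e / 4) = (2 * r) * (e / 8) by lra.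
  apply: ler_pM; rewrite ?sqrtr_ge0//.
    rewrite -[leRHS]ger0_norm; last by rewrite mulr_ge0// ltW.
    rewrite -sqrtr_sqr ler_wsqrtr// expr2 ler_wpM2l ?mulr_ge0 ?(ltW r0)//.
    by rewrite ler_peMl ?(ltW r0)// ler1n.
  rewrite -[leRHS]ger0_norm; last by rewrite divr_ge0// ltW.
  rewrite -sqrtr_sqr ler_wsqrtr//.
  have : forall A, measurable A -> A `<=` `]a, b[ ->
      \int[mu2]_(z in A `*` layer s h r) k z ^+ 2 <= (e / 8) ^+ 2.
    by near: r; exact: sqr_layer_cvg0.
  exact.
have L : \int[mu]_(x in A) `|W x - W x1| <= e / 4 * r.
  have : forall D, measurable D -> D `<=` ball x1 r ->
      \int[mu]_(x in D) `|W x - W x1| <= e / 4 * r.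
    by near: r; exact: lebesgue_pt_Rintegral_le.
  apply => // y; rewrite /A/= in_itv/= /ball/= ltr_distlC => /andP[? ?].
  by apply/andP; split.
have key := abs_trace_layer_le mA Aab rr K L.
have uDB : mu2.-integrable (D `&` B) (EFin \o u).
  have [mu_ fu] := L2_subset mD mDB (@subIsetl _ _ _) Lu.
  exact: (@integrable_of_sqr _ T2 _ mu2 _ u mDB DBfin mu_ fu).
have m0 : 0 < fine (mu2 (D `&` B)).
  by apply: lt_le_trans mass; rewrite divr_gt0// exprn_gt0.
have cDB : mu2.-integrable (D `&` B) (EFin \o cst (W x1)) by exact: integrable_cst.
have -> : W x1 = (\int[mu2]_(y in D `&` B) cst (W x1) y) / fine (mu2 (D `&` B)).
  by rewrite Rintegral_cst// mulfK// gt_eqF.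
rewrite -mulrBl -(@RintegralB _ T2)// normrM [X in _ * X]gtr0_norm ?invr_gt0//.
rewrite ler_pdivrMr//.
apply: (@le_trans _ _ (r * (r * (e / 4) + e / 4 * r))); last first.
  (* The choice of quarters makes the numerator exactly [e] times the lower bound for the mass. *)
  have -> : r * (r * (e / 4) + e / 4 * r) = e * (r ^+ 2 / 2) by lra.
  by rewrite ler_pM2l.
rewrite -lee_fin; apply: le_trans key.
have udi := @integrableR_B _ T2 _ mu2 _ _ _ mDB uDB cDB.
have nui := @integrableR_norm _ T2 _ mu2 _ _ mDB udi.
apply: (@le_trans _ _ (\int[mu2]_(y in D `&` B) `|u y - W x1|)%:E).
  rewrite lee_fin; apply: (le_trans (@le_normr_Rintegral _ T2 _ mu2 _ _ mDB
    (@integrableR_B _ T2 _ mu2 _ _ _ mDB cDB uDB))).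
  by rewrite [leLHS](@eq_Rintegral _ T2 _ mu2 _ (fun y => `|u y - W x1|))// => y _; rewrite distrC.
rewrite /Rintegral fineK; last exact: (@integrable_fin_num _ T2 _ mu2 _ mDB _ nui).
apply: (@ge0_subset_integral _ T2) => //; first exact: mrect.
have [muu _] := L2_subset mD (mrect r mA) (rect_sub Aab rd0) Lu.
apply/measurable_EFinP; apply: measurableT_comp => //.
by apply: measurable_funB => //; exact: measurable_cst.
Unshelve. all: by end_near. Qed.

End trace_at_lebesgue_points.

Section layer_averages.
Context {R : realType}.
Notation mu := (@lebesgue_measure R).
Notation mu2 := (@lebesgue2 R).
Notation T1 := (measurableTypeR R).
Notation T2 := (T1 * T1)%type.

Lemma integrable_rect_fst (A J : set R) (f : R -> R) : measurable A -> measurable J ->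
  (mu J < +oo)%E -> mu.-integrable A (EFin \o f) ->
  mu2.-integrable (A `*` J) (EFin \o (fun z => f z.1)).
Proof.
move=> mA mJ Jfin /(@integrableP _ T1)[/measurable_EFinP mf foo].
have mAJ := measurable_rect mA mJ.
have mf1 : measurable_fun (A `*` J) (fun z : R * R => f z.1).
  apply: (@measurable_comp _ _ _ _ _ _ A) => //; first by move=> x [z [? _] <-].
  by apply: measurable_funTS; exact: measurable_fst.
apply/(@integrableP _ T2); split; first exact/measurable_EFinP.
rewrite (@ge0_integral_rect1 _ _ T1 T1 _ mu mu (fun z => `|(f z.1)%:E|%E))//.
  rewrite (@eq_integral _ T1 _ mu _ (fun x => (mu J * `|(f x)%:E|)%E)); last first.
    by move=> x _; rewrite /= (@integral_cst _ T1 _ mu J mJ `|f x|%:E) muleC.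
  rewrite (@ge0_integralZl _ T1)//; last by apply/measurable_EFinP/measurableT_comp.
  by rewrite lte_mul_pinfty// ge0_fin_numE.
by apply/measurable_EFinP/measurableT_comp.
Qed.

Lemma Rintegral_rect_fst (A J : set R) (f : R -> R) : measurable A -> measurable J ->
  (mu J < +oo)%E -> mu.-integrable A (EFin \o f) ->
  \int[mu2]_(z in A `*` J) f z.1 = fine (mu J) * \int[mu]_(x in A) f x.
Proof.
move=> mA mJ Jfin fi.
have mAJ := measurable_rect mA mJ.
have /(@integrable_mkcond _ T2 _ mu2 _ _ mAJ) := integrable_rect_fst mA mJ Jfin fi.
rewrite restrict_EFin => gi.
rewrite Rintegral_mkcond (Rfubini1 gi) [in RHS]Rintegral_mkcond.
rewrite -RintegralZl//; last first.
  by have /(@integrable_mkcond _ T1 _ mu _ _ mA) := fi; rewrite restrict_EFin.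
apply: eq_Rintegral => x _.
rewrite [in RHS]patchE; case: ifPn => xA.
  rewrite (@eq_Rintegral _ T1 _ mu _ ((cst (f x)) \_ J)).
    by rewrite -Rintegral_mkcond Rintegral_cst// mulrC.
  move=> y _; rewrite !patchE; have -> // : ((x, y) \in A `*` J) = (y \in J).
  apply/idP/idP; first by move=> /set_mem[_ Jy]; exact/mem_set.
  by move=> /set_mem Jy; apply/mem_set; split => //; exact/set_mem.
rewrite mulr0 (@eq_Rintegral _ T1 _ mu _ (cst 0)) ?Rintegral_cst ?mul0r//.
move=> y _; rewrite patchE ifN//; apply: contra xA => /set_mem[Ax _].
exact/mem_set.
Qed.

End layer_averages.

(** * Layer averages compared with edge integrals *)

Section edge_estimate.
Context {R : realType}.
Notation mu := (@lebesgue_measure R).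
Notation mu2 := (@lebesgue2 R).
Notation T1 := (measurableTypeR R).
Notation T2 := (T1 * T1)%type.
Variables (D : set (R * R)) (s : bool) (a b h d0 : R).
Hypotheses (mD : measurable D) (Dfin : (mu2 D < +oo)%E) (d0_gt0 : 0 < d0).
Hypotheses (ab : a < b) (D_layer : `]a, b[ `*` layer s h d0 `<=` D).
Hypothesis side : forall z, D z -> if s then z.2 < h else h < z.2.

Let I := `]a, b[%classic.
Let mI : measurable I := measurable_itv _.
Let mQ d : measurable (I `*` layer s h d : set (R * R)).
Proof. by apply: measurable_rect => //; exact: measurable_layer. Qed.
Let QD d : d <= d0 -> I `*` layer s h d `<=` D.
Proof. by move=> dd0 z [Iz dz]; apply: D_layer; split => //; exact: le_layer dz. Qed.

Lemma sobolev_trace_layer u : sobolev1 D u ->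
  exists2 W : R -> R, mu.-integrable setT (EFin \o W) &
  forall (A : set R) (d : R), measurable A -> A `<=` `]a, b[ -> 0 < d <= d0 ->
  (\int[mu2]_(z in A `*` layer s h d) `|(u z - W z.1)%:E| <=
   d%:E * \int[mu2]_(z in A `*` layer s h d) `|(weak_deriv D e2 u z)%:E|)%E.
Proof.
move=> uD; move: D_layer; rewrite /layer; case: (s) => DQ.
  have lt_h : h - d0 < h by rewrite ltrBlDr ltrDl.
  have [W Wi uW] := sobolev_trace_top mD DQ lt_h uD.
  by exists W => // A d mA Aab dd0; apply: uW => //; rewrite subKr.
have lt_h : h < h + d0 by rewrite ltrDl.
have [W Wi uW] := sobolev_trace_bottom mD DQ lt_h uD.
by exists W => // A d mA Aab dd0; apply: uW => //; rewrite addrAC subrr add0r.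
Qed.

(** The edge integral is rewritten as the average over the layer of [c z.1 * W z.1], so that both
    terms become one planar integral. The factor [d] of the trace inequality cancels [d^-1], and the
    square root of the area of the layer remains. *)
Lemma edge_trace_estimate u : sobolev1 D u ->
  mu.-integrable I (EFin \o (fun x => trace D u (x, h))) /\
  forall (c : R -> R) (M d : R), measurable_fun I c -> (forall x, I x -> `|c x| <= M) ->
    0 < d <= d0 ->
  `|d^-1 * \int[mu2]_(z in I `*` layer s h d) (c z.1 * u z) -
    \int[mu]_(x in I) (c x * trace D u (x, h))| <=
  M * Num.sqrt ((b - a) * d) * Num.sqrt (\int[mu2]_(z in D) (weak_deriv D e2 u z ^+ 2)).
Proof.
move=> uD.
have [W Wi uW] := sobolev_trace_layer uD.
have [Lu _ /weak_derivP[Lk _]] := uD.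
have ui : mu2.-integrable D (EFin \o u).
  by have [mu_ fu] := Lu; exact: (@integrable_of_sqr _ T2 _ mu2 _ u).
have mtr : measurable_fun setT (fun x => trace D u (x, h)).
  by apply: measurable_trace_line => //; case: Lu.
have mW : measurable_fun setT W by move: Wi => /measurable_int/measurable_EFinP.
have tW : {ae mu, forall x, I x -> W x = trace D u (x, h)}.
  have locW : locally_integrable setT W by apply: open_integrable_locally => //; exact: openT.
  apply: filterS (lebesgue_differentiation locW) => x Wx.
  rewrite /I/= in_itv/= => axb; apply/esym/cvg_lim => //.
  exact: (trace_cvg_lebesgue_pt mD Dfin d0_gt0 D_layer Lu Lk Wi uW).
have WI : mu.-integrable I (EFin \o W) by exact: integrableS Wi.
have tI : mu.-integrable I (EFin \o (fun x => trace D u (x, h))).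
  have mtI : measurable_fun I (EFin \o (fun x => trace D u (x, h))).
    by apply/measurable_EFinP; exact: measurable_funTS.
  have /(@integrableP _ T1)[mWI Woo] := WI.
  apply/(@integrableP _ T1); split => //.
  rewrite -(@ge0_ae_eq_integral _ T1 _ mu I (abse \o (EFin \o W)))//.
  - exact: measurableT_comp.
  - exact: measurableT_comp.
  - by move=> x _; exact: abse_ge0.
  - by apply: filterS tW => x tWx Ix /=; rewrite tWx.
split => // c M d mc cM dd0.
have /andP[dp dd] := dd0.
have d1 : d != 0 by rewrite gt_eqF.
have cWI : mu.-integrable I (EFin \o (fun x => c x * W x)).
  have -> : (fun x => c x * W x) = (fun x => W x * c x) by apply/funext => x; rewrite mulrC.
  exact: (@integrable_boundedM _ T1 _ mu _ _ _ M).
have -> : \int[mu]_(x in I) (c x * trace D u (x, h)) = \int[mu]_(x in I) (c x * W x).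
  apply: ae_eq_Rintegral => //.
  - by apply: measurable_funM => //; exact: measurable_funTS.
  - by apply: measurable_funM => //; exact: measurable_funTS.
  - by apply: filterS tW => x tWx Ix; rewrite tWx.
have mQd := mQ d.
have mL := measurable_layer s h d.
have Lfin : (mu (layer s h d) < +oo)%E by rewrite lebesgue_measure_layer// ltry.
have -> : \int[mu]_(x in I) (c x * W x) =
    d^-1 * \int[mu2]_(z in I `*` layer s h d) (c z.1 * W z.1).
  rewrite (Rintegral_rect_fst mI mL Lfin cWI).
  by rewrite lebesgue_measure_layer//= mulrA mulVf// mul1r.
have uQ := @integrableS _ T2 _ mu2 _ _ _ mD (mQ d) (QD dd) ui.
have WQ := integrable_rect_fst mI mL Lfin WI.
have cWQ := integrable_rect_fst mI mL Lfin cWI.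
have mcQ : measurable_fun (I `*` layer s h d) (fun z : R * R => c z.1).
  apply: (@measurable_comp _ _ _ _ _ _ I) => //; first by move=> x [z [? _] <-].
  by apply: measurable_funTS; exact: measurable_fst.
have cuQ : mu2.-integrable (I `*` layer s h d) (EFin \o (fun z => c z.1 * u z)).
  have -> : (fun z => c z.1 * u z) = (fun z => u z * c z.1) by apply/funext => x; rewrite mulrC.
  by apply: (@integrable_boundedM _ T2 _ mu2 _ _ _ M) => // z [Iz _]; exact: cM.
rewrite -mulrBr -(@RintegralB _ T2)// normrM ger0_norm ?invr_ge0 ?(ltW dp)//.
rewrite mulrC ler_pdivrMr//.
have uWQ := @integrableR_B _ T2 _ mu2 _ _ _ (mQ d) uQ WQ.
have kQ := L2_subset mD (mQ d) (QD dd) Lk.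
have ki : mu2.-integrable (I `*` layer s h d) (EFin \o weak_deriv D e2 u).
  have [mk fk] := kQ; apply: (@integrable_of_sqr _ T2 _ mu2 _ _ (mQ d) _ mk fk).
  by apply: le_lt_trans Dfin; apply: le_measure; rewrite ?inE//; exact: QD.
have M0 : 0 <= M.
  have m2 : I ((a + b) / 2) by rewrite /I/= in_itv/= !midf_lt.
  exact: le_trans (cM _ m2).
apply: (@le_trans _ _ (M * \int[mu2]_(z in I `*` layer s h d) `|u z - W z.1|)).
  have nQ := @integrableR_norm _ T2 _ mu2 _ _ (mQ d) uWQ.
  rewrite -(@RintegralZl _ T2)//.
  apply: (le_trans (@le_normr_Rintegral _ T2 _ mu2 _ _ (mQ d)
    (@integrableR_B _ T2 _ mu2 _ _ _ (mQ d) cuQ cWQ))).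
  apply: (@le_Rintegral _ T2) => //.
  - exact: (@integrableR_norm _ T2 _ mu2 _ _ (mQ d) (@integrableR_B _ T2 _ mu2 _ _ _ (mQ d) cuQ cWQ)).
  - exact: (@integrableR_Z _ T2 _ mu2 _ _ _ (mQ d) nQ).
  - by move=> z [Iz _]; rewrite -mulrBr normrM ler_wpM2r//; exact: cM.
have uWd : \int[mu2]_(z in I `*` layer s h d) `|u z - W z.1| <=
    d * \int[mu2]_(z in I `*` layer s h d) `|weak_deriv D e2 u z|.
  have f1 := @integrable_fin_num _ T2 _ mu2 _ (mQ d) _ (@integrableR_norm _ T2 _ mu2 _ _ (mQ d) uWQ).
  have f2 := @integrable_fin_num _ T2 _ mu2 _ (mQ d) _ (@integrableR_norm _ T2 _ mu2 _ _ (mQ d) ki).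
  by rewrite -lee_fin EFinM /Rintegral !fineK//; apply: uW.
rewrite -!mulrA ler_wpM2l//; apply: le_trans uWd _.
rewrite [leRHS]mulrA [leRHS]mulrC ler_pM2l//.
apply: (le_trans (abs_layer_le mD Dfin D_layer Lk mI _ dd0)) => //.
rewrite lebesgue_measure_itv/= lte_fin ab -EFinB/= ler_wpM2l ?sqrtr_ge0//.
rewrite ler_wsqrtr//.
have [mk fk] := Lk.
have k2 := @integrable_sqr _ T2 _ mu2 _ _ mk fk.
have k2Q := @integrableS _ T2 _ mu2 _ _ _ mD (mQ d) (QD dd) k2.
rewrite -lee_fin /Rintegral !fineK; last 2 first.
- exact: (@integrable_fin_num _ T2 _ mu2 _ mD _ k2).
- exact: (@integrable_fin_num _ T2 _ mu2 _ (mQ d) _ k2Q).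
apply: (@ge0_subset_integral _ T2) => //.
- exact: measurable_int k2.
- by move=> z _; rewrite lee_fin sqr_ge0.
- exact: QD.
Qed.

End edge_estimate.

(** * Open sets and the specimen *)

Section open_sets_of_the_plane.
Context {R : realType}.
Notation mu2 := (@lebesgue2 R).
Notation T1 := (measurableTypeR R).
Notation T2 := (T1 * T1)%type.

Lemma rat_itv_in_ball (x e : R) : 0 < e -> exists p q : rat,
  ratr p < x < ratr q /\ forall y, ratr p <= y <= ratr q -> ball x e y.
Proof.
move=> e0.
have [p] : exists p : rat, ratr p \in `](x - e), x[.
  by apply: rat_in_itvoo; rewrite ltrBlDr ltrDl.
have [q] : exists q : rat, ratr q \in `]x, (x + e)[.
  by apply: rat_in_itvoo; rewrite ltrDl.
rewrite !in_itv/= => /andP[xq qe] /andP[ep px]; exists p, q; rewrite px xq.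
split=> // y /andP[py yq]; rewrite /ball/= ltr_distlC (lt_le_trans ep)//.
exact: le_lt_trans yq qe.
Qed.

(** Closed boxes are required to lie in [U] so that cut-offs supported in them are admissible test
    functions; open boxes do the covering. *)
Lemma open_bigcup_boxes (U : set (R * R)) : open U ->
  exists p q s t : nat -> R,
    (forall n, `[p n, q n] `*` `[s n, t n] `<=` U) /\
    U = \bigcup_n (`]p n, q n[ `*` `]s n, t n[).
Proof.
move=> oU.
pose ok (c : rat * rat * rat * rat) := `[ratr c.1.1.1, ratr c.1.1.2]%classic `*`
  `[ratr c.1.2, ratr c.2]%classic `<=` U.
(* An empty box, since its left end 1 exceeds its right end 0: the filler for codes that yield no
   box inside [U]. *)
pose c0 : rat * rat * rat * rat := (1, 0, 0, 0).
pose f n : rat * rat * rat * rat :=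
  if unpickle n is Some c then if `[< ok c >] then c else c0 else c0.
have ok0 : ok c0.
  by move=> z [/=]; rewrite in_itv/= !(rmorph1, rmorph0) => /andP[/le_trans h /h]; rewrite ler10.
have okf n : ok (f n) by rewrite /f; case: unpickle => // c; case: asboolP.
exists (fun n => ratr (f n).1.1.1), (fun n => ratr (f n).1.1.2),
  (fun n => ratr (f n).1.2), (fun n => ratr (f n).2); split=> //.
apply/seteqP; split=> z; last first.
  move=> [n _ [/= z1 z2]]; apply: (okf n); split=> /=.
    exact: subset_itv_oo_cc z1.
  exact: subset_itv_oo_cc z2.
move=> Uz; have /nbhs_ballP[e /= e0 eU] : nbhs z U by exact: open_nbhs_nbhs.
have [p [q [pzq pq]]] := rat_itv_in_ball z.1 e0.
have [s [t [szt st]]] := rat_itv_in_ball z.2 e0.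
have okc : ok (p, q, s, t).
  move=> w [/= w1 w2]; apply: eU; split.
    by apply: pq; move: w1; rewrite in_itv.
  by apply: st; move: w2; rewrite in_itv.
exists (pickle (p, q, s, t)) => //.
by rewrite /f pickleK asboolT//=; split; rewrite /= in_itv.
Qed.

Lemma open_measurable2 (U : set (R * R)) : open U -> measurable U.
Proof.
move=> /open_bigcup_boxes[p [q [s [t [_ ->]]]]].
by apply: bigcup_measurable => n _; exact: measurable_rect.
Qed.

Lemma closed_measurable2 (U : set (R * R)) : closed U -> measurable U.
Proof.
by move=> cU; rewrite -(setCK U); apply: measurableC; apply: open_measurable2; rewrite openC.
Qed.

Lemma measurable_frontier (D : set (R * R)) : measurable (frontier D).
Proof.
apply: measurableD.
  by apply: closed_measurable2; exact: closed_closure.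
by apply: open_measurable2; exact: open_interior.
Qed.

End open_sets_of_the_plane.

(** * The fundamental lemma of the calculus of variations *)

Section zero_distribution.
Context {R : realType}.
Notation mu := (@lebesgue_measure R).
Notation mu2 := (@lebesgue2 R).
Notation T1 := (measurableTypeR R).
Notation T2 := (T1 * T1)%type.

(** The one-variable criterion is used twice: first in the height, for each of the countably many
    rational intervals in x1, and then in x1 at almost every height. *)
Lemma integral_abs_rect0 (f : R * R -> R) a b c e :
  mu2.-integrable setT (EFin \o f) ->
  (forall p q s t : R, a < p -> q < b -> c < s -> t < e ->
    \int[mu2]_z (f z * (\1_(`]p, q[%classic) z.1 * \1_(`]s, t[%classic) z.2)) = 0) ->
  (\int[mu2]_(z in `]a, b[ `*` `]c, e[) `|(f z)%:E| = 0)%E.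
Proof.
move=> fi f0.
have ind1 (p q y : R) : `|\1_(`]p, q[%classic) y : R| <= 1.
  by rewrite indicE; case: (_ \in _); rewrite ?normr1 ?normr0.
have mind p q : measurable_fun setT (\1_(`]p, q[%classic) : R -> R) by exact: measurable_indic.
have slice0 (p q : R) : a < p -> q < b ->
    {ae mu, forall y, c < y < e -> \int[mu]_(x in `]p, q[) f (x, y) = 0}.
  move=> ap qb.
  have gi := integrable_Rfubini2 (integrable_strip p q fi).
  have := ae_eq0_of_rat_itv gi; move=> /(_ c e) g0.
  apply: filterS (g0 _) => [y gy /gy <-|s t cs _ te].
    by rewrite Rintegral_indicr.
  rewrite Rintegral_indicr -(Rintegral_slice (integrable_strip p q fi) (mind _ _) (ind1 (ratr s) (ratr t))).
  rewrite -[RHS](f0 p q (ratr s) (ratr t))//.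
  by apply: eq_Rintegral => z _; rewrite /strip mulrA.
have slices : {ae mu, forall y, forall p q : rat, a < ratr p -> ratr q < b ->
    c < y < e -> \int[mu]_(x in `]ratr p, ratr q[) f (x, y) = 0}.
  pose P n y := if (unpickle n : option (rat * rat)) is Some pq then
    a < ratr pq.1 -> ratr pq.2 < b -> c < y < e ->
    \int[mu]_(x in `]ratr pq.1, ratr pq.2[) f (x, y) = 0 else True.
  have : {ae mu, forall y n, P n y}.
    apply: ae_foralln => n; rewrite /P; case: (unpickle n) => [[p q]|]; last exact: aeW.
    have [ap|ap] := ltP a (ratr p); last by apply: aeW => y /= h; move: ap; rewrite leNgt h.
    have [qb|qb] := ltP (ratr q) b; last by apply: aeW => y /= _ h; move: qb; rewrite leNgt h.
    by apply: filterS (slice0 _ _ ap qb) => y /= yy _ _; exact: yy.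
  apply: filterS => y Py p q; have := Py (pickle (p, q)).
  by rewrite /P pickleK.
have mf : measurable_fun setT f by move: fi => /measurable_int/measurable_EFinP.
have mabs : measurable_fun (`]a, b[%classic `*` `]c, e[%classic) (fun z => `|(f z)%:E|%E).
  by apply: measurable_funTS; apply/measurable_EFinP/measurableT_comp.
rewrite (@ge0_integral_rect2 _ _ T1 T1 _ mu mu (fun z => `|(f z)%:E|%E))//.
rewrite (@ge0_ae_eq_integral _ T1 _ mu _ _ (cst 0%E))//.
- by rewrite integral0.
- by apply: (@measurable_integral_rect2 _ _ T1 T1 _ mu (fun z => `|(f z)%:E|%E)) mabs _ _ _.
- by move=> y _; apply: integral_ge0.
apply: filterS2 slices (ae_integrable2 fi) => y fy fiy; rewrite /= in_itv/= => cye.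
apply: (@ae_eq_integral_abs _ T1 _ mu _ _ (fun x => (f (x, y))%:E) _).2 => //.
  by apply: measurable_funTS; exact: (@measurable_int _ T1 _ mu _ _ fiy).
have := ae_eq0_of_rat_itv fiy; move=> /(_ a b) f0y.
apply: filterS (f0y _) => [x fx|p q ap _ qb]; last exact: fy.
by rewrite /= in_itv/= => /fx ->.
Qed.

Variables (D : set (R * R)) (h : R * R -> R).
Hypotheses (oD : open D) (Dfin : (mu2 D < +oo)%E) (Lh : L2 D h).
Hypothesis h0 : forall phi, test_function D phi -> \int[mu2]_(z in D) (h z * phi z) = 0.

Let mD : measurable D := open_measurable2 oD.
Let hi : mu2.-integrable setT (EFin \o (h \_ D)).
Proof.
have [mh fh] := Lh; rewrite -restrict_EFin; apply: (@integrable_mkcond _ T2 _ mu2 D _ mD).1.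
exact: (@integrable_of_sqr _ T2 _ mu2 _ h).
Qed.

(** Smooth cut-offs supported in the closed box tend to the indicator of the open one, with
    dominated convergence. *)
Let box0 p q s t : `[p, q] `*` `[s, t] `<=` D ->
  \int[mu2]_z ((h \_ D) z * (\1_(`]p, q[%classic) z.1 * \1_(`]s, t[%classic) z.2)) = 0.
Proof.
move=> QD.
pose F n z := (h \_ D) z * tensor (cutoff p q n.+1%:R^-1) (cutoff s t n.+1%:R^-1) z.
have c1 u v w n : `|cutoff u v n.+1%:R^-1 w : R| <= 1.
  by rewrite ger0_norm ?cutoff_ge0 ?cutoff_le1.
have mc u v n : measurable_fun setT (cutoff u v n.+1%:R^-1 : R -> R).
  by apply: measurable_continuousR; apply: smooth1_continuous; exact: smooth1_cutoff.
have : \int[mu2]_z F n z @[n --> \oo] -->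
    \int[mu2]_z ((h \_ D) z * (\1_(`]p, q[%classic) z.1 * \1_(`]s, t[%classic) z.2)).
  apply: (@Rintegral_dominated_cvg _ T2 _ mu2 setT _ _ (fun z => `|(h \_ D) z|)) => //.
  - move=> n; apply: measurable_funM.
      by move: hi => /measurable_int/measurable_EFinP.
    by apply: measurable_funM; apply: measurableT_comp.
  - move=> z _; apply: cvgM; first exact: cvg_cst.
    by apply: cvgM; apply: cutoff_cvg => //; exact: cvg_harmonic.
  - exact: integrableR_norm.
  - move=> n z _; rewrite normrM ler_piMr// /tensor normrM -[leRHS]mulr1.
    exact: ler_pM.
have -> : (fun n => \int[mu2]_z F n z) = cst 0.
  apply/funext => n; rewrite /= -[RHS](h0 (test_function_tensor _ _ QD
    (fun x => @cutoff_out _ p q n.+1%:R^-1 x _) (fun y => @cutoff_out _ s t n.+1%:R^-1 y _)))//;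
    last 2 first.
  - exact: smooth1_cutoff.
  - exact: smooth1_cutoff.
  rewrite [RHS]Rintegral_mkcond; apply: eq_Rintegral => z _; rewrite /F !patchE.
  by case: ifP => // _; rewrite mul0r.
move/cvg_lim => /(_ (@Rhausdorff R)) <-; exact: lim_cst.
Qed.

(* Uniqueness of weak derivatives, needed because [weak_deriv] is an arbitrary choice. *)
Lemma L2_zero_distribution : \int[mu2]_(z in D) h z ^+ 2 = 0.
Proof.
have [p [q [s [t [boxD DE]]]]] := open_bigcup_boxes oD.
have neg n : mu2.-negligible [set z | (`]p n, q n[ `*` `]s n, t n[) z /\ h z != 0].
  have sub : `]p n, q n[ `*` `]s n, t n[ `<=` D by rewrite DE => z zQ; exists n.
  have : (\int[mu2]_(z in `]p n, q n[ `*` `]s n, t n[) `|((h \_ D) z)%:E| = 0)%E.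
    apply: integral_abs_rect0 => // p' q' s' t' pp qq ss tt; apply: box0.
    move=> z [/= z1 z2]; apply: (boxD n).
    move: z1 z2; rewrite /= !in_itv/= => /andP[z1l z1r] /andP[z2l z2r].
    split; apply/andP; split.
    - exact: le_trans (ltW pp) z1l.
    - exact: le_trans z1r (ltW qq).
    - exact: le_trans (ltW ss) z2l.
    - exact: le_trans z2r (ltW tt).
  have mh : measurable_fun (`]p n, q n[ `*` `]s n, t n[) (EFin \o (h \_ D)).
    by apply: measurable_funTS; move: hi => /measurable_int.
  have mQ : measurable (`]p n, q n[%classic `*` `]s n, t n[%classic : set (R * R)).
    exact: measurable_rect.
  move/(@ae_eq_integral_abs _ T2 _ mu2 _ mQ _ mh).1 => H.
  apply: negligibleS H => z [Qz hz] /= /(_ Qz) [].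
  by rewrite patchE mem_set; [move/eqP; rewrite (negbTE hz)|exact: sub].
have negD : mu2.-negligible [set z | D z /\ h z != 0].
  have := negligible_bigcup neg; apply: negligibleS => z [Dz hz].
  by move: (Dz); rewrite DE => -[n _ Qz]; exists n.
have [mh fh] := Lh.
rewrite /Rintegral (@ge0_ae_eq_integral _ T2 _ mu2 D _ (cst 0%E))//.
- by rewrite integral0.
- by apply/measurable_EFinP; exact: measurable_funX.
- by move=> z _; rewrite lee_fin sqr_ge0.
apply: negligibleS negD => z /= nz; apply: contrapT => nDz; apply: nz => Dz.
have [->|hz] := eqVneq (h z) 0; first by rewrite expr0n.
by exfalso; apply: nDz.
Qed.

End zero_distribution.

(** * Geometry of the specimen *)

Section specimen_geometry.
Context {R : realType}.
Notation mu := (@lebesgue_measure R).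
Notation mu2 := (@lebesgue2 R).

Lemma continuous_eucl_dist (f g : R * R -> R * R) : continuous f -> continuous g ->
  continuous (fun x => eucl_dist (f x) (g x)).
Proof.
move=> cf cg x; rewrite /eucl_dist.
have f1 : (f y).1 @[y --> x] --> (f x).1
  by apply: (@continuous_comp _ _ _ f fst x (cf x)); exact: continuous_fst.
have f2 : (f y).2 @[y --> x] --> (f x).2
  by apply: (@continuous_comp _ _ _ f snd x (cf x)); exact: continuous_snd.
have g1 : (g y).1 @[y --> x] --> (g x).1
  by apply: (@continuous_comp _ _ _ g fst x (cg x)); exact: continuous_fst.
have g2 : (g y).2 @[y --> x] --> (g x).2
  by apply: (@continuous_comp _ _ _ g snd x (cg x)); exact: continuous_snd.
apply: (@continuous_comp _ _ _ (fun x => ((f x).1 - (g x).1) ^+ 2 + ((f x).2 - (g x).2) ^+ 2));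
  last exact: sqrt_continuous.
by apply: cvgD; rewrite expr2; apply: cvgM; exact: cvgB.
Qed.

Variables a b theta l0 d rho : R.
Hypotheses (theta_gt0 : 0 < theta) (d_gt0 : 0 < d) (rho_gt0 : 0 < rho).
Hypothesis mouth : d + rho + theta <= b / 2.

Let D := specimen a b theta l0 d rho.

Lemma open_rounded_rectangle : open (rounded_rectangle a b theta).
Proof.
pose K := [set c : R * R | theta <= c.1 <= a - theta /\
  - (b / 2) + theta <= c.2 <= b / 2 - theta].
have -> : rounded_rectangle a b theta = \bigcup_(c in K) [set x | eucl_dist x c < theta].
  by apply/seteqP; split=> x [c]; [case=> c1 c2 xc; exists c|case=> c1 c2 xc; exists c].
apply: bigcup_open => c _.
apply: (@open_comp _ _ (fun x => eucl_dist x c) [set y | y < theta]); last exact: open_lt.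
by move=> x _; apply: continuous_eucl_dist => // y; [exact: cvg_id|exact: cvg_cst].
Qed.

Lemma closed_notch : closed (notch l0 d rho).
Proof.
have cle (f : R * R -> R) (c : R) : continuous f -> closed [set x | f x <= c].
  move=> cf; apply: (@preimage_closed _ _ f [set y | y <= c]); last exact: closed_le.
  by move=> x _; exact: cf.
have cge (f : R * R -> R) (c : R) : continuous f -> closed [set x | c <= f x].
  move=> cf; apply: (@preimage_closed _ _ f [set y | c <= y]); last exact: closed_ge.
  by move=> x _; exact: cf.
have cabs : continuous (fun x : R * R => `|x.2|).
  by move=> x; apply: cvg_norm; exact: continuous_snd.
apply: closedU; first apply: closedU.
- by apply: closedI; apply: cle => //; exact: continuous_fst.
- by apply: cle; apply: continuous_eucl_dist => // y; [exact: cvg_id|exact: cvg_cst].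
- rewrite (_ : [set x | _] = [set x | x.1 <= rho] `&` [set x | `|x.2| <= d + rho] `&`
    [set x | rho <= eucl_dist (x.1, `|x.2|) (rho, d + rho)]); last first.
    by apply/seteqP; split=> x [] => [x1 x2 x3|[x1 x2] x3]; split.
  apply: closedI; first by apply: closedI; apply: cle => //; exact: continuous_fst.
  apply: cge; apply: continuous_eucl_dist => x; last exact: cvg_cst.
  exact: (cvg_pair (@continuous_fst R x) (cabs x)).
Qed.

Lemma open_specimen : open D.
Proof.
by apply: openI; [exact: open_rounded_rectangle|rewrite openC; exact: closed_notch].
Qed.

Lemma specimen_bounds z : D z -> 0 < z.1 < a /\ - (b / 2) < z.2 < b / 2.
Proof.
move=> [[c [/andP[c1l c1r] /andP[c2l c2r] zc]] _].
have := le_lt_trans (eucl_dist_ge1 _ _) zc; have := le_lt_trans (eucl_dist_ge2 _ _) zc.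
rewrite !ltr_norml => /andP[? ?] /andP[? ?].
by split; apply/andP; split; lra.
Qed.

Lemma specimen_lty : (mu2 D < +oo)%E.
Proof.
have mI (p q : R) : measurable `]p, q[%classic by exact: measurable_itv.
apply: (@le_lt_trans _ _ (mu2 (`]0, a[%classic `*` `](- (b / 2)), (b / 2)[%classic))).
  apply: le_measure; rewrite ?inE; first exact: (open_measurable2 open_specimen).
    exact: measurable_rect.
  by move=> z /specimen_bounds; rewrite /= !in_itv.
by rewrite lebesgue2_rect// lte_mul_pinfty ?lebesgue_measure_bnd_lty// ge0_fin_numE ?lebesgue_measure_bnd_lty.
Qed.

(** A disc of radius [theta] centred directly below or above the point, at height [b / 2 - theta] in
    absolute value, shows that it is in the rounded rectangle. By [mouth] its height exceeds
    [d + rho], which bounds all three pieces of the notch. *)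
Lemma specimen_away_from_notch z : theta <= z.1 <= a - theta ->
  b / 2 - theta < `|z.2| < b / 2 -> D z.
Proof.
have t0 := theta_gt0; have dp := d_gt0; have rp := rho_gt0; have mo := mouth.
move=> z1 /andP[z2l z2r]; split.
  have [z20|z20] := leP 0 z.2.
    rewrite ger0_norm// in z2l z2r; exists (z.1, b / 2 - theta); split => //=.
      by apply/andP; split; lra.
    apply: le_lt_trans (eucl_dist_le _ _) _; rewrite /= subrr normr0 add0r.
    by rewrite ltr_norml; apply/andP; split; lra.
  rewrite ltr0_norm// in z2l z2r; exists (z.1, - (b / 2) + theta); split => //=.
    by apply/andP; split; lra.
  apply: le_lt_trans (eucl_dist_le _ _) _; rewrite /= subrr normr0 add0r.
  by rewrite ltr_norml; apply/andP; split; lra.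
move=> [[[_ ]|/=]|[_]].
- by move=> ?; lra.
- move=> h; have := le_trans (eucl_dist_ge2 _ _) h; rewrite subr0 => ?; lra.
- by move=> ? _; lra.
Qed.

Definition edge_height (s : bool) : R := if s then b / 2 else - (b / 2).

Lemma layer_specimen s : `]theta, (a - theta)[ `*` layer s (edge_height s) theta `<=` D.
Proof.
have t0 := theta_gt0; have dp := d_gt0; have rp := rho_gt0; have mo := mouth.
move=> z [/= + z2]; rewrite in_itv/= => /andP[z1l z1r].
apply: specimen_away_from_notch; first by rewrite !ltW.
by move: z2; rewrite /layer /edge_height; case: s; rewrite /= in_itv/= => /andP[? ?];
  [rewrite ger0_norm|rewrite ler0_norm]; try apply/andP; try split; lra.
Qed.

Lemma specimen_side s z : D z -> if s then z.2 < edge_height s else edge_height s < z.2.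
Proof. by case/specimen_bounds => _ /andP[? ?]; case: s. Qed.

(** The specimen lies strictly on one side of the edge, so the point is not in it; points of the
    layer straight below or above come arbitrarily close. *)
Lemma edge_frontier s x1 : theta <= x1 <= a - theta -> frontier D (x1, edge_height s).
Proof.
have t0 := theta_gt0; have dp := d_gt0; have rp := rho_gt0; have mo := mouth.
move=> x1I; split; last first.
  by move=> /interior_subset /specimen_bounds[_]; rewrite /edge_height; case: s => /=; rewrite ltxx ?andbF.
move=> U /nbhs_ballP[e /= e0 eU].
pose m := Num.min e theta / 2.
have : 0 < Num.min e theta by rewrite lt_min e0.
have : Num.min e theta <= e by rewrite ge_min lexx.
have : Num.min e theta <= theta by rewrite ge_min lexx orbT.
rewrite {}/m; set m := Num.min e theta => mt me m0.
pose y := if s then b / 2 - m / 2 else - (b / 2) + m / 2.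
exists (x1, y); split.
  apply: specimen_away_from_notch => //; rewrite /y; case: (s) => /=;
    [rewrite ger0_norm|rewrite ler0_norm]; try apply/andP; try split; lra.
apply: eU; split => /=; first exact: ballxx.
rewrite /ball/= /y /edge_height; case: (s); rewrite ltr_norml; apply/andP; split; lra.
Qed.

End specimen_geometry.

(** * Layer and edge functionals *)

Section H1_norm.
Context {R : realType}.
Notation mu2 := (@lebesgue2 R).
Notation T1 := (measurableTypeR R).
Notation T2 := (T1 * T1)%type.
Variable D : set (R * R).

Let sqr_ge0 (u : R * R -> R) : 0 <= \int[mu2]_(z in D) (u z ^+ 2).
Proof. by apply: Rintegral_ge0 => z _; exact: sqr_ge0. Qed.

Lemma L2_norm_le_H1norm (w : R * R -> R * R) :
  Num.sqrt (\int[mu2]_(z in D) ((w z).2 ^+ 2)) <= H1norm D w.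
Proof.
rewrite /H1norm ler_wsqrtr// /sobolev1_sqnorm/= -[leLHS]add0r.
apply: lerD; first by rewrite !addr_ge0.
by rewrite -addrA lerDl addr_ge0.
Qed.

Lemma weak_deriv_norm_le_H1norm (w : R * R -> R * R) :
  Num.sqrt (\int[mu2]_(z in D) (weak_deriv D e2 (snd \o w) z ^+ 2)) <= H1norm D w.
Proof.
rewrite /H1norm ler_wsqrtr// /sobolev1_sqnorm/= -[leLHS]add0r.
apply: lerD; first by rewrite !addr_ge0.
by rewrite lerDr addr_ge0.
Qed.

End H1_norm.

Section edge_functionals.
Context {R : realType}.
Notation mu := (@lebesgue_measure R).
Notation mu2 := (@lebesgue2 R).
Notation T1 := (measurableTypeR R).
Notation T2 := (T1 * T1)%type.
Variables a b theta l0 d rho : R.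
Hypotheses (theta_gt0 : 0 < theta) (d_gt0 : 0 < d) (rho_gt0 : 0 < rho).
Hypotheses (theta_a : theta < a - theta) (mouth : d + rho + theta <= b / 2).

Let D := specimen a b theta l0 d rho.
Let I := `]theta, (a - theta)[%classic.
Let mD : measurable D := open_measurable2 (@open_specimen R a b theta l0 d rho).
Let Dfin : (mu2 D < +oo)%E := @specimen_lty R a b theta l0 d rho.
Let mI : measurable I := measurable_itv _.

Definition layer_sign (delta : R) (z : R * R) : R :=
  \1_(top_layer a b theta delta) z - \1_(bottom_layer a b theta delta) z.

(** The density [c] stands for the load at a frozen time. Keeping it arbitrary lets the same bounds
    apply to differences of loads at two times. *)
Definition layer_pairing (delta : R) (c : R -> R) (w : R * R -> R * R) : R :=
  \int[mu2]_(z in D) (delta^-1 * c z.1 * layer_sign delta z * (w z).2).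

Definition edge_pairing (c : R -> R) (w : R * R -> R * R) : R :=
  \int[mu]_(x in I) (c x * trace D (snd \o w) (x, b / 2)) -
  \int[mu]_(x in I) (c x * trace D (snd \o w) (x, - (b / 2))).

Lemma top_layerE delta : top_layer a b theta delta = I `*` layer true (b / 2) delta.
Proof. by apply/seteqP; split=> z; rewrite /top_layer /layer /I/= !in_itv. Qed.

Lemma bottom_layerE delta :
  bottom_layer a b theta delta = I `*` layer false (- (b / 2)) delta.
Proof. by apply/seteqP; split=> z; rewrite /bottom_layer /layer /I/= !in_itv. Qed.

Lemma measurable_layer_sign delta : measurable_fun setT (layer_sign delta).
Proof.
rewrite /layer_sign top_layerE bottom_layerE; apply: measurable_funB;
  by apply: measurable_indic; apply: measurable_rect => //; exact: measurable_layer.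
Qed.

Lemma layer_sign_le1 delta z : `|layer_sign delta z| <= 1.
Proof.
rewrite /layer_sign !indicE; case: (_ \in _); case: (_ \in _);
  by rewrite ?subrr ?subr0 ?sub0r ?normrN ?normr0 ?normr1.
Qed.

Variables (c : R -> R) (M : R).
Hypotheses (mc : measurable_fun setT c) (cM : forall x, `|c x| <= M).

Let M0 : 0 <= M. Proof. exact: le_trans (cM 0). Qed.

Let w2i (w : R * R -> R * R) : H1field D w -> mu2.-integrable D (EFin \o (snd \o w)).
Proof. by move=> [_ [[mw fw] _ _]]; exact: (@integrable_of_sqr _ T2 _ mu2). Qed.

Let mq delta : measurable_fun D (fun z => delta^-1 * c z.1 * layer_sign delta z).
Proof.
apply: measurable_funTS; apply: measurable_funM; last exact: measurable_layer_sign.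
apply: measurable_funM; first exact: measurable_cst.
by apply: measurableT_comp => //; exact: measurable_fst.
Qed.

Let qM (delta : R) z : 0 < delta -> `|delta^-1 * c z.1 * layer_sign delta z| <= delta^-1 * M.
Proof.
move=> d0; rewrite !normrM -[leRHS]mulr1 ler_pM ?layer_sign_le1//.
by rewrite ger0_norm ?ler_wpM2l// ltW// invr_gt0.
Qed.

Lemma integrable_layer_pairing (delta : R) w : 0 < delta -> H1field D w ->
  mu2.-integrable D (EFin \o (fun z => delta^-1 * c z.1 * layer_sign delta z * (w z).2)).
Proof.
move=> d0 wD.
have -> : (fun z => delta^-1 * c z.1 * layer_sign delta z * (w z).2) =
  (fun z => (w z).2 * (delta^-1 * c z.1 * layer_sign delta z)).
  by apply/funext => z; rewrite mulrC.
apply: (@integrable_boundedM _ T2 _ mu2 D _ _ (delta^-1 * M)) => //.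
- exact: mq.
- by move=> z _; exact: qM.
- exact: w2i.
Qed.

Lemma layer_pairing_le (delta : R) w : 0 < delta -> H1field D w ->
  `|layer_pairing delta c w| <=
  delta^-1 * M * Num.sqrt (fine (mu2 D)) * H1norm D w.
Proof.
move=> d0 wD.
have ii := integrable_layer_pairing d0 wD.
apply: le_trans (@le_normr_Rintegral _ T2 _ mu2 _ _ mD ii) _.
apply: (@le_trans _ _ (\int[mu2]_(z in D) (delta^-1 * M * `|(w z).2|))).
  apply: (@le_Rintegral _ T2) => //.
  - exact: (@integrableR_norm _ T2 _ mu2 _ _ mD ii).
  - exact: (@integrableR_Z _ T2 _ mu2 _ _ _ mD (@integrableR_norm _ T2 _ mu2 _ _ mD (w2i wD))).
  - by move=> z _; rewrite normrM ler_wpM2r// qM.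
rewrite (@RintegralZl _ T2)//; last exact: (@integrableR_norm _ T2 _ mu2 _ _ mD (w2i wD)).
rewrite -!mulrA ler_wpM2l ?invr_ge0 ?(ltW d0)// ler_wpM2l//.
have [_ [[mw fw] _ _]] := wD.
apply: le_trans (@Rintegral_norm_le_sqrt _ T2 _ mu2 _ _ mD Dfin mw fw) _.
by rewrite ler_wpM2l ?sqrtr_ge0// L2_norm_le_H1norm.
Qed.

(** Up to thickness [theta] both layers lie in the specimen; thicker ones may run into the notch. *)
Lemma layer_pairing_split delta w : 0 < delta <= theta -> H1field D w ->
  layer_pairing delta c w =
  delta^-1 * \int[mu2]_(z in I `*` layer true (b / 2) delta) (c z.1 * (w z).2) -
  delta^-1 * \int[mu2]_(z in I `*` layer false (- (b / 2)) delta) (c z.1 * (w z).2).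
Proof.
move=> /andP[d0 dt] wD.
have sub s : I `*` layer s (edge_height b s) delta `<=` D.
  move=> z [z1 z2]; apply: (layer_specimen l0 theta_gt0 d_gt0 rho_gt0 mouth (s := s)).
  by split => //; exact: le_layer z2.
have ci : mu2.-integrable D (EFin \o (fun z => c z.1 * (w z).2)).
  have -> : (fun z => c z.1 * (w z).2) = (fun z => (w z).2 * c z.1).
    by apply/funext => z; rewrite mulrC.
  apply: (@integrable_boundedM _ T2 _ mu2 D _ _ M) => //; last exact: w2i.
  by apply/measurable_funTS/measurableT_comp => //; exact: measurable_fst.
have restr s : \int[mu2]_(z in I `*` layer s (edge_height b s) delta) (c z.1 * (w z).2) =
    \int[mu2]_(z in D) (c z.1 * (w z).2 * \1_(I `*` layer s (edge_height b s) delta) z).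
  rewrite Rintegral_indicr [RHS]Rintegral_indicr; apply: eq_Rintegral => z _.
  rewrite !indicE -[RHS]mulrA; congr (_ * _).
  case: (boolP (z \in I `*` _)) => [/set_mem/sub Dz|_]; last by rewrite mul0r.
  by rewrite (mem_set Dz) mulr1.
have indi s : mu2.-integrable D
    (EFin \o (fun z => c z.1 * (w z).2 * \1_(I `*` layer s (edge_height b s) delta) z)).
  apply: (@integrable_boundedM _ T2 _ mu2 D _ _ 1) => //.
    apply/measurable_funTS; apply: (@measurable_indic _ T2 R _ (I `*` layer s _ delta)).
    by apply: measurable_rect => //; exact: measurable_layer.
  by move=> z _; rewrite indicE; case: (_ \in _); rewrite ?normr1 ?normr0.
rewrite (restr true) (restr false).
rewrite -(@RintegralZl _ T2 _ mu2 _ _ _ mD (indi true)).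
rewrite -(@RintegralZl _ T2 _ mu2 _ _ _ mD (indi false)).
rewrite -(@RintegralB _ T2 _ mu2 _ _ _ mD (@integrableR_Z _ T2 _ mu2 _ _ _ mD (indi true))
  (@integrableR_Z _ T2 _ mu2 _ _ _ mD (indi false))).
apply: eq_Rintegral => z _.
rewrite /layer_sign top_layerE bottom_layerE /edge_height -mulrBr -!mulrA -mulrBr.
by rewrite -mulrBr ![_ * (w z).2]mulrC.
Qed.

(** The factor 2 counts the two edges. *)
Lemma layer_pairing_cvg_rate delta w : 0 < delta <= theta -> H1field D w ->
  `|layer_pairing delta c w - edge_pairing c w| <=
  2 * M * Num.sqrt ((a - theta - theta) * delta) * H1norm D w.
Proof.
have comb (x p y q K : R) : `|x - p| <= K -> `|y - q| <= K -> `|x - y - (p - q)| <= K + K.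
  move=> xp yq; have -> : x - y - (p - q) = (x - p) - (y - q) by lra.
  exact: le_trans (ler_normB _ _) (lerD xp yq).
move=> dd wD; rewrite (layer_pairing_split dd wD).
have est s := edge_trace_estimate mD Dfin theta_gt0 theta_a
  (layer_specimen l0 theta_gt0 d_gt0 rho_gt0 mouth (s := s))
  (@specimen_side R a b theta l0 d rho s) wD.2.
have mcI : measurable_fun I c by exact: measurable_funTS.
have cMI x : I x -> `|c x| <= M by [].
have E1 := (est true).2 c M delta mcI cMI dd.
have E2 := (est false).2 c M delta mcI cMI dd.
have N : M * Num.sqrt ((a - theta - theta) * delta) *
    Num.sqrt (\int[mu2]_(z in D) (weak_deriv D e2 (snd \o w) z ^+ 2)) <=
    M * Num.sqrt ((a - theta - theta) * delta) * H1norm D w.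
  by rewrite ler_wpM2l ?weak_deriv_norm_le_H1norm// mulr_ge0// sqrtr_ge0.
apply: le_trans (comb _ _ _ _ _ (le_trans E1 N) (le_trans E2 N)) _.
by rewrite -mulr2n -!mulrA mulr_natl.
Qed.

End edge_functionals.

Section edge_functional.
Context {R : realType}.
Notation mu := (@lebesgue_measure R).
Notation mu2 := (@lebesgue2 R).
Notation T1 := (measurableTypeR R).
Notation T2 := (T1 * T1)%type.
Variables a b theta l0 d rho : R.
Hypotheses (theta_gt0 : 0 < theta) (d_gt0 : 0 < d) (rho_gt0 : 0 < rho).
Hypotheses (theta_a : theta < a - theta) (mouth : d + rho + theta <= b / 2).

Let D := specimen a b theta l0 d rho.
Let mD : measurable D := open_measurable2 (@open_specimen R a b theta l0 d rho).
Let LP := @layer_pairing R a b theta l0 d rho.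

(* As a limit of layer pairings it is linear without any appeal to the linearity of
   traces. *)
Definition edge_functional (c : R -> R) (w : R * R -> R * R) : R :=
  lim (LP (theta / n.+1%:R) c w @[n --> \oo]).

(** The first term is the crude bound for a layer of thickness at least [theta]. Comparing the edge
    with the layer of thickness exactly [theta] adds 2 square roots, and returning from the edge to
    a thinner layer adds 2 more, whence the 4. *)
Definition pairing_bound : R := theta^-1 * Num.sqrt (fine (mu2 D)) +
  4 * Num.sqrt ((a - theta - theta) * theta).

Lemma pairing_bound_gt0 : 0 < pairing_bound.
Proof.
rewrite ltr_wpDl ?mulr_ge0 ?invr_ge0 ?(ltW theta_gt0) ?sqrtr_ge0//.
by rewrite mulr_gt0// sqrtr_gt0 mulr_gt0// subr_gt0.
Qed.

Let delta_gt0 n : 0 < theta / n.+1%:R. Proof. by rewrite divr_gt0. Qed.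

Let delta_bounds n : 0 < theta / n.+1%:R <= theta.
Proof. by rewrite delta_gt0 ler_pdivrMr// ler_peMr ?ler1n// ltW. Qed.

Section bounded_density.
Variables (c : R -> R) (M : R).
Hypotheses (mc : measurable_fun setT c) (cM : forall x, `|c x| <= M).

Let M0 : 0 <= M. Proof. exact: le_trans (cM 0). Qed.

Lemma layer_pairing_linear delta k u v : 0 < delta -> H1field D u -> H1field D v ->
  LP delta c (k *: u + v) = k * LP delta c u + LP delta c v.
Proof.
move=> delta0 uD vD.
have iu := integrable_layer_pairing mc cM delta0 uD.
have iv := integrable_layer_pairing mc cM delta0 vD.
rewrite /LP /layer_pairing -(@RintegralZl _ T2 _ mu2 _ _ _ mD iu).
rewrite -(@RintegralD _ T2 _ mu2 _ _ _ mD (@integrableR_Z _ T2 _ mu2 _ _ _ mD iu) iv).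
apply: eq_Rintegral => z _ /=.
by rewrite mulrDr mulrCA.
Qed.

Lemma cvg_layer_pairing w : H1field D w ->
  LP (theta / n.+1%:R) c w @[n --> \oo] --> edge_pairing a b theta l0 d rho c w.
Proof.
move=> wD; apply/cvgrPdist_le => e e0.
pose K := 2 * M * H1norm D w.
have K0 : 0 <= K by rewrite !mulr_ge0// sqrtr_ge0.
have cv : (a - theta - theta) * (theta / n.+1%:R) @[n --> \oo] --> (0 : R).
  rewrite -[X in _ --> X](mulr0 (a - theta - theta)); apply: cvgM; first exact: cvg_cst.
  rewrite -[X in _ --> X](mulr0 theta); apply: cvgM; first exact: cvg_cst.
  exact: cvg_harmonic.
have cs : Num.sqrt ((a - theta - theta) * (theta / n.+1%:R)) @[n --> \oo] --> (0 : R).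
  rewrite -[X in _ --> X]sqrtr0.
  by apply: (cvg_comp _ _ cv); exact: sqrt_continuous.
have : K * Num.sqrt ((a - theta - theta) * (theta / n.+1%:R)) @[n --> \oo] --> (0 : R).
  by rewrite -[X in _ --> X](mulr0 K); apply: cvgM => //; exact: cvg_cst.
move=> /cvgr_lt/(_ _ e0); apply: filterS => n /ltW; apply: le_trans.
rewrite distrC; apply: le_trans
  (layer_pairing_cvg_rate theta_gt0 d_gt0 rho_gt0 theta_a mouth mc cM (delta_bounds n) wD) _.
by rewrite /K mulrAC.
Qed.

Lemma edge_functionalE w : H1field D w ->
  edge_functional c w = edge_pairing a b theta l0 d rho c w.
Proof. by move=> wD; apply: cvg_lim => //; exact: cvg_layer_pairing. Qed.

Lemma cvg_edge_functional w : H1field D w ->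
  LP (theta / n.+1%:R) c w @[n --> \oo] --> edge_functional c w.
Proof. by move=> wD; rewrite edge_functionalE//; exact: cvg_layer_pairing. Qed.

Lemma edge_functional_rate delta w : 0 < delta <= theta -> H1field D w ->
  `|LP delta c w - edge_functional c w| <=
  2 * M * Num.sqrt ((a - theta - theta) * delta) * H1norm D w.
Proof.
by move=> dd wD; rewrite edge_functionalE//; exact: layer_pairing_cvg_rate.
Qed.

Lemma edge_functional_linear k u v : H1field D u -> H1field D v ->
  edge_functional c (k *: u + v) = k * edge_functional c u + edge_functional c v.
Proof.
move=> uD vD; apply: cvg_lim => //.
under eq_cvg do rewrite layer_pairing_linear//.
apply: cvgD; last exact: cvg_edge_functional.
by apply: cvgM; [exact: cvg_cst|exact: cvg_edge_functional].
Qed.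

Let rate_theta w : H1field D w -> `|LP theta c w - edge_functional c w| <=
  2 * Num.sqrt ((a - theta - theta) * theta) * M * H1norm D w.
Proof.
move=> wD; rewrite [_ * M]mulrAC; apply: edge_functional_rate => //.
by rewrite theta_gt0 lexx.
Qed.

(** Comparison with the single layer of thickness [theta]. The factor 2 is kept here so that the
    passage to thin layers ends with the 4 of [pairing_bound]. *)
Let edge_functional_le' w : H1field D w -> `|edge_functional c w| <=
  (theta^-1 * Num.sqrt (fine (mu2 D)) + 2 * Num.sqrt ((a - theta - theta) * theta)) *
  M * H1norm D w.
Proof.
move=> wD; rewrite mulrDl mulrDl [theta^-1 * _ * M]mulrAC.
apply: le_trans (lerD (layer_pairing_le mc cM theta_gt0 wD) (rate_theta wD)).
by apply: le_trans (ler_normB _ _); rewrite opprB addrCA subrr addr0.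
Qed.

Lemma edge_functional_le w : H1field D w ->
  `|edge_functional c w| <= pairing_bound * M * H1norm D w.
Proof.
move=> wD; apply: le_trans (edge_functional_le' wD) _.
rewrite ler_wpM2r ?sqrtr_ge0// ler_wpM2r// lerD2l ler_wpM2r ?sqrtr_ge0//.
by rewrite ler_nat.
Qed.

Lemma layer_pairing_uniform_le delta w : 0 < delta -> H1field D w ->
  `|LP delta c w| <= pairing_bound * M * H1norm D w.
Proof.
move=> delta0 wD.
have N0 : 0 <= H1norm D w by exact: sqrtr_ge0.
have [dt|dt] := leP delta theta; last first.
  apply: le_trans (layer_pairing_le mc cM delta0 wD) _.
  rewrite ler_wpM2r// mulrAC ler_wpM2r//.
  apply: (@le_trans _ _ (theta^-1 * Num.sqrt (fine (mu2 D)))).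
    by rewrite ler_wpM2r ?sqrtr_ge0// lef_pV2 ?posrE// ltW.
  by rewrite lerDl mulr_ge0// sqrtr_ge0.
have dd : 0 < delta <= theta by rewrite delta0.
have -> : LP delta c w = (LP delta c w - edge_functional c w) + edge_functional c w.
  by rewrite subrK.
apply: le_trans (ler_normD _ _) _.
apply: le_trans (lerD (edge_functional_rate dd wD) (edge_functional_le' wD)) _.
rewrite -mulrDl ler_wpM2r// [2 * M]mulrC -mulrA [M * _]mulrC -mulrDl ler_wpM2r//.
rewrite addrC -addrA lerD2l.
have : Num.sqrt ((a - theta - theta) * delta) <= Num.sqrt ((a - theta - theta) * theta).
  by rewrite ler_wsqrtr// ler_wpM2l// subr_ge0 ltW.
move=> h; have -> : (4 : R) = 2 + 2 by rewrite -natrD.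
by rewrite [leRHS]mulrDl lerD2l ler_wpM2l.
Qed.

End bounded_density.

Lemma layer_pairingB (delta : R) (c c' : R -> R) (M M' : R) w : 0 < delta ->
  measurable_fun setT c -> (forall x, `|c x| <= M) ->
  measurable_fun setT c' -> (forall x, `|c' x| <= M') -> H1field D w ->
  LP delta (fun x => c x - c' x) w = LP delta c w - LP delta c' w.
Proof.
move=> delta0 mc cM mc' cM' wD.
have i1 := integrable_layer_pairing mc cM delta0 wD.
have i2 := integrable_layer_pairing mc' cM' delta0 wD.
rewrite /LP /layer_pairing -(@RintegralB _ T2 _ mu2 _ _ _ mD i1 i2).
by apply: eq_Rintegral => z _; rewrite -[in RHS]mulrBl -[in RHS]mulrBl -mulrBr.
Qed.

(** Additivity in the density converts a uniform bound on the functional into continuity in time. *)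
Lemma edge_functionalB (c c' : R -> R) (M M' : R) w :
  measurable_fun setT c -> (forall x, `|c x| <= M) ->
  measurable_fun setT c' -> (forall x, `|c' x| <= M') -> H1field D w ->
  edge_functional (fun x => c x - c' x) w = edge_functional c w - edge_functional c' w.
Proof.
move=> mc cM mc' cM' wD; apply: cvg_lim => //.
have : LP (theta / n.+1%:R) c w - LP (theta / n.+1%:R) c' w @[n --> \oo] -->
    edge_functional c w - edge_functional c' w.
  by apply: cvgB; [exact: (cvg_edge_functional mc cM)|exact: (cvg_edge_functional mc' cM')].
apply: cvg_trans; apply: near_eq_cvg; apply: nearW => n.
by rewrite (layer_pairingB (delta_gt0 n) mc cM mc' cM' wD).
Qed.

End edge_functional.

(** * The dual norm and the zero field *)

Section dual_norm.
Context {R : realType}.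
Notation mu2 := (@lebesgue2 R).
Notation T1 := (measurableTypeR R).
Notation T2 := (T1 * T1)%type.
Variable D : set (R * R).
Hypotheses (oD : open D) (Dfin : (mu2 D < +oo)%E).

Let zero : R * R -> R := fun=> 0.

Let integral0R (f : R * R -> R) : (forall z, f z = 0) -> \int[mu2]_(z in D) f z = 0.
Proof.
move=> f0; rewrite (@eq_Rintegral _ T2 _ mu2 D (cst 0)) => [|z _]; last exact: f0.
by rewrite Rintegral_cst ?mul0r//; exact: open_measurable2.
Qed.

Let L2_zero : L2 D zero.
Proof.
split; first exact: measurable_cst.
by rewrite /zero expr0n/= integral0 ltry.
Qed.

Let weak_deriv_zero v : is_weak_deriv D v zero zero.
Proof.
by move=> phi _; rewrite /zero !integral0R ?oppr0// => z; rewrite mul0r.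
Qed.

(** The chosen weak derivative of 0 need not be the zero function, but it annihilates all test
    functions, so its square integrates to 0. *)
Let sqnorm_zero : sobolev1_sqnorm D zero = 0.
Proof.
have sq0 v : \int[mu2]_(z in D) (weak_deriv D v zero z ^+ 2) = 0.
  have [Lh hh] := weak_derivP (ex_intro2 _ _ zero L2_zero (weak_deriv_zero v)).
  apply: L2_zero_distribution => // phi tphi.
  apply: oppr_inj; rewrite oppr0 -(hh _ tphi).
  by apply: integral0R => z; rewrite mul0r.
by rewrite /sobolev1_sqnorm [X in _ + X + _](sq0 e1) [X in _ + X](sq0 e2) !addr0; apply: integral0R => z; rewrite expr0n.
Qed.

Lemma H1dot0 : H1dot D 0.
Proof.
have s0 : sobolev1 D zero by split; [exact: L2_zero| |]; exists zero.
split=> // Omega c; apply: integral0R => z.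
by rewrite /dot/= !mul0r addr0.
Qed.

Lemma H1norm0 : H1norm D 0 = 0.
Proof. by rewrite /H1norm (_ : fst \o 0 = zero)// (_ : snd \o 0 = zero)// sqnorm_zero addr0 sqrtr0. Qed.

(* The zero field keeps the supremum from being over the empty set, where it is -oo. *)
Lemma H1dual_norm_ge0 F : (0 <= H1dual_norm D F)%E.
Proof.
apply: (@le_trans _ _ `|F 0|%:E); first by rewrite lee_fin.
apply: ereal_sup_ubound; exists 0 => //; split; first exact: H1dot0.
by rewrite H1norm0.
Qed.

Lemma H1dual_norm_le F (e : R) : 0 <= e ->
  (forall w, H1dot D w -> `|F w| <= e * H1norm D w) -> (H1dual_norm D F <= e%:E)%E.
Proof.
move=> e0 Fe; apply: ge_ereal_sup => _ [w [wD w1] <-].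
rewrite lee_fin; apply: le_trans (Fe _ wD) _.
by rewrite -[leRHS]mulr1 ler_wpM2l.
Qed.

End dual_norm.

(* The integral of a nonnegative function is a supremum over simple functions, hence
   monotone without any measurability. *)
Lemma ge0_le_integral_nomeas d (T : measurableType d) (R : realType)
    (mu : {measure set T -> \bar R}) (D : set T) (f1 f2 : T -> \bar R) :
  (forall x, D x -> 0 <= f1 x)%E -> (forall x, D x -> f1 x <= f2 x)%E ->
  (\int[mu]_(x in D) f1 x <= \int[mu]_(x in D) f2 x)%E.
Proof.
move=> f10 f12; rewrite [leLHS]integral_mkcond [leRHS]integral_mkcond.
have h1 x : (0 <= (f1 \_ D) x)%E by apply: erestrict_ge0.
have h12 x : ((f1 \_ D) x <= (f2 \_ D) x)%E by exact: lee_restrict.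
have h2 x : (0 <= (f2 \_ D) x)%E by exact: le_trans (h12 x).
rewrite !ge0_integralTE//; apply: ereal_sup_le => _ [h /= hf <-].
by exists h => // x; exact: le_trans (h12 x).
Qed.

(** * Bochner measurability of bounded continuous families *)

Section bochner.
Context {R : realType}.
Notation mu := (@lebesgue_measure R).
Notation mu2 := (@lebesgue2 R).
Notation field := (R * R -> R * R).
Variables (D : set (R * R)) (T C : R) (F : R -> field -> R).
Hypotheses (oD : open D) (Dfin : (mu2 D < +oo)%E) (T_gt0 : 0 < T) (C_ge0 : 0 <= C).
Hypothesis F_linear : forall t : R, 0 <= t <= T -> forall c u v, H1dot D u -> H1dot D v ->
  F t (c *: u + v) = c * F t u + F t v.
Hypothesis F_bounded : forall t : R, 0 <= t <= T -> forall w, H1dot D w ->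
  `|F t w| <= C * H1norm D w.
Hypothesis F_continuous : forall t : R, 0 <= t <= T -> forall e : R, 0 < e ->
  exists2 eta : R, 0 < eta & forall t' : R, 0 <= t' <= T -> `|t - t'| < eta ->
  forall w, H1dot D w -> `|F t' w - F t w| <= e * H1norm D w.

Let F_dual (t : R) : 0 <= t <= T -> H1dual D (F t).
Proof.
move=> tT; split; first exact: F_linear.
by exists C => w wD; exact: F_bounded.
Qed.

Let h n := T / n.+1%:R.
Let h_gt0 n : 0 < h n. Proof. by rewrite /h divr_gt0. Qed.

Let cell n i : set R := `[h n * i%:R, h n * i.+1%:R[%classic.

Let indic_cell n i (t : R) : 0 <= t -> (\1_(cell n i) t : R) = (Num.truncn (t / h n) == i)%:R.
Proof.
move=> t0; have th0 : 0 <= t / h n by rewrite divr_ge0 ?(ltW (h_gt0 n)).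
rewrite truncn_eq// indicE; congr (_%:R).
rewrite ler_pdivlMr// ltr_pdivrMr// [_ * h n]mulrC [_ * h n]mulrC.
by congr nat_of_bool; apply/idP/idP => [/set_mem|tin]; [|apply/mem_set; move: tin]; rewrite /cell/= in_itv.
Qed.

(** Samples of [F] on the grid of mesh [T / (n + 1)]. Cells are closed on the left only, so the
    extra cell number [n + 1], starting at [T], is there to cover [t = T]; every node still lies in
    [[0, T]]. *)
Let s n t w := \sum_(i < n.+2) \1_(cell n i) t * F (h n * i%:R) w.

Let node n (i : 'I_n.+2) : 0 <= h n * i%:R <= T.
Proof.
rewrite mulr_ge0 ?(ltW (h_gt0 n))//= /h mulrAC ler_pdivrMr// ler_wpM2l ?(ltW T_gt0)//.
by rewrite ler_nat -ltnS.
Qed.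

Let s_node n (t : R) : 0 <= t <= T -> exists2 i : 'I_n.+2,
  `|t - h n * i%:R| <= h n & forall w, s n t w = F (h n * i%:R) w.
Proof.
move=> /andP[t0 tT].
have th0 : 0 <= t / h n by rewrite divr_ge0 ?(ltW (h_gt0 n)).
have /andP[il ir] := truncn_itv th0.
have iN : (Num.truncn (t / h n) < n.+2)%N.
  rewrite ltnS -(ler_nat R); apply: le_trans il _.
  by rewrite ler_pdivrMr// /h mulrC divfK// pnatr_eq0.
exists (Ordinal iN) => /=.
  rewrite ler_pdivlMr// in il; rewrite ltr_pdivrMr// -natr1 mulrDl mul1r in ir.
  rewrite ger0_norm ?subr_ge0 mulrC// lerBlDl; exact: ltW.
move=> w; rewrite /s (bigD1 (Ordinal iN))//= indic_cell// eqxx mul1r big1 ?addr0// => i iN'.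
rewrite indic_cell// [_ == _](_ : _ = false) ?mul0r//.
by apply/negP => /eqP ti; move: iN'; rewrite -val_eqE/= ti eqxx.
Qed.

Let s_simple n : simple_H1dual D (s n).
Proof.
exists n.+2, (fun i => cell n i), (fun i => F (h n * i%:R)); split=> //.
  by move=> i; exact: measurable_itv.
by move=> i; exact/F_dual/node.
Qed.

Let s_cvg (t : R) : 0 <= t <= T -> H1dual_norm D (s n t - F t) @[n --> \oo] --> 0%E.
Proof.
move=> tT.
have small (e : R) : 0 < e -> \forall n \near \oo, (H1dual_norm D (s n t - F t)%R <= e%:E)%E.
  move=> e0; have [eta eta0 Feta] := F_continuous tT e0.
  have hc : h n @[n --> \oo] --> (0 : R).
    rewrite -[X in _ --> X](mulr0 T); apply: cvgM; first exact: cvg_cst.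
    exact: cvg_harmonic.
  move/cvgr_lt: hc => /(_ _ eta0); apply: filterS => n hn.
  apply: H1dual_norm_le; first exact: ltW.
  move=> w wD; have [i ti si] := s_node n tT.
  have -> : (s n t - F t) w = F (h n * i%:R) w - F t w by rewrite -si.
  by apply: Feta => //; exact: le_lt_trans ti hn.
have ge0 n : (0 <= H1dual_norm D (s n t - F t)%R)%E by exact: H1dual_norm_ge0.
apply/fine_cvgP; split.
  apply: filterS (small _ ltr01) => n n1; rewrite ge0_fin_numE//.
  by apply: le_lt_trans n1 _; rewrite ltry.
apply/cvgr0Pnorm_le => e e0; apply: filterS (small _ e0) => n ne.
rewrite ger0_norm ?fine_ge0// -lee_fin fineK// ge0_fin_numE//.
by apply: le_lt_trans ne _; rewrite ltry.
Qed.

(** Continuity of [F] in the dual norm makes the sampled step functions converge at every time, and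
    the norm is at most [C] on an interval of length [T]. *)
Lemma bochner_L2 : L2_H1dual D T F /\ (L2_H1dual_sqnorm D T F <= (T * C ^+ 2)%:E)%E.
Proof.
have le_sq : (L2_H1dual_sqnorm D T F <= (T * C ^+ 2)%:E)%E.
  apply: (@le_trans _ _ (\int[mu]_(t in [set` `[0, T]%R]) cst (C ^+ 2)%R%:E t)%E).
    apply: ge0_le_integral_nomeas => t; rewrite /= in_itv/= => tT.
      by rewrite mule_ge0// H1dual_norm_ge0.
    have N0 : (0 <= H1dual_norm D (F t))%E by exact: H1dual_norm_ge0.
    have NC : (H1dual_norm D (F t) <= C%:E)%E by apply: H1dual_norm_le => //; exact: F_bounded.
    by rewrite expr2 EFinM lee_pmul.
  have mI : mu `[0%R, T]%classic = T%:E.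
    by rewrite lebesgue_measure_itv/= lte_fin T_gt0 sube0.
  rewrite (@integral_cst _ (measurableTypeR R)); last exact: measurable_itv.
  by rewrite [X in (_ * X)%E]mI -EFinM lee_fin mulrC.
split=> //; split.
- exact: F_dual.
- by exists s; split; [exact: s_simple|apply: aeW => t; exact: s_cvg].
- by apply: le_lt_trans le_sq _; rewrite ltry.
Qed.

End bochner.

(** * Time-dependent loads and their convergence *)

Section load_families.
Context {R : realType}.
Notation mu := (@lebesgue_measure R).
Notation mu2 := (@lebesgue2 R).
Notation field := (R * R -> R * R).
Variables a b theta l0 d rho T M : R.
Hypotheses (theta_gt0 : 0 < theta) (d_gt0 : 0 < d) (rho_gt0 : 0 < rho).
Hypotheses (theta_a : theta < a - theta) (mouth : d + rho + theta <= b / 2).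
Hypotheses (T_gt0 : 0 < T).

Let D := specimen a b theta l0 d rho.
Let LP := @layer_pairing R a b theta l0 d rho.
Let EF := @edge_functional R a b theta l0 d rho.

Variable c : R -> R -> R.
Hypothesis mc : forall t : R, 0 <= t <= T -> measurable_fun setT (c t).
Hypothesis cM : forall t x : R, 0 <= t <= T -> `|c t x| <= M.
Hypothesis c_continuous : forall t : R, 0 <= t <= T -> forall e : R, 0 < e ->
  exists2 eta : R, 0 < eta &
  forall t' x : R, 0 <= t' <= T -> `|t - t'| < eta -> `|c t' x - c t x| <= e.

Let M0 : 0 <= M.
Proof. by apply: le_trans (@cM 0 0 _) => //; rewrite lexx ltW. Qed.

Section family.
Variables (L : (R -> R) -> field -> R) (K : R).
Hypothesis K0 : 0 <= K.
Hypothesis L_linear : forall (f : R -> R) (N : R), measurable_fun setT f ->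
  (forall x, `|f x| <= N) -> forall k u v, H1field D u -> H1field D v ->
  L f (k *: u + v) = k * L f u + L f v.
Hypothesis L_le : forall (f : R -> R) (N : R), measurable_fun setT f ->
  (forall x, `|f x| <= N) -> forall w, H1field D w -> `|L f w| <= K * N * H1norm D w.
Hypothesis L_B : forall (f f' : R -> R) (N N' : R),
  measurable_fun setT f -> (forall x, `|f x| <= N) ->
  measurable_fun setT f' -> (forall x, `|f' x| <= N') -> forall w, H1field D w ->
  L (fun x => f x - f' x) w = L f w - L f' w.

(** The abstract [L] covers the layer pairing, the edge functional and their difference. By
    additivity [L (c t') - L (c t)] is [L] at the density [c t' - c t], which is uniformly small for
    [t'] near [t]. *)
Lemma family_L2 : L2_H1dual D T (fun t => L (c t)) /\
  (L2_H1dual_sqnorm D T (fun t => L (c t)) <= (T * (K * M) ^+ 2)%:E)%E.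
Proof.
apply: bochner_L2 => //.
- exact: open_specimen.
- exact: specimen_lty.
- exact: mulr_ge0.
- move=> t tT k u v [uD _] [vD _].
  exact: (L_linear (mc tT) (fun x => cM x tT)).
- by move=> t tT w [wD _]; exact: (L_le (mc tT) (fun x => cM x tT)).
- move=> t tT e e0; have K1 : 0 < K + 1 by rewrite ltr_wpDl.
  (* Dividing by [K + 1] rather than [K] allows [K = 0]. *)
  have [eta eta0 ceta] := c_continuous tT (divr_gt0 e0 K1).
  exists eta => // t' t'T tt' w [wD _].
  rewrite -(L_B (mc t'T) (fun x => cM x t'T) (mc tT) (fun x => cM x tT) wD).
  apply: le_trans (L_le _ (fun x => ceta t' x t'T tt') wD) _.
    by apply: measurable_funB; exact: mc.
  rewrite ler_wpM2r ?sqrtr_ge0// mulrCA ler_piMr ?(ltW e0)//.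
  by rewrite ler_pdivrMr// mul1r lerDl.
Qed.

End family.

Lemma layer_family_L2 (delta : R) : 0 < delta ->
  L2_H1dual D T (fun t => LP delta (c t)).
Proof.
move=> delta0.
apply: (@family_L2 (LP delta) (pairing_bound a b theta l0 d rho) _ _ _ _).1.
- by apply: ltW; exact: pairing_bound_gt0.
- by move=> f N mf fN k u v uD vD; exact: (layer_pairing_linear mf fN).
- by move=> f N mf fN w wD; exact: layer_pairing_uniform_le.
- by move=> f f' N N' mf fN mf' fN' w wD; exact: layer_pairingB.
Qed.

Lemma edge_family_L2 : L2_H1dual D T (fun t => EF (c t)).
Proof.
apply: (@family_L2 EF (pairing_bound a b theta l0 d rho) _ _ _ _).1.
- by apply: ltW; exact: pairing_bound_gt0.
- by move=> f N mf fN k u v uD vD; exact: edge_functional_linear.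
- by move=> f N mf fN w wD; exact: edge_functional_le.
- by move=> f f' N N' mf fN mf' fN' w wD; exact: edge_functionalB.
Qed.

Let rate (delta : R) := 2 * Num.sqrt ((a - theta - theta) * delta).

(** Written in the shape [k *: u + v] of the linearity clause of [bounded_functional], so that [Phi]
    can be split along it. *)
Let diff (delta : R) : R -> field -> R :=
  (-1) *: (fun t => EF (c t)) + (fun t => LP delta (c t)).

Lemma difference_family_L2 (delta : R) : 0 < delta <= theta ->
  L2_H1dual D T (diff delta) /\
  (L2_H1dual_sqnorm D T (diff delta) <=
   (T * (rate delta * M) ^+ 2)%:E)%E.
Proof.
move=> dd; have /andP[delta0 _] := dd.
have -> : diff delta =
    (fun t w => LP delta (c t) w - EF (c t) w).
  by apply/funext => t; apply/funext => w; rewrite /diff/= addrC scaleN1r.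
apply: (@family_L2 (fun f w => LP delta f w - EF f w)).
- by rewrite /rate mulr_ge0// sqrtr_ge0.
- move=> f N mf fN k u v uD vD.
  rewrite /EF (edge_functional_linear theta_gt0 d_gt0 rho_gt0 theta_a mouth mf fN)//.
  by rewrite /LP (layer_pairing_linear mf fN)// mulrBr opprD addrACA.
- move=> f N mf fN w wD; rewrite /rate [2 * _ * N]mulrAC; exact: edge_functional_rate.
- move=> f f' N N' mf fN mf' fN' w wD.
  rewrite /EF (edge_functionalB theta_gt0 d_gt0 rho_gt0 theta_a mouth mf fN mf' fN' wD).
  by rewrite /LP (layer_pairingB delta0 mf fN mf' fN' wD) !opprD !opprK addrACA.
Qed.

(** Convergence in norm: once [eps n <= theta], the L^2 norm of the difference is at most [sqrt T]
    times the uniform rate, and a bounded functional multiplies this by a constant. *)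
Lemma weakly_cvg_layer_families (eps : nat -> R) : (forall n, 0 < eps n) ->
  eps n @[n --> \oo] --> 0 ->
  weakly_cvg (L2_H1dual D T) (L2_H1dual_norm D T)
    (fun n t => LP (eps n) (c t)) (fun t => EF (c t)).
Proof.
move=> eps0 epsc Phi [Phi_linear [C PhiC]].
have inner : (a - theta - theta) * eps n @[n --> \oo] --> (0 : R).
  by rewrite -[X in _ --> X](mulr0 (a - theta - theta)); apply: cvgM => //; exact: cvg_cst.
(* The constant of a bounded functional may be negative, hence the absolute value. *)
have rate_cvg : `|C| * (Num.sqrt T * (rate (eps n) * M)) @[n --> \oo] --> (0 : R).
  rewrite -[X in _ --> X](mulr0 `|C|); apply: cvgM; first exact: cvg_cst.
  rewrite -[X in _ --> X](mulr0 (Num.sqrt T)); apply: cvgM; first exact: cvg_cst.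
  rewrite -[X in _ --> X](mul0r M); apply: cvgM; last exact: cvg_cst.
  rewrite -[X in _ --> X](mulr0 2); apply: cvgM; first exact: cvg_cst.
  rewrite -[X in _ --> X]sqrtr0.
  by apply: (cvg_comp _ _ inner); exact: sqrt_continuous.
apply/cvgrPdist_le => e e0.
have le_theta : \forall n \near \oo, eps n <= theta.
  by move/cvgr_le: epsc => /(_ _ theta_gt0).
move/cvgr_le: rate_cvg => /(_ _ e0); apply: filterS2 le_theta => n nt; apply: le_trans.
have dd : 0 < eps n <= theta by rewrite eps0.
have [GL2 Gsq] := difference_family_L2 dd.
have -> : `|Phi (fun t => EF (c t)) - Phi (fun t => LP (eps n) (c t))| =
    `|Phi (diff (eps n))|.
  rewrite /diff Phi_linear; [|exact: edge_family_L2|exact: layer_family_L2].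
  by rewrite mulN1r distrC addrC.
apply: le_trans (PhiC _ GL2) _.
have N0 : 0 <= L2_H1dual_norm D T (diff (eps n)).
  exact: sqrtr_ge0.
apply: le_trans (ler_wpM2r N0 (ler_norm C)) _.
rewrite ler_wpM2l// /L2_H1dual_norm.
have KM0 : 0 <= rate (eps n) * M by rewrite mulr_ge0// /rate mulr_ge0// sqrtr_ge0.
apply: (@le_trans _ _ (Num.sqrt (T * (rate (eps n) * M) ^+ 2))).
  rewrite ler_wsqrtr// -lee_fin fineK//.
  rewrite ge0_fin_numE; first by apply: le_lt_trans Gsq _; rewrite ltry.
  apply: integral_ge0 => t _; rewrite expe2 mule_ge0//;
    by apply: H1dual_norm_ge0; [exact: open_specimen|exact: specimen_lty].
by rewrite sqrtrM ?(ltW T_gt0)// sqrtr_sqr ger0_norm.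
Qed.

End load_families.

(** * The load and the traction *)

Section load.
Context {R : realType}.
Variables (p q T : R) (g : R * R -> R) (O : set (R * R)).
Hypotheses (oO : open O) (cg : forall z, O z -> {for z, continuous g}).
Hypothesis Osub : forall x t : R, p <= x <= q -> 0 <= t <= T -> O (x, t).

Lemma measurable_load t : 0 <= t <= T ->
  measurable_fun `[p, q] (fun x => g (x, t)).
Proof.
move=> tT.
have pc : continuous (fun x : R => (x, t)).
  by move=> x; exact: (cvg_pair (@cvg_id _ (nbhs x)) (@cvg_cst _ t _ _ _)).
have oOt : open ((fun x : R => (x, t)) @^-1` O) by apply: open_comp => // x _; exact: pc.
apply: (@measurable_funS _ _ _ _ ((fun x : R => (x, t)) @^-1` O)).
- exact: open_measurable.
- by move=> x; rewrite /= in_itv/= => xpq; exact: Osub.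
apply: open_continuous_measurable_fun => // x /set_mem Ox.
by apply: (@continuous_comp _ _ _ (fun x : R => (x, t)) g); [exact: pc|exact: cg].
Qed.

(** Continuity of [g] at the points [(x, t)] gives product neighbourhoods, and compactness of
    [[p, q]] extracts one time radius valid for all [x]. *)
Lemma load_continuous t e : 0 <= t <= T -> 0 < e ->
  exists2 eta : R, 0 < eta & forall t' x, 0 <= t' <= T -> `|t - t'| < eta ->
    p <= x <= q -> `|g (x, t') - g (x, t)| <= e.
Proof.
move=> tT e0.
have := @segment_compact R p q => /compact_near_coveringP.
move=> /(_ R (nbhs t) (fun t' x => `|g (x, t') - g (x, t)| <= e) _) cov.
have : \forall t' \near t, forall x, `[p, q]%classic x -> `|g (x, t') - g (x, t)| <= e.
  apply: cov => x; rewrite /= in_itv/= => xpq.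
  have := cg (Osub xpq tT) => /cvgrPdist_le/(_ _ (divr_gt0 e0 (ltr0n R 2))).
  case=> -[U V] /= [Ux Vt] UV.
  exists (U, V) => // -[x' t'] /= [Ux' Vt'].
  have h1 := UV (x', t') (conj Ux' Vt').
  (* Both [(x', t')] and [(x', t)] are compared with the centre [(x, t)], each within [e / 2]. *)
  have h2 := UV (x', t) (conj Ux' (nbhs_singleton Vt)).
  have -> : g (x', t') - g (x', t) = (g (x, t) - g (x', t)) - (g (x, t) - g (x', t')).
    by rewrite opprB [RHS]addrC addrA subrK.
  by apply: le_trans (ler_normB _ _) _; rewrite [leRHS]splitr; exact: lerD.
move=> /nbhs_ballP[eta /= eta0 He]; exists eta => // t' x t'T tt' xpq.
by apply: He => //=; rewrite in_itv.
Qed.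

End load.

Section line_integrals.
Context {R : realType}.
Notation mu := (@lebesgue_measure R).
Notation T1 := (measurableTypeR R).
Variables (h : R) (J : set R).
Hypothesis mJ : measurable J.
Notation E := ((fun x : R => (x, h)) @` J).

Lemma measurable_fun_line d (T : sigmaRingType d) (f : R * R -> T) :
  measurable_fun J (fun x => f (x, h)) -> measurable_fun E f.
Proof.
move=> mf.
apply: (@eq_measurable_fun _ _ _ _ E (fun z => f (z.1, h))).
  by move=> z /set_mem[x _ <-].
apply: (@measurable_comp _ _ _ _ _ _ J (fun x => f (x, h)) E fst) => //.
  by move=> x [z [y Jy <-] <-].
by apply: measurable_funTS; exact: measurable_fst.
Qed.

Lemma integrable_line (f : R * R -> R) :
  mu.-integrable J (EFin \o (fun x => f (x, h))) ->
  hausdorff1.-integrable E (EFin \o f) /\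
  \int[hausdorff1]_(z in E) f z = \int[mu]_(x in J) f (x, h).
Proof.
move=> /(@integrableP _ T1)[mf foo].
have mfE : measurable_fun E (EFin \o f) by exact: measurable_fun_line.
split.
  apply/integrableP; split => //.
  rewrite (@ge0_integral_line _ h J (fun z => `|(EFin \o f) z|%E))//.
  exact: measurableT_comp.
have pos := @ge0_integral_line _ h J (EFin \o f)^\+%E mJ (measurable_funepos mfE)
  (funepos_ge0 _).
have neg := @ge0_integral_line _ h J (EFin \o f)^\-%E mJ (measurable_funeneg mfE)
  (funeneg_ge0 _).
rewrite /Rintegral [in LHS]integralE [in RHS]integralE.
congr (fine (_ - _)%E).
  by apply: (etrans pos); apply: eq_integral => x _; rewrite !funeposE.
by apply: (etrans neg); apply: eq_integral => x _; rewrite !funenegE.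
Qed.

End line_integrals.

Section two_lines.
Context {R : realType}.
Notation mu := (@lebesgue_measure R).
Notation T1 := (measurableTypeR R).

Lemma patch_indicE (E : set (R * R)) (f : R * R -> R) z : (f \_ E) z = f z * \1_E z.
Proof. by rewrite patchE indicE; case: (_ \in _); rewrite ?mulr1 ?mulr0. Qed.

Lemma integrable_patch (E S : set (R * R)) (f : R * R -> R) :
  measurable E -> measurable S -> E `<=` S ->
  hausdorff1.-integrable E (EFin \o f) ->
  hausdorff1.-integrable S (EFin \o (f \_ E)) /\
  \int[hausdorff1]_(z in S) (f \_ E) z = \int[hausdorff1]_(z in E) f z.
Proof.
move=> mE mS ES fE; split.
  by rewrite -restrict_EFin; apply: (integrable_restrict _ mE mS _).1; rewrite setIidr.
rewrite [LHS]Rintegral_mkcond [RHS]Rintegral_mkcond; apply: eq_Rintegral => z _.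
rewrite patchE; case: ifPn => // zS; rewrite patchE ifN//.
by apply: contra zS => /set_mem/ES zS; exact/mem_set.
Qed.

(** Signed sum over two segments of the boundary: the shape of any pairing with the traction,
    whether with a trace or with an H^{1/2} field. *)
Lemma integrable_two_lines (S : set (R * R)) (J : set R) (h1 h2 : R) (f : R * R -> R) :
  measurable S -> measurable J ->
  (fun x => (x, h1)) @` J `<=` S -> (fun x => (x, h2)) @` J `<=` S ->
  mu.-integrable J (EFin \o (fun x => f (x, h1))) ->
  mu.-integrable J (EFin \o (fun x => f (x, h2))) ->
  let F := fun z => f z * (\1_((fun x => (x, h1)) @` J) z - \1_((fun x => (x, h2)) @` J) z) in
  hausdorff1.-integrable S (EFin \o F) /\
  \int[hausdorff1]_(z in S) F z =
    \int[mu]_(x in J) f (x, h1) - \int[mu]_(x in J) f (x, h2).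
Proof.
move=> mS mJ S1 S2 f1 f2 F.
have [i1 <-] := integrable_line mJ f1; have [i2 <-] := integrable_line mJ f2.
have [j1 <-] := integrable_patch (measurable_line h1 mJ) mS S1 i1.
have [j2 <-] := integrable_patch (measurable_line h2 mJ) mS S2 i2.
have -> : F = (fun z => (f \_ ((fun x => (x, h1)) @` J)) z - (f \_ ((fun x => (x, h2)) @` J)) z).
  by apply/funext => z; rewrite /F !patch_indicE mulrBr.
by split; [exact: integrableR_B|rewrite RintegralB].
Qed.

End two_lines.

(** * The edge functional as a boundary integral *)

Section traction_pairing.
Context {R : realType}.
Notation mu := (@lebesgue_measure R).
Notation mu2 := (@lebesgue2 R).
Notation T1 := (measurableTypeR R).
Notation T2 := (T1 * T1)%type.

(** Reconciles the closed edges that carry the traction with the open interval over which the layers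
    stand and the trace is identified. *)
Lemma integrable_itv_closure (p q : R) (f : R -> R) : measurable_fun `[p, q] f ->
  mu.-integrable `]p, q[ (EFin \o f) ->
  mu.-integrable `[p, q] (EFin \o f) /\
  \int[mu]_(x in `[p, q]) f x = \int[mu]_(x in `]p, q[) f x.
Proof.
move=> mf /(@integrableP _ T1)[mfo foo].
split; last by rewrite /Rintegral integral_itv_bndoo.
apply/(@integrableP _ T1); split; first exact/measurable_EFinP.
rewrite integral_itv_bndoo//.
exact: measurableT_comp.
Qed.

Lemma dot_scale_e2 (k : R) (v : R * R) : dot (k *: e2) v = k * v.2.
Proof.
by rewrite /dot/= scaler0 mul0r add0r; congr (_ * _); exact: mulr1.
Qed.

Variables (a b theta l0 d rho T M : R) (g : R * R -> R) (O : set (R * R)).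
Hypotheses (theta_gt0 : 0 < theta) (d_gt0 : 0 < d) (rho_gt0 : 0 < rho).
Hypotheses (theta_a : theta < a - theta) (mouth : d + rho + theta <= b / 2).
Hypotheses (oO : open O) (cg : forall z, O z -> {for z, continuous g}).
Hypothesis Osub : forall x t : R, theta <= x <= a - theta -> 0 <= t <= T -> O (x, t).
Hypothesis gM : forall x t : R, theta <= x <= a - theta -> 0 <= t <= T -> `|g (x, t)| <= M.

Let D := specimen a b theta l0 d rho.
Let I := `]theta, (a - theta)[%classic.
Let J := `[theta, (a - theta)]%classic.
Let mD : measurable D := open_measurable2 (@open_specimen R a b theta l0 d rho).
Let Dfin : (mu2 D < +oo)%E := @specimen_lty R a b theta l0 d rho.

(** Bounds on [g] are known only over the edge; extension by zero yields a bounded measurable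
    density on the whole line, and the layers see no difference. *)
Definition load_density (t : R) : R -> R := (fun x => g (x, t)) \_ I.

Let IJ x : I x -> theta <= x <= a - theta.
Proof. by rewrite /I/= in_itv/= => /andP[? ?]; rewrite !ltW. Qed.

Let M_ge0 t : 0 <= t <= T -> 0 <= M.
Proof. by move=> tT; apply: le_trans (gM (x := theta) _ tT) => //; rewrite lexx ltW. Qed.

Lemma measurable_load_density t : 0 <= t <= T -> measurable_fun setT (load_density t).
Proof.
move=> tT; apply/(measurable_restrictT _ _).1; first exact: measurable_itv.
apply: measurable_funS (measurable_load oO cg Osub tT); first exact: measurable_itv.
by move=> x /IJ; rewrite /= in_itv.
Qed.

Lemma load_density_le t x : 0 <= t <= T -> `|load_density t x| <= M.
Proof.
move=> tT; rewrite /load_density patchE; case: ifPn => [/set_mem/IJ xI|_].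
  exact: gM.
by rewrite normr0; exact: M_ge0 tT.
Qed.

Lemma load_density_continuous t : 0 <= t <= T -> forall e, 0 < e ->
  exists2 eta : R, 0 < eta &
  forall t' x, 0 <= t' <= T -> `|t - t'| < eta -> `|load_density t' x - load_density t x| <= e.
Proof.
move=> tT e e0; have [eta eta0 H] := load_continuous cg Osub tT e0.
exists eta => // t' x t'T tt'; rewrite /load_density !patchE; case: ifPn => [/set_mem/IJ xI|_].
  exact: H.
by rewrite subrr normr0 ltW.
Qed.

Lemma body_force_pairing eps t w :
  \int[mu2]_(z in D) dot (body_force a b theta g eps t z) (w z) =
  layer_pairing a b theta l0 d rho eps (load_density t) w.
Proof.
apply: eq_Rintegral => z _; rewrite /body_force dot_scale_e2 /layer_sign /load_density patchE.
case: ifPn => // zI.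
have nI : ~ I z.1 by move=> Iz; move: zI; rewrite mem_set.
rewrite !indicE !memNset ?subrr ?mulr0 ?mul0r//; rewrite ?top_layerE ?bottom_layerE.
  by case.
by case.
Qed.

Let trace_edge s w : H1field D w ->
  mu.-integrable J (EFin \o (fun x => trace D (snd \o w) (x, edge_height b s))) .
Proof.
move=> wD; apply: (integrable_itv_closure _ _).1.
  apply: measurable_funTS; apply: measurable_trace_line.
  - exact: mD.
  - exact: Dfin.
  - by case: wD => _ [[]].
  - have [_ [[mw fw] _ _]] := wD.
    exact: (@integrable_of_sqr _ T2 _ mu2 _ _ mD Dfin mw fw).
exact: (edge_trace_estimate mD Dfin
  theta_gt0 theta_a (layer_specimen l0 theta_gt0 d_gt0 rho_gt0 mouth (s := s))
  (@specimen_side R a b theta l0 d rho s) wD.2).1.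
Qed.

Lemma top_edgeE : top_edge a b theta = (fun x => (x, b / 2)) @` J.
Proof.
apply/seteqP; split=> [[x y] [/= xI ->]|_ [x xI <-]]; first by exists x => //; rewrite /J/= in_itv.
by move: xI; rewrite /J/= in_itv.
Qed.

Lemma bottom_edgeE : bottom_edge a b theta = (fun x => (x, - (b / 2))) @` J.
Proof.
apply/seteqP; split=> [[x y] [/= xI ->]|_ [x xI <-]]; first by exists x => //; rewrite /J/= in_itv.
by move: xI; rewrite /J/= in_itv.
Qed.

Lemma dot_traction t (v x : R * R) : dot (traction a b theta g t x) v =
  g (x.1, t) * v.2 *
    (\1_((fun x => (x, b / 2)) @` J) x - \1_((fun x => (x, - (b / 2))) @` J) x).
Proof.
by rewrite /traction dot_scale_e2 top_edgeE bottom_edgeE mulrAC.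
Qed.

Lemma edge_sub_frontier s : (fun x => (x, edge_height b s)) @` J `<=` frontier D.
Proof.
move=> _ [x xJ <-]; apply: (edge_frontier l0 theta_gt0 d_gt0 rho_gt0 mouth).
by move: xJ; rewrite /J/= in_itv.
Qed.

(** The traction lives on two horizontal segments of the frontier, where the boundary integral
    becomes two Lebesgue integrals of load times trace; these are the two terms of
    [edge_pairing]. *)
Lemma traction_pairing t w : 0 <= t <= T -> H1field D w ->
  hausdorff1.-integrable (frontier D)
    (fun x => (dot (traction a b theta g t x) (vtrace D w x))%:E) /\
  edge_functional a b theta l0 d rho (load_density t) w =
  \int[hausdorff1]_(x in frontier D) dot (traction a b theta g t x) (vtrace D w x).
Proof.
move=> tT wD; pose f z := g (z.1, t) * trace D (snd \o w) z.
have mJ : measurable J by exact: measurable_itv.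
have mgJ : measurable_fun J (fun x => g (x, t)) by exact: (measurable_load oO cg Osub).
have fJ s : mu.-integrable J (EFin \o (fun x => f (x, edge_height b s))).
  have -> : (fun x => f (x, edge_height b s)) =
      (fun x => trace D (snd \o w) (x, edge_height b s) * g (x, t)).
    by apply/funext => x; rewrite /f mulrC.
  apply: (@integrable_boundedM _ T1 _ mu _ _ _ M) => //.
    by move=> x; rewrite /J/= in_itv/= => xJ; exact: gM.
  exact: trace_edge.
have [Fi Fint] := integrable_two_lines (measurable_frontier D) mJ
  (@edge_sub_frontier true) (@edge_sub_frontier false) (fJ true) (fJ false).
have FE : (fun x => dot (traction a b theta g t x) (vtrace D w x)) = (fun z => f z *
    (\1_((fun x => (x, edge_height b true)) @` J) z -
     \1_((fun x => (x, edge_height b false)) @` J) z)).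
  by apply/funext => x; rewrite dot_traction.
split; first by move: Fi; rewrite -FE.
have -> : \int[hausdorff1]_(x in frontier D) dot (traction a b theta g t x) (vtrace D w x) =
  \int[hausdorff1]_(x in frontier D) (f x *
    (\1_((fun x => (x, edge_height b true)) @` J) x -
     \1_((fun x => (x, edge_height b false)) @` J) x)).
  by apply: eq_Rintegral => x _; rewrite dot_traction.
rewrite Fint (edge_functionalE theta_gt0 d_gt0 rho_gt0 theta_a mouth
  (measurable_load_density tT) (fun x => load_density_le x tT) wD) /edge_pairing.
have E s : \int[mu]_(x in J) f (x, edge_height b s) =
    \int[mu]_(x in I) (load_density t x * trace D (snd \o w) (x, edge_height b s)).
  rewrite (integrable_itv_closure _ _).2.
  - by apply: eq_Rintegral => x xI; rewrite /load_density patchE xI.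
  - by move: (fJ s) => /(@measurable_int _ T1)/measurable_EFinP.
  - exact: (@integrableS _ T1 _ mu _ _ _ mJ _ _ (fJ s)).
exact: (congr2 (fun x y : R => x - y) (esym (E true)) (esym (E false))).
Qed.

End traction_pairing.

(** * The traction belongs to H^{-1/2} *)

Section traction_Hmhalf.
Context {R : realType}.
Notation mu := (@lebesgue_measure R).
Notation T1 := (measurableTypeR R).

Section edge_values.
Variables (S : set (R * R)) (h : R) (J : set R) (v : R * R -> R * R).
Hypotheses (mS : measurable S) (mJ : measurable J) (JS : (fun x => (x, h)) @` J `<=` S).
Hypothesis Jfin : (mu J < +oo)%E.
Hypothesis vS : Hhalf S v.

Lemma measurable_edge_values : measurable_fun J (fun x => (v (x, h)).2).
Proof.
have [_ mv _] := vS.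
have mE := measurable_line h mJ.
apply: (@measurable_comp _ _ _ _ _ _ _ (snd \o v) J (fun x => (x, h)) mE) => //.
  exact: measurable_funS mS JS mv.
by apply: measurable_funTS; exact: measurable_iota.
Qed.

(** The square of the H^{1/2} norm contains the L^2 part over the whole boundary; the double
    integral, the rest of the boundary and the first component are nonnegative and are dropped. *)
Lemma edge_values_sqr_le :
  (\int[mu]_(x in J) ((v (x, h)).2 ^+ 2)%:E <= Hhalf_sqnorm S v)%E.
Proof.
have msq : measurable_fun ((fun x => (x, h)) @` J) (fun z => ((v z).2 ^+ 2)%:E).
  apply: measurable_fun_line => //; apply/measurable_EFinP.
  by apply: measurable_funX; exact: measurable_edge_values.
rewrite -(@ge0_integral_line _ h J (fun z => ((v z).2 ^+ 2)%:E))//; last first.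
  by move=> z; rewrite lee_fin sqr_ge0.
apply: (@le_trans _ _ (\int[hausdorff1]_(x in S) (eucl_dist (v x) 0 ^+ 2)%:E)%E); last first.
  rewrite /Hhalf_sqnorm leeDl//; apply: integral_ge0 => x _; apply: integral_ge0 => y _.
  by rewrite lee_fin mulr_ge0 ?invr_ge0 ?sqr_ge0.
rewrite [leLHS]integral_mkcond [leRHS]integral_mkcond; apply: ge0_le_integral_nomeas.
  by move=> z _; apply: erestrict_ge0 => x _; rewrite lee_fin sqr_ge0.
move=> z _; rewrite !patchE; case: ifPn => [/set_mem/JS Sz|_].
  rewrite (mem_set Sz) lee_fin /eucl_dist/= !subr0 sqr_sqrtr ?addr_ge0 ?sqr_ge0//.
  by rewrite lerDr sqr_ge0.
by case: ifP => // _; rewrite lee_fin sqr_ge0.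
Qed.

Let sqr_lty : (\int[mu]_(x in J) ((v (x, h)).2 ^+ 2)%:E < +oo)%E.
Proof. by have [_ _] := vS; exact: le_lt_trans edge_values_sqr_le. Qed.

Lemma integrable_edge_values : mu.-integrable J (EFin \o (fun x => (v (x, h)).2)).
Proof. exact: (@integrable_of_sqr _ T1 _ mu _ _ mJ Jfin measurable_edge_values sqr_lty). Qed.

Lemma edge_values_norm_le : \int[mu]_(x in J) `|(v (x, h)).2| <=
  Num.sqrt (fine (mu J)) * Hhalf_norm S v.
Proof.
apply: le_trans (@Rintegral_norm_le_sqrt _ T1 _ mu _ _ mJ Jfin measurable_edge_values sqr_lty) _.
rewrite ler_wpM2l ?sqrtr_ge0// /Hhalf_norm ler_wsqrtr// /Rintegral.
have sq0 : (0 <= \int[mu]_(x in J) ((v (x, h)).2 ^+ 2)%:E)%E.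
  by apply: integral_ge0 => x _; rewrite lee_fin sqr_ge0.
have [_ _ Soo] := vS.
apply: fine_le; last exact: edge_values_sqr_le.
  by rewrite ge0_fin_numE.
by rewrite ge0_fin_numE//; exact: le_trans edge_values_sqr_le.
Qed.

End edge_values.

Variables (a b theta l0 d rho T M : R) (g : R * R -> R) (O : set (R * R)).
Hypotheses (theta_gt0 : 0 < theta) (d_gt0 : 0 < d) (rho_gt0 : 0 < rho).
Hypotheses (theta_a : theta < a - theta) (mouth : d + rho + theta <= b / 2).
Hypotheses (oO : open O) (cg : forall z, O z -> {for z, continuous g}).
Hypothesis Osub : forall x t : R, theta <= x <= a - theta -> 0 <= t <= T -> O (x, t).
Hypothesis gM : forall x t : R, theta <= x <= a - theta -> 0 <= t <= T -> `|g (x, t)| <= M.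

Let D := specimen a b theta l0 d rho.
Let S := frontier D.
Let J := `[theta, (a - theta)]%classic.
Let mS : measurable S := measurable_frontier D.
Let mJ : measurable J := measurable_itv _.
Let Jfin : (mu J < +oo)%E := lebesgue_measure_bnd_lty _ _ _ _.
Let JS s : (fun x => (x, edge_height b s)) @` J `<=` S :=
  @edge_sub_frontier R a b theta l0 d rho theta_gt0 d_gt0 rho_gt0 mouth s.

Variable t : R.
Hypothesis tT : 0 <= t <= T.

Let f (v : R * R -> R * R) (z : R * R) := g (z.1, t) * (v z).2.

Let f_integrable v s : Hhalf S v ->
  mu.-integrable J (EFin \o (fun x => f v (x, edge_height b s))).
Proof.
move=> vS; have -> : (fun x => f v (x, edge_height b s)) =
    (fun x => (v (x, edge_height b s)).2 * g (x, t)).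
  by apply/funext => x; rewrite /f mulrC.
apply: (@integrable_boundedM _ T1 _ mu _ _ _ M) => //.
- exact: (measurable_load oO cg Osub).
- by move=> x; rewrite /J/= in_itv/= => xJ; exact: gM.
- exact: (integrable_edge_values mS mJ (@JS s) Jfin vS).
Qed.

Let f_le v s : Hhalf S v -> `|\int[mu]_(x in J) f v (x, edge_height b s)| <=
  M * (Num.sqrt (fine (mu J)) * Hhalf_norm S v).
Proof.
move=> vS.
have M0 : 0 <= M.
  by apply: le_trans (gM (x := theta) _ tT) => //; rewrite lexx ltW.
have vi := integrable_edge_values mS mJ (@JS s) Jfin vS.
apply: (le_trans (@le_normr_Rintegral _ T1 _ mu _ _ mJ (f_integrable s vS))).
apply: (@le_trans _ _ (M * \int[mu]_(x in J) `|(v (x, edge_height b s)).2|)).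
  rewrite -(@RintegralZl _ T1 _ mu _ _ _ mJ (@integrableR_norm _ T1 _ mu _ _ mJ vi)).
  apply: (@le_Rintegral _ T1) => //.
  - exact: (@integrableR_norm _ T1 _ mu _ _ mJ (f_integrable s vS)).
  - exact: (@integrableR_Z _ T1 _ mu _ _ _ mJ (@integrableR_norm _ T1 _ mu _ _ mJ vi)).
  - move=> x; rewrite /J/= in_itv/= => xJ; rewrite /f normrM ler_wpM2r//; exact: gM.
by rewrite ler_wpM2l//; exact: (edge_values_norm_le mS mJ (@JS s) Jfin vS).
Qed.

Let pairing v : Hhalf S v ->
  hausdorff1.-integrable S (EFin \o (fun x => dot (traction a b theta g t x) (v x))) /\
  \int[hausdorff1]_(x in S) dot (traction a b theta g t x) (v x) =
  \int[mu]_(x in J) f v (x, edge_height b true) -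
  \int[mu]_(x in J) f v (x, edge_height b false).
Proof.
move=> vS.
have -> : (fun x => dot (traction a b theta g t x) (v x)) = (fun z => f v z *
    (\1_((fun x => (x, edge_height b true)) @` J) z -
     \1_((fun x => (x, edge_height b false)) @` J) z)).
  by apply/funext => x; rewrite dot_traction.
exact: (integrable_two_lines mS mJ (@JS true) (@JS false)
  (f_integrable true vS) (f_integrable false vS)).
Qed.

(** The load is bounded by [M] on each of the two edges, and Cauchy-Schwarz on an edge gives the
    square root of its length; hence the constant below. *)
Lemma traction_in_Hmhalf : in_Hmhalf S (traction a b theta g t).
Proof.
split; first by move=> v /pairing[].
split.
  move=> k u v /pairing[ui _] /pairing[vi _].
  rewrite -(RintegralZl _ mS ui) -(RintegralD mS (integrableR_Z _ mS ui) vi).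
  apply: eq_Rintegral => x _; rewrite /traction !dot_scale_e2 /=.
  by rewrite mulrDr; congr (_ + _); exact: mulrCA.
exists (2 * (M * Num.sqrt (fine (mu J)))) => v vS.
rewrite (pairing vS).2; apply: le_trans (ler_normB _ _) _.
rewrite -mulrA mulr_natl mulr2n -mulrA; apply: lerD; exact: f_le.
Qed.

End traction_Hmhalf.

Theorem lemma3p1 (R : realType) (a b T theta l0 d rho : R)
    (ha : 0 < a) (hb : 0 < b) (hT : 0 < T)
    (htheta : 0 < theta) (htheta_a : 2 * theta < a) (htheta_b : 2 * theta < b)
    (hd : 0 < d) (hrho : 0 < rho) (hmouth : d + rho + theta <= b / 2)
    (hlength : rho + d <= l0) (htip : l0 < a)
    (g : R * R -> R) (O : set (R * R)) (hO : open O)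
    (hO_sub : forall x1 t, theta <= x1 <= a - theta -> 0 <= t <= T -> O (x1, t))
    (hg_smooth : smooth_on O g)
    (hg_pos : forall x1 t, theta <= x1 <= a - theta -> 0 <= t <= T ->
      0 < g (x1, t))
    (hg_bounded : exists M, forall x1 t,
      theta <= x1 <= a - theta -> 0 <= t <= T -> g (x1, t) <= M)
    (eps : nat -> R) (heps_pos : forall n, 0 < eps n)
    (heps_cvg : eps n @[n --> \oo] --> 0) :
  let D := specimen a b theta l0 d rho in
  let beps n t (w : R * R -> R * R) :=
    \int[lebesgue2]_(x in D) dot (body_force a b theta g (eps n) t x) (w x) in
  (exists2 C, 0 < C & forall n t w, 0 <= t <= T -> H1dot D w ->
     `|beps n t w| <= C * H1norm D w) /\
  (exists b0 : R -> (R * R -> R * R) -> R,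
     [/\ forall n, L2_H1dual D T (beps n),
         L2_H1dual D T b0,
         weakly_cvg (L2_H1dual D T) (L2_H1dual_norm D T) beps b0,
         forall t w, 0 <= t <= T -> H1dot D w ->
           hausdorff1.-integrable (frontier D)
             (fun x => (dot (traction a b theta g t x) (vtrace D w x))%:E) /\
           b0 t w = \int[hausdorff1]_(x in frontier D)
             dot (traction a b theta g t x) (vtrace D w x)
       & forall t, 0 <= t <= T ->
           in_Hmhalf (frontier D) (traction a b theta g t)]).
Proof.
move=> D beps.
have theta_a : theta < a - theta by lra.
have cg z : O z -> {for z, continuous g} by exact: (hg_smooth 0%N).1.
have [M gM] := hg_bounded.
have absgM (x t : R) : theta <= x <= a - theta -> 0 <= t <= T -> `|g (x, t)| <= M.
  by move=> xI tT; rewrite gtr0_norm ?hg_pos// gM.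
(* Positivity of the load at one point of the edge makes the final constant strictly positive. *)
have M_gt0 : 0 < M.
  have zT : 0 <= (0 : R) <= T by rewrite lexx ltW.
  have tI : theta <= theta <= a - theta by rewrite lexx ltW.
  exact: lt_le_trans (hg_pos _ _ tI zT) (gM _ _ tI zT).
pose c := load_density a theta g.
have mc (t : R) : 0 <= t <= T -> measurable_fun setT (c t).
  exact: (measurable_load_density hO cg hO_sub).
have cM (t x : R) : 0 <= t <= T -> `|c t x| <= M by exact: load_density_le.
have cc := load_density_continuous cg hO_sub.
have bepsE : beps = fun n t => layer_pairing a b theta l0 d rho (eps n) (c t).
  by apply/funext => n; apply/funext => t; apply/funext => w; exact: body_force_pairing.
split.
  exists (pairing_bound a b theta l0 d rho * M).
    by rewrite mulr_gt0// pairing_bound_gt0.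
  move=> n t w tT [wD _]; rewrite bepsE.
  exact: (layer_pairing_uniform_le htheta hd hrho theta_a hmouth (mc t tT)
    (fun x => cM t x tT) (heps_pos n) wD).
exists (fun t => edge_functional a b theta l0 d rho (c t)); split.
- by move=> n; rewrite bepsE; exact: (layer_family_L2 l0 htheta hd hrho theta_a hmouth hT mc cM cc (heps_pos n)).
- exact: (edge_family_L2 l0 htheta hd hrho theta_a hmouth hT mc cM cc).
- by rewrite bepsE; exact: (weakly_cvg_layer_families htheta hd hrho theta_a hmouth hT mc cM cc heps_pos heps_cvg).
- move=> t w tT [wD _].
  exact: (traction_pairing htheta hd hrho theta_a hmouth hO cg hO_sub absgM tT wD).
- move=> t tT.
  exact: (traction_in_Hmhalf l0 htheta hd hrho theta_a hmouth hO cg hO_sub absgM tT).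
Qed.
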